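(* For every $\kappa>0$ there exists a number $A(\kappa)<\infty$ such that for every $a\ge A(\kappa)$ the set $\{\lambda_k(a)\}_{k=0,1,2,\ldots}$ of eigenvalues of the truncated Fourier operator $\mathscr{F}_{[-a,a]}$ forms a $\kappa$-net in the cross $[-1,1]\cup[-i,i]\subset\mathbb{C}$ with the vertices $1,\,i,\,-1,\,-i$.
   Context: For $a>0$, the truncated Fourier operator $\mathscr{F}_{[-a,a]}:L^2([-a,a])\to L^2([-a,a])$ is defined by $$(\mathscr{F}_{[-a,a]}x)(t)=\frac{1}{\sqrt{2\pi}}\int_{-a}^{a}e^{it\tau}x(\tau)\,d\tau,\qquad -a\le t\le a.$$ It is a compact normal operator, and $\{\lambda_k(a)\}_{k=0,1,2,\ldots}$ denotes the set of all its eigenvalues; these lie in the cross $[-1,1]\cup[-i,i]$, where $[-i,i]=\{is: s\in[-1,1]\}$. A subset $S$ of a set $X\subset\mathbb{C}$ is a $\kappa$-net in $X$ if every point of $X$ is at distance at most $\kappa$ from some point of $S$. *)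

(* Defs.v *)
From mathcomp Require Import all_boot all_order all_algebra.
From mathcomp Require Import all_classical all_reals all_analysis.
From mathcomp Require Import complex.

Set Implicit Arguments.
Unset Strict Implicit.
Unset Printing Implicit Defensive.

Import Order.TTheory GRing.Theory Num.Theory.
Import numFieldNormedType.Exports.

Local Open Scope classical_set_scope.
Local Open Scope ring_scope.
Local Open Scope complex_scope.

(* e^{i theta}, by Euler's formula *)
Definition expi (R : realType) (theta : R) : R[i] := cos theta +i* sin theta.

(* The Lebesgue integral of a complex-valued function is taken on real and
   imaginary parts; [Rintegral] is 0 when the integral is infinite or undefined,
   which does not occur below since L2 functions on a segment are integrable. *)
Definition Cintegral (R : realType) (D : set R) (f : R -> R[i]) : R[i] :=
  Rintegral lebesgue_measure D (fun t => complex.Re (f t)) +i*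
  Rintegral lebesgue_measure D (fun t => complex.Im (f t)).

(* Elements of the complex space L2(D) are handled through representatives
   R -> R[i], of which only the values on D matter; equality in L2(D) is [eqL2]. *)
Definition inL2 (R : realType) (D : set R) (x : R -> R[i]) : Prop :=
  [/\ measurable_fun D (fun t => complex.Re (x t)),
      measurable_fun D (fun t => complex.Im (x t)) &
      (\int[lebesgue_measure]_(t in D) ((Normc.normc (x t)) ^+ 2)%:E < +oo)%E].

Definition eqL2 (R : realType) (D : set R) (x y : R -> R[i]) : Prop :=
  {ae lebesgue_measure, forall t : R, D t -> x t = y t}.

Definition truncated_Fourier (R : realType) (a : R) (x : R -> R[i]) :
    R -> R[i] :=
  fun t => ((Num.sqrt (2 * pi))^-1)%:C *
           Cintegral `[- a, a] (fun tau => expi (t * tau) * x tau).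

Definition eigenvalues (R : realType) (D : set R)
    (T : (R -> R[i]) -> (R -> R[i])) : set R[i] :=
  [set lambda | exists x : R -> R[i],
    [/\ inL2 D x, ~ eqL2 D x (fun=> 0) &
        eqL2 D (T x) (fun t => lambda * x t)]].

Definition cross (R : realType) : set R[i] :=
  [set z | exists2 s : R, -1 <= s <= 1 & z = s%:C \/ z = 0 +i* s].

Definition is_net (R : realType) (kappa : R) (S X : set R[i]) : Prop :=
  S `<=` X /\
  forall z, X z -> exists2 w, S w & Normc.normc (z - w) <= kappa.

(* Main.v *)
(** Membership in the cross: up to a factor, an eigenfunction is bounded and
    splits into an even and an odd part, on which the operator is the real
    symmetric cosine transform, resp. [i] times the real symmetric sine transform;
    Plancherel's inequality (obtained by Abel-Poisson summation) gives the bound 1.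

    Density: in the variables [p = a - t], [r = a - tau] measured from the endpoint
    [a], the cosine and sine transforms act near the corner of the phase-space
    square like the half-line Fourier transform, which is diagonalised by dilation:
    a packet [r^(-1/2 + i eta)] on [alpha, beta] is sent to [c(eta)] times the packet
    [p^(-1/2 - i eta)] on [1/beta, 1/alpha], up to an error bounded in L2 while the
    norms grow like the logarithm of [beta / alpha].  For [u] supported in [2, beta]
    and its dual packet [v], supported in [1/beta, 1/2] and hence orthogonal to [u],
    [u + v] and [u - v] are therefore approximate eigenvectors for [|c(eta)|] and
    [-|c(eta)|].  Here [|c|] is continuous, tends to 0 at [+oo], and satisfies
    [|c(eta)|^2 + |c(-eta)|^2 >= 1] by Plancherel's theorem, so it takes all values
    in ]0, 1[.  Approximate eigenvectors yield eigenvalues because the operators are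
    compact and symmetric. *)
Require Import Defs.
From mathcomp Require Import all_boot all_order all_algebra.
From mathcomp Require Import all_classical all_reals all_analysis.
From mathcomp Require Import measurable_realfun complex ring lra.

Import Order.TTheory GRing.Theory Num.Theory.
Import numFieldNormedType.Exports.

Local Open Scope classical_set_scope.
Local Open Scope ring_scope.

Set Implicit Arguments.
Unset Strict Implicit.
Unset Printing Implicit Defensive.

(** * Bounded measurable functions and iterated integrals *)

(** All packets are real. Expanding [(L - p)(L - r) = L^2 - L p - L r + p r] shows why they carry
    the factor [cos (L r + ...)]: the carrier cancels the fast phase in [r] and leaves the half-line
    kernel [p r], while the other term of the product-to-sum formula sits at the frequency
    [2 L - p >= L] and decays. An unknown phase is always resolved into the two phases [0] and
    [- (pi / 2)], whose squares add up to 1.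

    The number [c(eta)] is the integral of [y^(-1/2 + i eta) exp (i y)] over the half-line, up to a
    phase and the factor [sqrt (2 pi)]. It decays for [eta > 0] because [y + eta ln y] then has no
    stationary point. Its lower bound comes from windows of growing logarithmic length, where only
    the coefficient of the logarithm survives and all bounded errors disappear.

    The wanted value [s] lies in general inside the spectrum, out of reach of a variational
    principle for [T]; this is why [2 s T - T^2] enters. Every estimate is uniform in the length
    [L], so the threshold depends only on [s] and on the tolerance. *)

Section BoundedMeasurable.
Context {R : realType}.
Local Notation mu := (@lebesgue_measure R).
Implicit Types (f g : R -> R) (c d : R).

(** Both conditions are imposed on the whole line, so that one predicate serves every segment, is
    stable under products and is preserved by the integral operators below. *)
Definition bmf f := measurable_fun setT f /\ exists M, forall x, `|f x| <= M.

Lemma bmf_cst (k : R) : bmf (fun=> k).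
Proof. by split; [exact: measurable_cst | exists `|k|]. Qed.

Lemma bmfD f g : bmf f -> bmf g -> bmf (fun x => f x + g x).
Proof.
move=> [mf [M fM]] [mg [N gN]]; split; first exact: measurable_funD.
by exists (M + N) => x; rewrite (le_trans (ler_normD _ _))// lerD.
Qed.

Lemma bmfM f g : bmf f -> bmf g -> bmf (fun x => f x * g x).
Proof.
move=> [mf [M fM]] [mg [N gN]]; split; first exact: measurable_funM.
by exists (M * N) => x; rewrite normrM ler_pM.
Qed.

Lemma bmfZ k f : bmf f -> bmf (fun x => k * f x).
Proof. exact/bmfM/bmf_cst. Qed.

Lemma bmfN f : bmf f -> bmf (fun x => - f x).
Proof.
by move=> /(bmfZ (-1)); under [X in bmf X -> _]funext do rewrite mulN1r.
Qed.

Lemma bmfB f g : bmf f -> bmf g -> bmf (fun x => f x - g x).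
Proof. by move=> bf /bmfN; exact: bmfD. Qed.

Lemma bmf_continuous f M : continuous f -> (forall x, `|f x| <= M) -> bmf f.
Proof. by move=> cf fM; split; [exact: continuous_measurable_fun | exists M]. Qed.

Lemma bmf_indic f c d M : measurable_fun `[c, d] f ->
  (forall x, c <= x <= d -> `|f x| <= M) ->
  bmf (fun x => f x * \1_(`[c, d] : set R) x).
Proof.
move=> mf fM; split.
  rewrite (_ : (fun _ => _) = f \_ `[c, d]); last first.
    by apply/funext => x; rewrite patchE indicE; case: ifP; rewrite ?mulr1 ?mulr0.
  by apply/(measurable_restrictT _ _).1.
exists (Num.max M 0) => x; rewrite indicE.
case: (boolP (x \in _)) => [|_]; last by rewrite mulr0 normr0 le_max lexx orbT.
by rewrite inE/= in_itv/= => /fM fMx; rewrite mulr1 le_max fMx.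
Qed.

Lemma bmf_integrable c d f : bmf f -> mu.-integrable `[c, d] (EFin \o f).
Proof.
move=> [mf [M fM]]; apply: measurable_bounded_integrable => //.
- rewrite -[X in (X < _)%E]/(lebesgue_measure _) lebesgue_measure_itv/=; case: ifP => // _.
  by rewrite -EFinB ltry.
- exact: measurable_funS mf.
- exists M; split; first exact: num_real.
  by move=> x Mx y _; exact: le_trans (fM y) (ltW Mx).
Qed.

Lemma int_cst c d (k : R) : c <= d -> \int[mu]_(x in `[c, d]) k = k * (d - c).
Proof.
move=> cd; rewrite Rintegral_cst//= lebesgue_measure_itv/= lte_fin.
by case: ltgtP cd => // -[->]; rewrite subrr.
Qed.

Lemma intD c d f g : bmf f -> bmf g -> \int[mu]_(x in `[c, d]) (f x + g x) =
  \int[mu]_(x in `[c, d]) f x + \int[mu]_(x in `[c, d]) g x.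
Proof. by move=> *; rewrite RintegralD//; exact: bmf_integrable. Qed.

Lemma intB c d f g : bmf f -> bmf g -> \int[mu]_(x in `[c, d]) (f x - g x) =
  \int[mu]_(x in `[c, d]) f x - \int[mu]_(x in `[c, d]) g x.
Proof. by move=> *; rewrite RintegralB//; exact: bmf_integrable. Qed.

Lemma intZ c d k f : bmf f -> \int[mu]_(x in `[c, d]) (k * f x) =
  k * \int[mu]_(x in `[c, d]) f x.
Proof. by move=> *; rewrite RintegralZl//; exact: bmf_integrable. Qed.

Lemma int_le c d f g : bmf f -> bmf g -> (forall x, c <= x <= d -> f x <= g x) ->
  \int[mu]_(x in `[c, d]) f x <= \int[mu]_(x in `[c, d]) g x.
Proof.
move=> bf bg fg; apply: le_Rintegral; [by []|exact: bmf_integrable|exact: bmf_integrable|].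
by move=> x; rewrite /= in_itv/=; exact: fg.
Qed.

Lemma int_eq c d f g : (forall x, c <= x <= d -> f x = g x) ->
  \int[mu]_(x in `[c, d]) f x = \int[mu]_(x in `[c, d]) g x.
Proof.
by move=> fg; apply: eq_Rintegral => x; rewrite inE/= in_itv/=; exact: fg.
Qed.

Lemma int_norm_le c d f g : bmf f -> bmf g ->
  (forall x, c <= x <= d -> `|f x| <= g x) ->
  `|\int[mu]_(x in `[c, d]) f x| <= \int[mu]_(x in `[c, d]) g x.
Proof.
move=> bf bg fg; rewrite ler_norml -mulN1r -intZ//; apply/andP; split.
  apply: int_le => //; first exact: bmfZ.
  by move=> x /fg; rewrite ler_norml mulN1r => /andP[].
by apply: int_le => // x /fg; rewrite ler_norml => /andP[].
Qed.

Lemma int_sqr_ge0 c d f : 0 <= \int[mu]_(x in `[c, d]) (f x * f x).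
Proof. by apply: Rintegral_ge0 => x _; rewrite -expr2 sqr_ge0. Qed.

Lemma int_norm_cst c d f (M : R) : c <= d -> bmf f ->
  (forall x, c <= x <= d -> `|f x| <= M) ->
  `|\int[mu]_(x in `[c, d]) f x| <= M * (d - c).
Proof.
by move=> cd bf fM; rewrite -int_cst// int_norm_le//; exact: bmf_cst.
Qed.

Lemma discriminant_le (A B C : R) : 0 <= A ->
  (forall t : R, 0 <= A * t ^+ 2 + 2 * B * t + C) -> B ^+ 2 <= A * C.
Proof.
rewrite le_eqVlt => /predU1P[<- H|A0 H].
  rewrite mul0r; have [->|B0] := eqVneq B 0; first by rewrite expr0n.
  (* For [A = 0] the form is affine in [t]; this [t] gives it the value -1. *)
  have := H (- (C + 1) / (2 * B)).
  rewrite (_ : 0 * _ + _ + _ = -1); first by rewrite lerNr oppr0 ler10.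
  by field.
have := H (- B / A).
rewrite (_ : _ + C = (A * C - B ^+ 2) / A); first by rewrite pmulr_lge0 ?invr_gt0// subr_ge0.
by field; rewrite gt_eqF.
Qed.

Lemma int_CS c d f g : bmf f -> bmf g ->
  (\int[mu]_(x in `[c, d]) (f x * g x)) ^+ 2 <=
  \int[mu]_(x in `[c, d]) (f x * f x) * \int[mu]_(x in `[c, d]) (g x * g x).
Proof.
move=> bf bg; apply: discriminant_le => [|t]; first exact: int_sqr_ge0.
have := int_sqr_ge0 c d (fun x => t * f x + g x).
rewrite (_ : \int[_]_(_ in _) _ = \int[mu]_(x in `[c, d])
  ((t ^+ 2 * (f x * f x) + 2 * t * (f x * g x)) + g x * g x)); last first.
  by apply: int_eq => x _; ring.
have bff := bmfM bf bf; have bfg := bmfM bf bg; have bgg := bmfM bg bg.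
rewrite intD//; last by apply: bmfD; exact: bmfZ.
by rewrite intD ?intZ//; [lra|exact: bmfZ..].
Qed.

End BoundedMeasurable.

Section IteratedIntegrals.
Context {R : realType}.
Local Notation mu := (@lebesgue_measure R).
Implicit Types (k : R * R -> R) (a b c d : R).

Definition bmf2 k := measurable_fun setT k /\ exists M, forall z, `|k z| <= M.

Lemma bmf2_continuous_comp (f : R -> R) (g : R * R -> R) M : continuous f ->
  measurable_fun setT g -> (forall x, `|f x| <= M) -> bmf2 (fun z => f (g z)).
Proof.
move=> cf mg fM; split; last by exists M.
by apply: measurableT_comp => //; exact: continuous_measurable_fun.
Qed.

Lemma bmf2D k k' : bmf2 k -> bmf2 k' -> bmf2 (fun z => k z + k' z).
Proof.
move=> [mf [M fM]] [mg [N gN]]; split; first exact: measurable_funD.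
by exists (M + N) => x; rewrite (le_trans (ler_normD _ _))// lerD.
Qed.

Lemma bmf2M k k' : bmf2 k -> bmf2 k' -> bmf2 (fun z => k z * k' z).
Proof.
move=> [mf [M fM]] [mg [N gN]]; split; first exact: measurable_funM.
by exists (M * N) => x; rewrite normrM ler_pM.
Qed.

Lemma bmf2_fst (f : R -> R) : bmf f -> bmf2 (fun z => f z.1).
Proof. by move=> [mf [M fM]]; split; [exact: measurableT_comp|exists M]. Qed.

Lemma bmf2_snd (f : R -> R) : bmf f -> bmf2 (fun z => f z.2).
Proof. by move=> [mf [M fM]]; split; [exact: measurableT_comp|exists M]. Qed.

Lemma bmf2_sym k : bmf2 k -> bmf2 (fun z => k (z.2, z.1)).
Proof.
move=> [mk [M kM]]; split; last by exists M.
by apply: measurableT_comp => //; exact: measurable_swap.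
Qed.

Lemma bmf2_section k x : bmf2 k -> bmf (fun y => k (x, y)).
Proof.
move=> [mk [M kM]]; split; last by exists M.
by apply: measurableT_comp => //; exact: measurable_pair1.
Qed.

Section Fubini.
Variables (a b c d : R) (k : R * R -> R).
Hypothesis bk : bmf2 k.

Let A : set (R * R) := `[a, b]%classic `*` `[c, d]%classic.
Let F := (EFin \o k) \_ A.

Local Notation RR := (measurableTypeR R * measurableTypeR R)%type.

Let mA : measurable (A : set RR). Proof. exact: measurableX. Qed.

Let fin_itv (u v : R) : (mu `[u, v] < +oo)%E.
Proof. by rewrite lebesgue_measure_itv/=; case: ifP => // _; rewrite -EFinB ltry. Qed.

Let intF : (mu \x mu)%E.-integrable setT F.
Proof.
have [mk [M kM]] := bk.
apply/(integrable_mkcond (mu := (mu \x mu)%E) (EFin \o k) mA).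
apply: measurable_bounded_integrable => //.
- rewrite [X in (X < _)%E](_ : _ = (mu `[a, b] * mu `[c, d])%E); last first.
    by apply: product_measure1E; exact: measurable_itv.
  by rewrite lte_mul_pinfty// ge0_fin_numE.
- by apply: (measurable_funS (E := setT) (D := (A : set RR)) (f := (k : RR -> R))) => //; exact: mk.
- exists M; split; first exact: num_real.
  by move=> x Mx y _; exact: le_trans (kM y) (ltW Mx).
Qed.

Let secE x : (\int[mu]_y F (x, y))%E =
  ((EFin \o (fun x => \int[mu]_(y in `[c, d]) k (x, y))) \_ `[a, b]) x.
Proof.
rewrite /F /A !patchE/=; case: ifPn => xab.
  rewrite /Rintegral fineK; last first.
    apply: integrable_fin_num => //.
    by have /(bmf_integrable c d) := bmf2_section x bk.
  rewrite [RHS]integral_mkcond; apply: eq_integral => y _.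
  rewrite !patchE; congr (if _ then _ else _).
  by rewrite in_setX/= xab.
rewrite integral0_eq// => y _; rewrite patchE in_setX/=.
by rewrite (negbTE xab).
Qed.

Let secE2 y : (\int[mu]_x F (x, y))%E =
  ((EFin \o (fun y => \int[mu]_(x in `[a, b]) k (x, y))) \_ `[c, d]) y.
Proof.
rewrite /F /A !patchE/=; case: ifPn => xab.
  rewrite /Rintegral fineK; last first.
    apply: integrable_fin_num => //.
    by have /(bmf_integrable a b) := bmf2_section y (bmf2_sym bk).
  rewrite [RHS]integral_mkcond; apply: eq_integral => x _.
  rewrite !patchE; congr (if _ then _ else _).
  by rewrite in_setX/= xab andbT.
rewrite integral0_eq// => x _; rewrite patchE in_setX/=.
by rewrite (negbTE xab) andbF.
Qed.

(** Extended by 0 outside the rectangle, the kernel is integrable for the product measure, and its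
    sections integrate over the line to the segment integrals. *)
Lemma int_swap :
  \int[mu]_(x in `[a, b]) (\int[mu]_(y in `[c, d]) k (x, y)) =
  \int[mu]_(y in `[c, d]) (\int[mu]_(x in `[a, b]) k (x, y)).
Proof.
rewrite /Rintegral; congr fine.
rewrite integral_mkcond [RHS]integral_mkcond.
transitivity (\int[mu]_x \int[mu]_y F (x, y))%E.
  by apply: eq_integral => x _; rewrite secE.
transitivity (\int[mu]_y \int[mu]_x F (x, y))%E; first exact: Fubini intF.
by apply: eq_integral => y _; rewrite secE2.
Qed.

End Fubini.

Lemma bmf_param c d k : c <= d -> bmf2 k ->
  bmf (fun x => \int[mu]_(y in `[c, d]) k (x, y)).
Proof.
move=> cd bk; have [mk [M kM]] := bk; split; last first.
  exists (M * (d - c)) => x; rewrite int_norm_cst//; exact: bmf2_section.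
(* Tonelli needs a nonnegative function, hence the shift by the bound [M]; its contribution
   [M * (d - c)] is subtracted afterwards. *)
pose F := (fun z : R * R => ((k z + M) * \1_(`[c, d] : set R) z.2)%:E).
have F0 z : (0 <= F z)%E.
  by rewrite lee_fin mulr_ge0// addrC -lerBlDl sub0r; have := kM z; rewrite ler_norml => /andP[].
have mF : measurable_fun setT F.
  apply/measurable_EFinP/measurable_funM => //; first exact: measurable_funD.
  by apply: measurableT_comp => //; exact: measurable_indic.
have mG : measurable_fun setT (fun x : measurableTypeR R => \int[mu]_y F (x, y))%E.
  exact: (measurable_fun_fubini_tonelli_F (m2 := mu)
    (F : measurableTypeR R * measurableTypeR R -> _) mF F0).
have -> : (fun x => \int[mu]_(y in `[c, d]) k (x, y)) =
    fun x => fine (\int[mu]_y F (x, y))%E - M * (d - c).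
  apply/funext => x; have bkx := bmf2_section x bk.
  rewrite -(int_cst _ cd) -[LHS](addrK (\int[mu]_(y in `[c, d]) M)).
  congr (_ - _); rewrite -intD//; last exact: bmf_cst.
  congr fine; rewrite integral_mkcond; apply: eq_integral => y _.
  by rewrite /F patchE indicE; case: ifP; rewrite ?mulr1 ?mulr0.
apply: measurable_funB => //.
exact: measurableT_comp mG.
Qed.

End IteratedIntegrals.

(** * Eigenvalues of compact symmetric integral operators *)

Section EquiLipschitz.
Context {R : realType}.

(* Tychonoff gives a pointwise cluster point; on a finite grid of the segment
   the equi-Lipschitz bound upgrades pointwise to uniform closeness. *)
Lemma equilipschitz_cluster (c d M : R) (h : nat -> R -> R) : c < d ->
  (forall n t, `|h n t| <= M) ->
  (forall n t u, `|h n t - h n u| <= M * `|t - u|) ->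
  exists g : R -> R, [/\ forall t, `|g t| <= M,
    forall t u, `|g t - g u| <= M * `|t - u| &
    forall e N, 0 < e -> exists2 n, (N <= n)%N &
      forall t, c <= t <= d -> `|h n t - g t| <= e].
Proof.
move=> cd hM hL.
have M0 : 0 <= M by exact: le_trans (hM 0%N 0).
have cM (i : R) : compact [set x : R | `|x| <= M].
  rewrite (_ : [set x : R | _] = `[- M, M]%classic); first exact: segment_compact.
  by apply/seteqP; split => x /=; rewrite in_itv/= -ler_norml.
have /(_ ((h : nat -> {ptws R -> R}) @ \oo)) := @tychonoff R (fun=> R : topologicalType) _ cM.
have PF : ProperFilter ((h : nat -> {ptws R -> R}) @ \oo).
  exact: fmap_proper_filter.
move=> /(_ PF) [|g [gM gclus]].
  by exists 0%N => // n _ i /=; exact: hM.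
(* A basic neighbourhood of [g] for pointwise convergence constrains finitely many values, and a
   cluster point meets it at indices beyond any [N]. *)
have close m (p : 'I_m -> R) e N : 0 < e ->
    exists2 n, (N <= n)%N & forall i, `|h n (p i) - g (p i)| < e.
  move=> e0.
  have [||f [[n /= Nn <-]]] := gclus ((h : nat -> {ptws R -> R}) @` [set n | (N <= n)%N])
      [set f | forall i, `|f (p i) - g (p i)| < e].
  - by exists N => // n /= Nn; exists n.
  - apply: (@filter_forall {ptws R -> R} _
      (fun i => [set f : R -> R | `|f (p i) - g (p i)| < e]) (nbhs (g : {ptws R -> R}))) => i.
    have ball_e : nbhs (g (p i)) [set y : R | `|y - g (p i)| < e].
      by apply/nbhs_ballP; exists e => // y; rewrite /ball/= distrC.
    exact: (@proj_continuous R (fun=> R : topologicalType) (p i) g _ ball_e).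
  - by exists n.
have gL t u : `|g t - g u| <= M * `|t - u|.
  apply/ler_addgt0Pr => e e0.
  have [|n _ H] := close 2%N (fun i => if i == ord0 then t else u) (e / 2) 0%N.
    by rewrite divr_gt0.
  have /= Ht := H ord0; have /= Hu := H (lift ord0 ord0).
  rewrite (_ : g t - g u = (h n t - h n u) - (h n t - g t) + (h n u - g u)); last by ring.
  rewrite (le_trans (ler_normD _ _))// (le_trans (lerD (ler_normB _ _) (lexx _)))//.
  by have := hL n t u; move: Ht Hu; lra.
exists g; split => // e N e0.
(* The mesh [dl] satisfies [M * dl <= e / 3]. Going through a nearby grid point costs [e / 3] three
   times: for moving [h n], for moving [g], and for their gap there. *)
pose m := (Num.trunc (3 * M * (d - c) / e)).+1.
have m0 : 0 < m%:R :> R by rewrite ltr0n.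
pose dl := (d - c) / m%:R.
have dl0 : 0 < dl by rewrite divr_gt0// subr_gt0.
have Mdl : M * dl <= e / 3.
  rewrite /dl mulrA ler_pdivrMr// mulrC.
  have /andP[_] : (Num.trunc (3 * M * (d - c) / e))%:R <= (3 * M * (d - c) / e) < m%:R.
    by apply: truncn_itv; rewrite divr_ge0 ?(ltW e0)// !mulr_ge0// subr_ge0 ltW.
  by rewrite ltr_pdivrMr// => /ltW; lra.
have [|n Nn H] := close m.+1 (fun i => c + i%:R * dl) (e / 3) N; first by rewrite divr_gt0.
exists n => // t /andP[ct td].
pose i := Num.trunc ((t - c) / dl).
have /andP[i1 i2] : i%:R <= (t - c) / dl < i.+1%:R.
  by apply: truncn_itv; rewrite divr_ge0 ?(ltW dl0)// subr_ge0.
have im : (i < m.+1)%N.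
  rewrite ltnS -(ler_nat R) (le_trans i1)// ler_pdivrMr// /dl mulrCA divff ?gt_eqF//.
  by rewrite mulr1 lerD2r.
have := H (Ordinal im) => /=; set p := c + _ => Hp.
have tp : `|t - p| <= dl.
  move: i1 i2; rewrite ler_pdivlMr// ltr_pdivrMr// -natr1 => i1 i2.
  by rewrite ler_norml /p; apply/andP; split; lra.
have Mtp : M * `|t - p| <= e / 3 by rewrite (le_trans _ Mdl)// ler_wpM2l.
rewrite (_ : h n t - g t = (h n t - h n p) - (g t - g p) + (h n p - g p)); last by ring.
rewrite (le_trans (ler_normD _ _))// (le_trans (lerD (ler_normB _ _) (lexx _)))//.
by have := hL n t p; have := gL t p; move: Mtp Hp; lra.
Qed.

End EquiLipschitz.

Local Ltac bmf_auto := repeat first [assumption | exact: bmf_cst |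
  apply: bmfM | apply: bmfD | apply: bmfZ].

Section CompactSymmetric.
Context {R : realType}.
Variables c d : R.
Hypothesis cd : c < d.
Local Notation mu := (@lebesgue_measure R).
Implicit Types (f g h : R -> R) (T : (R -> R) -> R -> R).

Definition ip f g : R := \int[mu]_(x in `[c, d]) (f x * g x).

Lemma ipC f g : ip f g = ip g f.
Proof. by apply: int_eq => x _; rewrite mulrC. Qed.

Lemma ip_ge0 f : 0 <= ip f f.
Proof. exact: int_sqr_ge0. Qed.

Lemma ipDl k f g h : bmf f -> bmf g -> bmf h ->
  ip (fun x => k * f x + g x) h = k * ip f h + ip g h.
Proof.
move=> bf bg bh; rewrite /ip -intZ; last exact: bmfM.
rewrite -intD; last 2 first.
- exact/bmfZ/bmfM.
- exact: bmfM.
by apply: int_eq => x _; ring.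
Qed.

Lemma ipDr k f g h : bmf f -> bmf g -> bmf h ->
  ip h (fun x => k * f x + g x) = k * ip h f + ip h g.
Proof. by move=> bf bg bh; rewrite ipC ipDl// !(ipC h). Qed.

Lemma bmf_lin k f g : bmf f -> bmf g -> bmf (fun x => k * f x + g x).
Proof. by move=> bf bg; apply: bmfD => //; exact: bmfZ. Qed.

Lemma ip_sqr_lin k f g : bmf f -> bmf g ->
  ip (fun x => k * f x + g x) (fun x => k * f x + g x) =
  k ^+ 2 * ip f f + 2 * k * ip f g + ip g g.
Proof.
move=> bf bg; have bk := bmf_lin k bf bg.
by rewrite ipDl// !ipDr// (ipC g f); ring.
Qed.

Lemma ip_le_cst f (M : R) : bmf f -> (forall x, c <= x <= d -> `|f x| <= M) ->
  ip f f <= M ^+ 2 * (d - c).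
Proof.
move=> bf fM; rewrite /ip -int_cst ?(ltW cd)//; apply: int_le.
- exact: bmfM.
- exact: bmf_cst.
by move=> x /fM H; rewrite -expr2 -real_normK ?num_real// lerXn2r ?nnegrE// (le_trans _ H).
Qed.

(* [T] maps the unit ball of L2 to a uniformly bounded, equi-Lipschitz family. *)
Record smoothing T (C : R) : Prop := Smoothing {
  smoothing_bmf : forall f, bmf f -> bmf (T f) ;
  smoothing_lin : forall k f g, bmf f -> bmf g ->
    T (fun x => k * f x + g x) = fun x => k * T f x + T g x ;
  smoothing_sym : forall f g, bmf f -> bmf g -> ip (T f) g = ip f (T g) ;
  smoothing_bound : forall f t, bmf f -> (T f t) ^+ 2 <= C * ip f f ;
  smoothing_lip : forall f t u, bmf f ->
    (T f t - T f u) ^+ 2 <= C * ip f f * (t - u) ^+ 2 }.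

Section TopEigenvalue.
Variables (T : (R -> R) -> R -> R) (C S rho : R) (f0 : R -> R).
Hypotheses (sT : smoothing T C)
  (TS : forall f, bmf f -> ip (T f) f <= S * ip f f)
  (bf0 : bmf f0) (f0_gt0 : 0 < ip f0 f0) (rho_gt0 : 0 < rho)
  (f0_rho : rho * ip f0 f0 <= ip (T f0) f0).

Let TD := smoothing_lin sT.
Let Tb := smoothing_bmf sT.

Let C0 : 0 <= C.
Proof.
have := smoothing_bound sT 0 bf0; rewrite -(pmulr_lge0 C f0_gt0).
exact/le_trans/sqr_ge0.
Qed.

(** Linearity is given only for [k f + g]; homogeneity follows with [g = f] and the coefficient
    [k - 1]. *)
Let TZ k f : bmf f -> T (fun x => k * f x) = fun x => k * T f x.
Proof.
move=> bf; have := TD (k - 1) bf bf.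
rewrite (_ : (fun x => (k - 1) * f x + f x) = fun x => k * f x) => [->|].
  by apply/funext => x; ring.
by apply/funext => x; ring.
Qed.

Let normT f : bmf f -> ip (T f) (T f) <= C * (d - c) * ip f f.
Proof.
move=> bf; rewrite /ip.
have -> : C * (d - c) * ip f f = \int[mu]_(x in `[c, d]) (C * ip f f).
  by rewrite int_cst ?(ltW cd)//; ring.
apply: int_le; [by apply: bmfM; exact: Tb|exact: bmf_cst|].
by move=> x _; rewrite -expr2; exact: smoothing_bound.
Qed.

Let E := [set y | exists f, [/\ bmf f, ip f f = 1 & y = ip (T f) f]].
Let Lam := sup E.

Let normalize f : bmf f -> 0 < ip f f -> E (ip (T f) f / ip f f).
Proof.
move=> bf f0'; have s0 : Num.sqrt (ip f f) != 0 by rewrite gt_eqF// sqrtr_gt0.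
exists (fun x => (Num.sqrt (ip f f))^-1 * f x).
have bk := bmfZ (Num.sqrt (ip f f))^-1 bf.
have ipZ g : bmf g -> ip (fun x => (Num.sqrt (ip f f))^-1 * g x)
    (fun x => (Num.sqrt (ip f f))^-1 * f x) = ip g f / ip f f.
  move=> bg; rewrite /ip -[RHS]mulrC -intZ; last exact: bmfM.
  apply: int_eq => x _; rewrite -/(ip f f) -{3}(sqr_sqrtr (ltW f0')).
  by field.
split => //; first by rewrite ipZ// divff// gt_eqF.
by rewrite TZ// ipZ//; exact: Tb.
Qed.

Let E0 : E !=set0. Proof. by eexists; exact: normalize f0_gt0. Qed.

Let ubE : ubound E S.
Proof. by move=> _ [f [bf ff1 ->]]; rewrite (le_trans (TS bf))// ff1 mulr1. Qed.

Let hsE : has_sup E. Proof. by split => //; exists S. Qed.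

Let LamS : Lam <= S. Proof. exact: ge_sup. Qed.

Let rhoLam : rho <= Lam.
Proof.
have := ub_le_sup hsE.2 (normalize bf0 f0_gt0); apply: le_trans.
by rewrite ler_pdivlMr.
Qed.

Let Lam0 : 0 < Lam. Proof. exact: lt_le_trans rhoLam. Qed.

Let TLam f : bmf f -> ip (T f) f <= Lam * ip f f.
Proof.
move=> bf; have := ip_ge0 f; rewrite le_eqVlt => /predU1P[f0'|f0'].
  (* A function of norm 0 has no Rayleigh quotient; Cauchy-Schwarz forbids [ip (T f) f] to be
     positive. *)
  rewrite -f0' mulr0 real_leNgt ?num_real//; apply/negP => H.
  have := int_CS c d (Tb bf) bf; rewrite -/(ip _ _) -/(ip _ _) -/(ip _ _) -f0' mulr0.
  by rewrite leNgt exprn_gt0.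
by rewrite -ler_pdivrMr//; apply: ub_le_sup; [exact: hsE.2|exact: normalize].
Qed.

Let N := Lam + C * (d - c) + 1.

Let N0 : 0 < N.
Proof. by rewrite /N ltr_wpDl// addr_ge0 ?(ltW Lam0)// mulr_ge0// subr_ge0 (ltW cd). Qed.

Let A f := fun x => (- 1) * T f x + Lam * f x.

Let Ab f : bmf f -> bmf (A f).
Proof. by move=> bf; apply: bmf_lin; [exact: Tb|exact: bmfZ]. Qed.

Let AipE f g : bmf f -> bmf g -> ip (A f) g = Lam * ip f g - ip (T f) g.
Proof.
move=> bf bg; rewrite /A ipDl//; [|exact: Tb|exact: bmfZ].
have := @ipDl Lam f (fun=> 0) g bf (bmf_cst 0) bg.
rewrite (_ : (fun x => Lam * f x + 0) = (fun x => Lam * f x)); last first.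
  by apply/funext => x; rewrite addr0.
move=> ->; rewrite (_ : ip (fun=> 0) g = 0); first by ring.
by rewrite /ip; under eq_Rintegral do rewrite mul0r; rewrite int_cst ?(ltW cd)// mul0r.
Qed.

Let AipEr f g : bmf f -> bmf g -> ip g (A f) = Lam * ip g f - ip g (T f).
Proof. by move=> bf bg; rewrite ipC AipE// !(ipC g). Qed.

Let A_ge0 f : bmf f -> 0 <= ip (A f) f.
Proof. by move=> bf; rewrite AipE// subr_ge0; exact: TLam. Qed.

Let A_le f : bmf f -> ip (A f) f <= N * ip f f.
Proof.
move=> bf; rewrite AipE// /N.
have := ip_ge0 (fun x => 1 * T f x + f x); rewrite ip_sqr_lin//; last exact: Tb.
have := normT bf; have := ip_ge0 f; have := ip_ge0 (T f).
have : 0 <= C * (d - c) * ip f f by rewrite !mulr_ge0 ?ip_ge0// subr_ge0 (ltW cd).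
nra.
Qed.

(** Nonnegativity of the form of [A] at [f - A f / N] gives [0 <= ip (A f) f - (2 / N) |A f|^2 + ip
    (A (A f)) (A f) / N^2], and the last term is at most [|A f|^2 / N]. *)
Let A_sqr f : bmf f -> ip (A f) (A f) <= N * ip (A f) f.
Proof.
move=> bf; have bA := Ab bf; have bAA := Ab bA.
have := A_ge0 (bmf_lin (- N^-1) bA bf).
rewrite (_ : A (fun x => - N^-1 * A f x + f x) = fun x => - N^-1 * A (A f) x + A f x).
  rewrite ipDl//; last exact: bmf_lin.
  rewrite (ipDr _ bA bf bAA) (ipDr _ bA bf bA).
  have -> : ip (A (A f)) f = ip (A f) (A f).
    by rewrite AipE// (smoothing_sym sT)// AipEr.
  have NA := A_le bA; move=> H.
  have H2 : N^-1 * (N^-1 * ip (A (A f)) (A f)) <= N^-1 * ip (A f) (A f).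
    by rewrite ler_wpM2l ?invr_ge0 ?(ltW N0)// mulrC ler_pdivrMr// mulrC.
  rewrite -ler_pdivrMl//; lra.
apply/funext => x; transitivity (-1 * T (fun x => - N^-1 * A f x + f x) x +
    Lam * (- N^-1 * A f x + f x)); first by [].
transitivity (- N^-1 * (-1 * T (A f) x + Lam * A f x) + (-1 * T f x + Lam * f x)); last by [].
by rewrite TD//; ring.
Qed.

(** Unit vectors whose Rayleigh quotients approach [Lam] satisfy [(Lam - T) f -> 0] in norm by
    [A_sqr]. Their images under [T] are equi-Lipschitz and cluster uniformly at some [g], which
    inherits the eigenvalue equation at every point of the segment. *)
Lemma top_eigenvalue : exists Lam' g, [/\ rho <= Lam' <= S, bmf g, 0 < ip g g &
  forall t, c <= t <= d -> T g t = Lam' * g t].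
Proof.
have dc : 0 < d - c by rewrite subr_gt0.
have seq_ex (n : nat) : exists f, [/\ bmf f, ip f f = 1 & ip (A f) (A f) <= n.+1%:R^-1].
  have e0 : 0 < n.+1%:R^-1 / N by rewrite divr_gt0// invr_gt0 ltr0n.
  have [_ [f [bf ff1 ->]]] := sup_adherent e0 hsE; rewrite -/Lam => H.
  exists f; split => //; rewrite (le_trans (A_sqr bf))// AipE// ff1 mulr1.
  by rewrite mulrC -ler_pdivlMr// lerBlDr -lerBlDl ltW.
pose F n := sval (cid (seq_ex n)).
have FP n : [/\ bmf (F n), ip (F n) (F n) = 1 & ip (A (F n)) (A (F n)) <= n.+1%:R^-1].
  by rewrite /F; case: cid.
(* As [C <= (C + 1)^2], one constant turns both squared bounds of [smoothing] into bounds on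
   absolute values. *)
pose M := C + 1.
have M0 : 0 < M by rewrite ltr_wpDl.
have CM : C <= M ^+ 2 by rewrite /M; move: C0; nra.
have sqrtb (x y : R) : 0 <= y -> x ^+ 2 <= y ^+ 2 -> `|x| <= y.
  by move=> y0 xy; rewrite -ler_sqr ?nnegrE// real_normK ?num_real.
have [||g [gM gL gclose]] := @equilipschitz_cluster R c d M (fun n => T (F n)) cd.
- move=> n t; have [bF F1 _] := FP n; apply: sqrtb; first exact: ltW.
  by rewrite (le_trans (smoothing_bound sT _ bF))// F1 mulr1.
- move=> n t u; have [bF F1 _] := FP n; apply: sqrtb; first by rewrite mulr_ge0 ?(ltW M0).
  rewrite (le_trans (smoothing_lip sT _ _ bF))// F1 mulr1 exprMn.
  by rewrite real_normK ?num_real// ler_wpM2r// sqr_ge0.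
have bg : bmf g.
  apply: (@bmf_continuous _ _ M) => // x; apply/cvgrPdist_le => e e0.
  near=> y; rewrite (le_trans (gL _ _))// mulrC -ler_pdivlMr//.
  near: y; apply: cvgr_dist_le; first exact: cvg_id.
  by rewrite divr_gt0.
have Tsmall u dl t : bmf u -> 0 <= dl -> ip u u <= dl ^+ 2 -> `|T u t| <= M * dl.
  move=> bu dl0 udl; apply: sqrtb; first by rewrite mulr_ge0// ltW.
  rewrite (le_trans (smoothing_bound sT _ bu))// exprMn ler_pM//; exact: ip_ge0.
have pick e : 0 < e -> exists f, [/\ bmf f, ip f f = 1, ip (A f) (A f) <= e ^+ 2 &
    forall t, c <= t <= d -> `|T f t - g t| <= e].
  move=> e0; pose n0 := Num.trunc (e ^- 2).
  have [n n0n H] := gclose e n0 e0; have [bF F1 AF] := FP n.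
  exists (F n); split => //; rewrite (le_trans AF)//.
  rewrite invf_ple ?posrE ?ltr0n ?exprn_gt0//.
  have /andP[_ /ltW /le_trans] := truncn_itv (x := e ^- 2) ltac:(by rewrite invr_ge0 exprn_ge0 ?(ltW e0)).
  by apply; rewrite ler_nat ltnS.
have diffE f t : T f t = - 1 * A f t + Lam * f t by rewrite /A; ring.
exists Lam, g; split => //; first by rewrite rhoLam.
(* If [g] had norm 0, then [Lam f = g + A f + w] with [w = T f - g] small would give
   [Lam^2 <= 3 (|A f|^2 + |w|^2) <= K e^2]; [e] is chosen so that the right side is [Lam^2 / 2]. *)
- rewrite lt_neqAle ip_ge0 andbT; apply/eqP => g0.
  pose K := 3 * (1 + (d - c)).
  have K0 : 0 < K by rewrite mulr_gt0// ltr_wpDr ?(ltW dc).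
  pose e := Num.sqrt (Lam ^+ 2 / (2 * K)).
  have L2 : 0 < Lam ^+ 2 / (2 * K) by rewrite divr_gt0 ?exprn_gt0// mulr_gt0.
  have e0 : 0 < e by rewrite sqrtr_gt0.
  have [f [bf f1 Af Tf]] := pick e e0.
  have bA := Ab bf; have bT := Tb bf.
  have Tgf : ip (fun x => - 1 * g x + T f x) (fun x => - 1 * g x + T f x) <= e ^+ 2 * (d - c).
    apply: ip_le_cst; first exact: bmf_lin.
    by move=> x /Tf; rewrite mulN1r addrC.
  pose w := fun x => - 1 * g x + T f x; have bw : bmf w by exact: bmf_lin.
  have : ip (fun x => Lam * f x + 0) (fun x => Lam * f x + 0) <=
      3 * ip g g + 3 * (ip (A f) (A f) + ip w w).
    have bL : bmf (fun x => Lam * f x + 0) by apply: bmf_lin => //; exact: bmf_cst.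
    rewrite /ip -!intD -?intZ; try bmf_auto.
    rewrite -intD; try bmf_auto.
    apply: int_le; [exact: bmfM|bmf_auto|].
    move=> x _; rewrite addr0 (_ : Lam * f x = g x + A f x + w x); last by rewrite /w diffE; ring.
    rewrite -subr_ge0.
    rewrite (_ : _ - _ = (g x - A f x) ^+ 2 + (g x - w x) ^+ 2 + (A f x - w x) ^+ 2); last by ring.
    by rewrite !addr_ge0// sqr_ge0.
  rewrite ip_sqr_lin//; last exact: bmf_cst.
  rewrite f1 -g0 mulr0 add0r mulr1.
  have z0 h : bmf h -> ip h (fun=> 0) = 0.
    by move=> _; rewrite /ip; under eq_Rintegral do rewrite mulr0; rewrite int_cst ?(ltW cd)// mul0r.
  rewrite !z0//; last exact: bmf_cst.
  rewrite mulr0 !addr0 => H.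
  have : 3 * (ip (A f) (A f) + ip w w) <= 3 * (e ^+ 2 + e ^+ 2 * (d - c)).
    by rewrite ler_wpM2l// lerD.
  rewrite (_ : 3 * _ = e ^+ 2 * K); last by rewrite /K; ring.
  rewrite sqr_sqrtr ?(ltW L2)// (_ : Lam ^+ 2 / (2 * K) * K = Lam ^+ 2 / 2); last by field; rewrite gt_eqF.
  have : 0 < Lam ^+ 2 by rewrite exprn_gt0.
  lra.
(* With [w = g - T f] one has [T g - Lam g = T w - T (A f) - Lam w]. The three terms are at most
   [M s], [M] and [Lam] times [e / K], and [K] is the sum of these factors. *)
- move=> t tcd; apply/eqP; rewrite -subr_eq0 -normr_le0.
  apply/ler_addgt0Pr => e e0; rewrite add0r.
  pose s := Num.sqrt (d - c).
  have s0 : 0 < s by rewrite sqrtr_gt0.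
  pose K := M * s + M + Lam.
  have K0 : 0 < K by rewrite /K addr_gt0// ltr_wpDl// mulr_ge0// ltW.
  have e'0 : 0 < e / K by rewrite divr_gt0.
  have [f [bf f1 Af Tf]] := pick (e / K) e'0.
  have bA := Ab bf; have bT := Tb bf.
  pose w := fun x => - 1 * T f x + g x; have bw : bmf w by exact: bmf_lin.
  have wt x : c <= x <= d -> `|w x| <= e / K.
    by move=> /Tf; rewrite distrC /w mulN1r addrC.
  have ww : ip w w <= (e / K * s) ^+ 2.
    by rewrite exprMn sqr_sqrtr ?(ltW dc)//; exact: ip_le_cst.
  have := Tsmall _ _ t bw (mulr_ge0 (ltW e'0) (ltW s0)) ww.
  have := Tsmall _ _ t bA (ltW e'0) Af.
  have -> : T (A f) t = - 1 * T (T f) t + Lam * T f t.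
    by rewrite /A TD ?TZ//; exact: bmfZ.
  rewrite /w TD// => H1 H2; have H3 := wt t tcd.
  rewrite (_ : T g t - _ = (- 1 * T (T f) t + T g t) - (- 1 * T (T f) t + Lam * T f t)
     - Lam * w t); last by rewrite /w; ring.
  rewrite (le_trans (ler_normB _ _))// (le_trans (lerD (ler_normB _ _) (lexx _)))//.
  rewrite normrM (gtr0_norm Lam0).
  have H4 : Lam * `|w t| <= Lam * (e / K) by rewrite ler_wpM2l// ltW.
  have -> : e = M * (e / K * s) + M * (e / K) + Lam * (e / K).
    by rewrite /K; field; rewrite gt_eqF.
  by rewrite !lerD.
Unshelve. all: by end_near.
Qed.

End TopEigenvalue.

End CompactSymmetric.

Section NearEigenvalue.
Context {R : realType}.
Variables c d : R.
Hypothesis cd : c < d.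
Local Notation mu := (@lebesgue_measure R).
Local Notation ip := (@ip R c d).
Implicit Types (f g h : R -> R).

Definition kop (k : R * R -> R) f : R -> R :=
  fun t => \int[mu]_(r in `[c, d]) (k (t, r) * f r).

(** Cauchy-Schwarz in [r] bounds values and increments alike; symmetry is Fubini together with the
    symmetry of the kernel. *)
Lemma smoothing_kop k M l : bmf2 k -> (forall t r, k (t, r) = k (r, t)) ->
  (forall t r, c <= r <= d -> `|k (t, r)| <= M) ->
  (forall t u r, c <= r <= d -> `|k (t, r) - k (u, r)| <= l * `|t - u|) ->
  smoothing c d (kop k) ((M ^+ 2 + l ^+ 2) * (d - c)).
Proof.
move=> bk ksym kM kl; have dc : 0 < d - c by rewrite subr_gt0.
have bkf t f : bmf f -> bmf (fun r => k (t, r) * f r).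
  by move=> bf; apply: bmfM => //; exact: bmf2_section.
have bK f : bmf f -> bmf (kop k f).
  move=> bf; apply: (@bmf_param _ c d (fun z => k z * f z.2)); first exact: ltW.
  by apply: bmf2M => //; exact: bmf2_snd.
split => //.
- move=> a f g bf bg; apply/funext => t; rewrite /kop -intZ; last exact: bkf.
  rewrite -intD; [|by apply: bmfZ; exact: bkf|exact: bkf].
  by apply: int_eq => x _; ring.
- move=> f g bf bg; rewrite /ip /kop.
  transitivity (\int[mu]_(x in `[c, d]) \int[mu]_(r in `[c, d]) (k (x, r) * f r * g x)).
    apply: int_eq => x _; rewrite mulrC -intZ; last exact: bkf.
    by apply: int_eq => r _; rewrite mulrC.
  rewrite (@int_swap _ c d c d (fun z => k z * f z.2 * g z.1)); last first.
    by apply: bmf2M; [apply: bmf2M => //; exact: bmf2_snd|exact: bmf2_fst].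
  apply: int_eq => r _; rewrite -intZ; last exact: bkf.
  by apply: int_eq => x _ /=; rewrite ksym; ring.
- move=> f t bf; have := int_CS c d (bmf2_section t bk) bf => /le_trans; apply.
  rewrite ler_wpM2r ?ip_ge0//; have [ckd|ncd] := leP c d; last by move: dc; rewrite subr_gt0 ltNge ltW.
  apply: (le_trans (ip_le_cst cd (bmf2_section t bk) (kM t))).
  by rewrite ler_wpM2r ?(ltW dc)// lerDl sqr_ge0.
- move=> f t u bf.
  have bku : bmf (fun r => k (t, r) - k (u, r)) by apply: bmfB; exact: bmf2_section.
  have -> : kop k f t - kop k f u = \int[mu]_(r in `[c, d]) ((k (t, r) - k (u, r)) * f r).
    by rewrite /kop -intB; [apply: int_eq => r _; ring|exact: bkf..].
  have := int_CS c d bku bf => /le_trans; apply.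
  rewrite mulrAC ler_wpM2r ?ip_ge0//.
  apply: (le_trans (ip_le_cst cd bku (kl t u))).
  rewrite exprMn real_normK ?num_real// [leLHS]mulrAC ler_wpM2r ?sqr_ge0//.
  by rewrite ler_wpM2r ?(ltW dc)// lerDr sqr_ge0.
Qed.

(** [T] is bounded in L2 with squared norm at most [C (d - c)], so [T] applied twice obeys the same
    kind of estimates; they combine through [(2 s a - b)^2 <= 8 s^2 a^2 + 2 b^2]. *)
Lemma smoothing_shifted_square T C s : smoothing c d T C ->
  smoothing c d (fun f x => 2 * s * T f x - T (T f) x)
    (8 * s ^+ 2 * C + 2 * C * (C * (d - c))).
Proof.
move=> sT; have Tb := smoothing_bmf sT; have dc : 0 < d - c by rewrite subr_gt0.
have TT f : bmf f -> ip (T f) (T f) <= C * (d - c) * ip f f.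
  move=> bf; rewrite [leRHS](_ : _ = \int[mu]_(x in `[c, d]) (C * ip f f)); last first.
    by rewrite int_cst ?(ltW cd)//; ring.
  apply: int_le; [by apply: bmfM; exact: Tb|exact: bmf_cst|].
  by move=> x _; rewrite -expr2; exact: smoothing_bound.
have C0 : 0 <= C.
  have := smoothing_bound sT 0 (bmf_cst 1).
  rewrite /ip int_cst ?(ltW cd)// !mul1r => /(le_trans (sqr_ge0 _)).
  by rewrite pmulr_lge0.
have sqr_le (a b X Y : R) : a ^+ 2 <= X -> b ^+ 2 <= Y ->
    (2 * s * a - b) ^+ 2 <= 8 * s ^+ 2 * X + 2 * Y.
  move=> aX bY; apply: (@le_trans _ _ (8 * s ^+ 2 * a ^+ 2 + 2 * b ^+ 2)).
    rewrite -subr_ge0 (_ : _ - _ = (2 * s * a + b) ^+ 2); last by ring.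
    exact: sqr_ge0.
  by rewrite lerD// ler_wpM2l// mulr_ge0// sqr_ge0.
split.
- by move=> f bf; apply: bmfB; [apply: bmfZ; exact: Tb|exact/Tb/Tb].
- move=> k f g bf bg; apply/funext => x.
  by rewrite !(smoothing_lin sT)//; [ring|exact: Tb|exact: Tb].
- move=> f g bf bg; have bTf := Tb _ bf; have bTg := Tb _ bg.
  have bTTf := Tb _ bTf; have bTTg := Tb _ bTg.
  transitivity (2 * s * ip (T f) g - ip (T (T f)) g).
    rewrite /ip -intZ -?intB; try by repeat apply: bmfM.
      by apply: int_eq => x _; ring.
    by apply: bmfZ; apply: bmfM.
  transitivity (2 * s * ip f (T g) - ip f (T (T g))); last first.
    rewrite /ip -intZ -?intB; try by repeat apply: bmfM.
      by apply: int_eq => x _; ring.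
    by apply: bmfZ; apply: bmfM.
  by rewrite !(smoothing_sym sT).
- move=> f t bf; rewrite [leRHS]mulrDl.
  apply: (le_trans (sqr_le _ _ _ _ (smoothing_bound sT t bf) (smoothing_bound sT t (Tb _ bf)))).
  rewrite lerD//; first by rewrite !mulrA.
  rewrite -!mulrA ler_wpM2l// ler_wpM2l// mulrA; exact: TT.
- move=> f t u bf; rewrite [leRHS](_ : _ = 8 * s ^+ 2 * (C * ip f f * (t - u) ^+ 2) +
    2 * (C * (C * (d - c) * ip f f) * (t - u) ^+ 2)); last by ring.
  rewrite (_ : _ - _ = 2 * s * (T f t - T f u) - (T (T f) t - T (T f) u)); last by ring.
  apply: (le_trans (sqr_le _ _ _ _ (smoothing_lip sT t u bf) (smoothing_lip sT t u (Tb _ bf)))).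
  rewrite lerD// ler_wpM2l// ler_wpM2r ?sqr_ge0// ler_wpM2l//; exact: TT.
Qed.

(* Since [(T - s)^2 = s^2 - (2 s T - T^2)], a small value of [|| (T - s) f ||] makes
   the top eigenvalue of [2 s T - T^2] close to [s^2]. *)
Lemma near_eigenvalue T C s e f0 : smoothing c d T C -> bmf f0 -> 0 < ip f0 f0 ->
  0 < e < `|s| ->
  ip (fun x => - s * f0 x + T f0 x) (fun x => - s * f0 x + T f0 x)
    <= e ^+ 2 * ip f0 f0 ->
  exists m h, [/\ `|m - s| <= e, bmf h, 0 < ip h h &
    forall t, c <= t <= d -> T h t = m * h t].
Proof.
move=> sT bf0 f00 /andP[e0 es] He; have Tb := smoothing_bmf sT.
have sL := smoothing_shifted_square s sT.
have BE f : bmf f -> ip (fun x => 2 * s * T f x - T (T f) x) f =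
    s ^+ 2 * ip f f - ip (fun x => - s * f x + T f x) (fun x => - s * f x + T f x).
  move=> bf; have bTf := Tb _ bf; have bTTf := Tb _ bTf.
  rewrite ip_sqr_lin// [ip f (T f)]ipC -(smoothing_sym sT)//.
  rewrite [LHS](_ : _ = 2 * s * ip (T f) f - ip (T (T f)) f); first by ring.
  rewrite /ip -intZ -?intB; try by repeat apply: bmfM.
    by apply: int_eq => x _; ring.
  by apply: bmfZ; apply: bmfM.
have s2e : 0 < s ^+ 2 - e ^+ 2.
  by rewrite subr_gt0 -(real_normK (num_real s)) ltr_pXn2r ?nnegrE ?(ltW e0).
have [||L [g [/andP[L1 L2] bg g0 gL]]] := top_eigenvalue cd sL (S := s ^+ 2) _ bf0 f00 s2e.
- by move=> f bf; rewrite BE// lerBlDr lerDl ip_ge0.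
- by rewrite BE// mulrBl lerB.
have bTg := Tb _ bg.
(* The equation for [g] reads [(T - s)^2 g = dl^2 g], that is [(T - s - dl) (T - s + dl) g = 0];
   [h1] is [(T - s + dl) g]. *)
pose dl := Num.sqrt (s ^+ 2 - L).
have dl2 : dl ^+ 2 = s ^+ 2 - L by rewrite sqr_sqrtr// subr_ge0.
have dl0 : 0 <= dl by exact: sqrtr_ge0.
have dle : dl <= e.
  by rewrite -(@ler_pXn2r _ 2)// ?nnegrE ?(ltW e0)// dl2; lra.
pose h1 x := (dl - s) * g x + T g x.
have bh1 : bmf h1 by exact: bmf_lin.
have Th1 t : c <= t <= d -> T h1 t = (s + dl) * h1 t.
  move=> tcd; rewrite (smoothing_lin sT)// /h1.
  have := gL t tcd; rewrite (_ : L = s ^+ 2 - dl ^+ 2); last by rewrite dl2; ring.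
  move=> H; have -> : T (T g) t = 2 * s * T g t - (s ^+ 2 - dl ^+ 2) * g t by rewrite -H; ring.
  ring.
have := ip_ge0 c d h1; rewrite le_eqVlt => /predU1P[h10|h10].
(* Here [g] has the eigenvalue [s - dl] in the L2 sense only. Its image [T g] satisfies the equation
   at every point, and it is nonzero because [dl <= e < |s|]. *)
- have bTh := bmf_lin (s - dl) bg bh1.
  exists (s - dl), (T g); split => //.
  + by rewrite [_ - s](_ : _ = - dl); [rewrite normrN ger0_norm|ring].
  + have gh : ip g h1 = 0.
      apply/eqP; rewrite -sqrf_eq0 eq_le sqr_ge0 andbT.
      by rewrite (le_trans (int_CS c d bg bh1))// -/(ip h1 h1) -h10 mulr0.
    have -> : ip (T g) (T g) = ip (fun x => (s - dl) * g x + h1 x) (fun x => (s - dl) * g x + h1 x).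
      by congr (ip _ _); apply/funext => x; rewrite /h1; ring.
    rewrite ip_sqr_lin// gh -h10 mulr0 !addr0 mulr_gt0// exprn_even_gt0//=.
    apply/negP => /eqP sd; have : `|s| <= e.
      by rewrite (_ : s = dl); [rewrite ger0_norm|lra].
    by rewrite leNgt es.
  + move=> t tcd; have : T h1 t = 0.
      apply/eqP; rewrite -sqrf_eq0 eq_le sqr_ge0 andbT.
      by rewrite (le_trans (smoothing_bound sT t bh1))// -h10 mulr0.
    rewrite (smoothing_lin sT)// => H; apply/eqP; rewrite -subr_eq0 -[X in _ == X]H.
    by apply/eqP; ring.
- exists (s + dl), h1; split => //.
  by rewrite [_ - s](_ : _ = dl); [rewrite ger0_norm|ring].
Qed.

End NearEigenvalue.

(** * Calculus on segments *)

Section DerivativeRules.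
Context {R : realType}.
Implicit Types (f g : R -> R) (x a b : R).

(* [is_derive] hidden from type-class resolution *)
Definition has_der f x a := is_derive x 1 f a.

Lemma der_eq f x a b : has_der f x a -> a = b -> has_der f x b.
Proof. by move=> H <-. Qed.

Lemma der_cst x k : has_der (fun=> k : R) x 0.
Proof. exact: is_derive_cst. Qed.

Lemma der_id x : has_der (fun y : R => y) x 1.
Proof. exact: is_derive_id. Qed.

Lemma derD f g x a b : has_der f x a -> has_der g x b ->
  has_der (fun y => f y + g y) x (a + b).
Proof. by move=> ? ?; exact: is_deriveD. Qed.

Lemma derN f x a : has_der f x a -> has_der (fun y => - f y) x (- a).
Proof. by move=> ?; exact: is_deriveN. Qed.

Lemma derM f g x a b : has_der f x a -> has_der g x b ->
  has_der (fun y => f y * g y) x (a * g x + f x * b).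
Proof.
move=> da db; have H := is_deriveM da db; apply: (der_eq (f := f * g)) H _.
by rewrite /GRing.scale/= addrC mulrC.
Qed.

Lemma derX f x a n : has_der f x a ->
  has_der (fun y => f y ^+ n.+1) x (n.+1%:R * f x ^+ n * a).
Proof. move=> da; rewrite (_ : (fun y => _) = f ^+ n.+1); last first.
  by apply/funext => y; rewrite exprfctE.
exact: (is_deriveX n.+1 da). Qed.

Lemma derV f x a : f x != 0 -> has_der f x a ->
  has_der (fun y => (f y)^-1) x (- a / f x ^+ 2).
Proof.
move=> fx da; have H := is_deriveV fx da; apply: der_eq H _.
by rewrite /GRing.scale/= !mulNr mulrC.
Qed.

Lemma der_sin f x a : has_der f x a ->
  has_der (fun y => sin (f y)) x (cos (f x) * a).
Proof. exact: is_derive1_comp. Qed.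

Lemma der_cos f x a : has_der f x a ->
  has_der (fun y => cos (f y)) x (- sin (f x) * a).
Proof. exact: is_derive1_comp. Qed.

Lemma der_exp f x a : has_der f x a ->
  has_der (fun y => expR (f y)) x (expR (f x) * a).
Proof. exact: is_derive1_comp. Qed.

Lemma der_ln f x a : 0 < f x -> has_der f x a ->
  has_der (fun y => ln (f y)) x ((f x)^-1 * a).
Proof. by move=> fx; apply: is_derive1_comp; exact: is_derive1_ln. Qed.

Lemma der_sqrt f x a : 0 < f x -> has_der f x a ->
  has_der (fun y => Num.sqrt (f y)) x ((2 * Num.sqrt (f x))^-1 * a).
Proof. by move=> fx; apply: is_derive1_comp; exact: is_derive1_sqrt. Qed.

Lemma der_atan f x a : has_der f x a ->
  has_der (fun y => atan (f y)) x ((1 + f x ^+ 2)^-1 * a).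
Proof. exact: is_derive1_comp. Qed.

Lemma der_continuous f x a : has_der f x a -> {for x, continuous f}.
Proof. by move=> [df _]; apply: differentiable_continuous; exact/derivable1_diffP. Qed.

End DerivativeRules.

Ltac derive_auto := repeat first [exact: der_cst | exact: der_id | eassumption |
  apply: derD | apply: derN | apply: derM | apply: derX | apply: derV |
  apply: der_sin | apply: der_cos | apply: der_exp | apply: der_ln |
  apply: der_sqrt | apply: der_atan].

Section SegmentCalculus.
Context {R : realType}.
Local Notation mu := (@lebesgue_measure R).
Implicit Types (f g F G : R -> R) (a b : R).

(** Two-sided derivatives at every point, endpoints included: a certificate of continuity that the
    derivative rules produce automatically. *)
Definition smooth_on a b f := forall x, a <= x <= b -> exists l, has_der f x l.

Lemma smooth_within a b f : smooth_on a b f -> {within `[a, b], continuous f}.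
Proof.
move=> sf; apply: derivable_within_continuous => x; rewrite in_itv/= => /sf[l].
by case.
Qed.

Lemma bmf_smooth a b f : a <= b -> smooth_on a b f ->
  bmf (fun x => f x * \1_(`[a, b] : set R) x).
Proof.
move=> ab sf; have cf := smooth_within sf.
have cnf : {within `[a, b], continuous (fun x => `|f x|)}.
  apply: (@within_continuous_comp _ _ _ _ f Num.norm) => //.
  by move=> x _; exact: norm_continuous.
have [c _ cM] := EVT_max ab cnf.
apply: (@bmf_indic _ _ _ _ `|f c|).
  exact: subspace_continuous_measurable_fun.
by move=> x xab; apply: cM; rewrite in_itv.
Qed.

Lemma int_FTC2 a b f F : a <= b -> (forall x, a <= x <= b -> has_der F x (f x)) ->
  smooth_on a b f -> \int[mu]_(x in `[a, b]) f x = F b - F a.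
Proof.
rewrite le_eqVlt => /predU1P[<- _ _|ab dF sf].
  by rewrite set_itv1 Rintegral_set1 subrr.
have cF x : a <= x <= b -> F y @[y --> x] --> F x.
  by move=> /dF /der_continuous.
rewrite /Rintegral (@continuous_FTC2 _ f F)//=.
- exact: smooth_within.
- split.
  + by move=> x /subset_itv_oo_cc; rewrite in_itv/= => /dF[].
  + by apply: cvg_at_right_filter; apply: cF; rewrite lexx ltW.
  + by apply: cvg_at_left_filter; apply: cF; rewrite lexx ltW.
- move=> x /subset_itv_oo_cc; rewrite in_itv/= => /dF[_ <-].
  by rewrite derive1E.
Qed.

Lemma der_le_increment a b F G f g : a <= b ->
  (forall x, a <= x <= b -> has_der F x (f x)) ->
  (forall x, a <= x <= b -> has_der G x (g x)) ->
  (forall x, a <= x <= b -> f x <= g x) -> F b - F a <= G b - G a.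
Proof.
move=> ab dF dG fg.
have dH x : a <= x <= b -> has_der (fun y => G y + - F y) x (g x + - f x).
  by move=> xab; apply: derD; [exact: dG|apply: derN; exact: dF].
have [||c cab H] := @MVT_segment R (fun y => G y + - F y) (fun x => g x + - f x) a b ab.
- by move=> x /subset_itv_oo_cc; rewrite in_itv/=; exact: dH.
- by apply: smooth_within => x /dH; exists (g x + - f x).
have : 0 <= (g c + - f c) * (b - a).
  by rewrite mulr_ge0 ?subr_ge0//; apply: fg; move: cab; rewrite in_itv.
by rewrite -H; lra.
Qed.

(** Serves as an integral estimate: a majorant of [|f|] with an explicit primitive [G] controls the
    increment of [F]. *)
Lemma der_norm_increment a b F G f g : a <= b ->
  (forall x, a <= x <= b -> has_der F x (f x)) ->
  (forall x, a <= x <= b -> has_der G x (g x)) ->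
  (forall x, a <= x <= b -> `|f x| <= g x) -> `|F b - F a| <= G b - G a.
Proof.
move=> ab dF dG fg; rewrite ler_norml; apply/andP; split.
- have : - F b - - F a <= G b - G a; last lra.
  apply: (@der_le_increment a b (fun y => - F y) G (fun y => - f y) g) => //.
    by move=> x xab; apply: derN; exact: dF.
  by move=> x /fg; rewrite ler_norml lerNl => /andP[].
- by apply: der_le_increment dF dG _ => // x /fg; rewrite ler_norml => /andP[].
Qed.

End SegmentCalculus.

(** * Plancherel bounds for the Fourier transform *)

Section AbelPoisson.
Context {R : realType}.
Local Notation mu := (@lebesgue_measure R).
Implicit Types (f : R -> R) (e B x p r : R).

(** Closed form of the integral of [exp (- e p) cos (p x)] over [0 <= p <= B]; it tends to the
    Poisson kernel as [B] grows. *)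
Definition abelW e B x : R :=
  (e + expR (- e * B) * (x * sin (B * x) - e * cos (B * x))) / (e ^+ 2 + x ^+ 2).

Definition poisson e x : R := e / (e ^+ 2 + x ^+ 2).

Lemma poisson_den e x : 0 < e -> 0 < e ^+ 2 + x ^+ 2.
Proof. by move=> e0; rewrite ltr_wpDr ?sqr_ge0// exprn_gt0. Qed.

Lemma int_exp_cos e B x : 0 < e -> 0 <= B ->
  \int[mu]_(p in `[0, B]) (expR (- e * p) * cos (p * x)) = abelW e B x.
Proof.
move=> e0 B0; have D0 := lt0r_neq0 (poisson_den x e0).
pose F p := (expR (- e * p) * (x * sin (p * x) - e * cos (p * x))) / (e ^+ 2 + x ^+ 2).
transitivity (F B - F 0).
  apply: int_FTC2 => // p _.
    apply: der_eq; first by rewrite /F; derive_auto.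
    by rewrite /=; field.
  by eexists; derive_auto.
rewrite /F /abelW mulr0 mul0r expR0 sin0 cos0 -mulrBl; congr (_ / _); ring.
Qed.

Lemma int_poisson e r a b : 0 < e -> a <= b ->
  \int[mu]_(x in `[a, b]) poisson e (r - x) = atan ((b - r) / e) + atan ((r - a) / e).
Proof.
move=> e0 ab; have e0' := lt0r_neq0 e0.
transitivity (atan ((b - r) / e) - atan ((a - r) / e)); last first.
  by rewrite -[in RHS](opprB a r) mulNr atanN.
apply: (@int_FTC2 _ _ _ _ (fun x => atan ((x - r) / e))) => // x _.
- apply: der_eq; first by derive_auto.
  have D0 := lt0r_neq0 (poisson_den (r - x) e0).
  have D1 : 1 + ((x - r) / e) ^+ 2 != 0 by rewrite gt_eqF// ltr_wpDr ?sqr_ge0.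
  rewrite /poisson /=; field.
  by rewrite D0 e0'.
- have D0 := lt0r_neq0 (poisson_den (r - x) e0).
  by eexists; rewrite /poisson; derive_auto.
Qed.

(** The difference is the exponential times [(x sin - e cos) / (e^2 + x^2)], and
    [e (|x| + e) <= 2 (e^2 + x^2)]. *)
Lemma abelW_close e B x : 0 < e -> `|abelW e B x - poisson e x| <= expR (- e * B) * (2 / e).
Proof.
move=> e0; have D0 := poisson_den x e0.
rewrite /abelW /poisson -mulrBl addrC addKr normrM normrM ger0_norm ?expR_ge0//.
rewrite -mulrA ler_wpM2l ?expR_ge0// [`|_^-1|]gtr0_norm ?invr_gt0// ler_pdivrMr//.
have H : `|x * sin (B * x) - e * cos (B * x)| <= `|x| + e.
  rewrite (le_trans (ler_normB _ _))// !normrM (gtr0_norm e0) lerD//.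
    by rewrite ler_piMr// ler_norml sin_geN1 sin_le1.
  by rewrite ler_piMr ?(ltW e0)// ler_norml cos_geN1 cos_le1.
apply: (le_trans H); rewrite mulrAC ler_pdivlMr// -(real_normK (num_real x)).
have := sqr_ge0 (e - `|x|); have := sqr_ge0 `|x|; have := sqr_ge0 e; nra.
Qed.

End AbelPoisson.

Section Plancherel.
Context {R : realType}.
Variables al be : R.
Hypothesis albe : al < be.
Local Notation mu := (@lebesgue_measure R).
Variable f : R -> R.
Hypothesis bf : bmf f.

Definition cosT p : R := \int[mu]_(r in `[al, be]) (cos (p * r) * f r).
Definition sinT p : R := \int[mu]_(r in `[al, be]) (sin (p * r) * f r).

Let bmf2_mul (h : R -> R) : continuous h -> (forall x, `|h x| <= 1) ->
  bmf2 (fun z : R * R => h (z.1 * z.2)).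
Proof.
move=> ch h1; apply: (bmf2_continuous_comp _ _ h1) => //.
exact: measurable_funM.
Qed.

Let cos1 (x : R) : `|cos x| <= 1.
Proof. by rewrite ler_norml cos_geN1 cos_le1. Qed.

Let sin1 (x : R) : `|sin x| <= 1.
Proof. by rewrite ler_norml sin_geN1 sin_le1. Qed.

Let bcos := bmf2_mul (@continuous_cos R) cos1.
Let bsin := bmf2_mul (@continuous_sin R) sin1.

Lemma bmf_cosT : bmf cosT.
Proof.
apply: (@bmf_param _ al be (fun z => cos (z.1 * z.2) * f z.2)); first exact: ltW.
by apply: bmf2M => //; exact: bmf2_snd.
Qed.

Lemma bmf_sinT : bmf sinT.
Proof.
apply: (@bmf_param _ al be (fun z => sin (z.1 * z.2) * f z.2)); first exact: ltW.
by apply: bmf2M => //; exact: bmf2_snd.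
Qed.

Let Phi (z : R * R) := cos (z.1 * z.2) * cosT z.1 + sin (z.1 * z.2) * sinT z.1.

Let bPhi : bmf2 Phi.
Proof.
apply: bmf2D; apply: bmf2M => //; apply: bmf2_fst; [exact: bmf_cosT|exact: bmf_sinT].
Qed.

Let bcosf p : bmf (fun r => cos (p * r) * f r).
Proof. by apply: bmfM => //; exact: (bmf2_section p bcos). Qed.

Let bsinf p : bmf (fun r => sin (p * r) * f r).
Proof. by apply: bmfM => //; exact: (bmf2_section p bsin). Qed.

Let PhiE p r : Phi (p, r) = \int[mu]_(x in `[al, be]) (cos (p * (r - x)) * f x).
Proof.
rewrite /Phi /= /cosT /sinT -!intZ// -intD; [|by apply: bmfZ..].
by apply: int_eq => x _; rewrite mulrBr cosB; ring.
Qed.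

Let int_fPhi p : \int[mu]_(r in `[al, be]) (f r * Phi (p, r)) = cosT p ^+ 2 + sinT p ^+ 2.
Proof.
transitivity (\int[mu]_(r in `[al, be]) (cosT p * (cos (p * r) * f r) + sinT p * (sin (p * r) * f r))).
  by apply: int_eq => r _; rewrite /Phi/=; ring.
by rewrite intD ?intZ//; exact: bmfZ.
Qed.

(** The absolute value keeps the damping bounded on the whole line, as [bmf] demands; on [[0, B]] it
    has no effect. *)
Let damp (e p : R) := expR (- e * `|p|).

Let bdamp (e : R) : 0 < e -> bmf (damp e).
Proof.
move=> e0; apply: (@bmf_continuous _ _ 1).
  move=> x; apply: continuous_comp; last exact: continuous_expR.
  by apply: cvgM; [exact: cvg_cst|exact: norm_continuous].
move=> x; rewrite ger0_norm ?expR_ge0// -expR0 ler_expR mulNr oppr_le0.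
by rewrite mulr_ge0// ltW.
Qed.

Let dampE (e B : R) (g : R -> R) : \int[mu]_(p in `[0, B]) (damp e p * g p) =
  \int[mu]_(p in `[0, B]) (expR (- e * p) * g p).
Proof. by apply: int_eq => q /andP[q0 _]; rewrite /damp ger0_norm. Qed.

(** [cosT^2 + sinT^2] is the double integral of [f r * f x * cos (p (r - x))]. Two exchanges bring
    the [p]-integral inside, where it is [abelW]. *)
Lemma abel_energy (e B : R) : 0 < e -> 0 <= B ->
  \int[mu]_(p in `[0, B]) (expR (- e * p) * (cosT p ^+ 2 + sinT p ^+ 2)) =
  \int[mu]_(r in `[al, be]) \int[mu]_(x in `[al, be]) (f r * f x * abelW e B (r - x)).
Proof.
move=> e0 B0; rewrite -dampE//.
transitivity (\int[mu]_(p in `[0, B]) \int[mu]_(r in `[al, be]) (damp e p * f r * Phi (p, r))).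
  apply: int_eq => p _; rewrite -int_fPhi -intZ; last first.
    by apply: bmfM => //; exact: bmf2_section.
  by apply: int_eq => r _; ring.
rewrite (@int_swap _ 0 B al be (fun z => damp e z.1 * f z.2 * Phi z)); last first.
  by apply: bmf2M => //; apply: bmf2M; [apply: bmf2_fst; exact: bdamp|exact: bmf2_snd].
apply: int_eq => r _ /=.
transitivity (\int[mu]_(p in `[0, B]) \int[mu]_(x in `[al, be])
    (f r * f x * (damp e p * cos (p * (r - x))))).
  apply: int_eq => p _; rewrite PhiE -intZ; last first.
    apply: bmfM => //; apply: (@bmf_continuous _ _ 1) => [x|x]; last exact: cos1.
    apply: continuous_comp; last exact: continuous_cos.
    by apply: cvgM; [exact: cvg_cst|apply: cvgB; [exact: cvg_cst|exact: cvg_id]].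
  by apply: int_eq => x _; ring.
rewrite (@int_swap _ 0 B al be (fun z => f r * f z.2 * (damp e z.1 * cos (z.1 * (r - z.2))))); last first.
  apply: bmf2M; first by apply: (bmf2_snd (f := fun x => f r * f x)); exact: bmfZ.
  apply: bmf2M; first by apply: bmf2_fst; exact: bdamp.
  apply: (bmf2_continuous_comp _ _ cos1); first exact: continuous_cos.
  by apply: measurable_funM => //; apply: measurable_funB.
apply: int_eq => x _ /=; rewrite intZ; last first.
  apply: bmfM; first exact: bdamp.
  apply: (@bmf_continuous _ _ 1) => [p|p]; last exact: cos1.
  apply: continuous_comp; last exact: continuous_cos.
  by apply: cvgM; [exact: cvg_id|exact: cvg_cst].
by rewrite dampE// int_exp_cos.
Qed.

End Plancherel.

Section EnergyBounds.
Context {R : realType}.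
Variables al be : R.
Hypothesis albe : al < be.
Local Notation mu := (@lebesgue_measure R).
Implicit Types (e B x r : R).

Let D := be - al.
Let D0 : 0 < D. Proof. by rewrite subr_gt0. Qed.

Definition int2 (k : R * R -> R) : R :=
  \int[mu]_(r in `[al, be]) \int[mu]_(x in `[al, be]) k (r, x).

Let bin k : bmf2 k -> bmf (fun r => \int[mu]_(x in `[al, be]) k (r, x)).
Proof. by move=> bk; apply: bmf_param bk; exact: ltW. Qed.

Lemma int2D k k' : bmf2 k -> bmf2 k' -> int2 (fun z => k z + k' z) = int2 k + int2 k'.
Proof.
move=> bk bk'; rewrite /int2 -intD//; [|exact: bin..].
by apply: int_eq => r _; rewrite intD//; exact: bmf2_section.
Qed.

Lemma int2_le k k' : bmf2 k -> bmf2 k' ->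
  (forall r x, al <= r <= be -> al <= x <= be -> k (r, x) <= k' (r, x)) ->
  int2 k <= int2 k'.
Proof.
move=> bk bk' kk'; apply: int_le; [exact: bin..|] => r rab.
by apply: int_le; [exact: bmf2_section..|] => x; exact: kk'.
Qed.

Lemma int2_cst c : int2 (fun=> c) = c * D ^+ 2.
Proof.
rewrite /int2; under eq_Rintegral do rewrite int_cst ?(ltW albe)//.
by rewrite int_cst ?(ltW albe)// -mulrA -expr2.
Qed.

Lemma bmf2_cst (c : R) : bmf2 (fun=> c : R).
Proof. by split; [exact: measurable_cst|exists `|c|]. Qed.

Lemma bmf2_diff (g : R -> R) M : continuous g -> (forall x, `|g x| <= M) ->
  bmf2 (fun z : R * R => g (z.1 - z.2)).
Proof.
move=> cg gM; apply: (bmf2_continuous_comp _ _ gM) => //.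
by apply: measurable_funB.
Qed.

Lemma bmf2_poisson e : 0 < e -> bmf2 (fun z : R * R => poisson e (z.1 - z.2)).
Proof.
move=> e0; apply: (@bmf2_diff _ e^-1) => x.
  have H0 := lt0r_neq0 (poisson_den x e0).
  by apply: der_continuous; rewrite /poisson; derive_auto.
have H0 := poisson_den x e0.
rewrite /poisson ger0_norm ?divr_ge0 ?(ltW e0) ?(ltW H0)// ler_pdivrMr// mulrC ler_pdivlMr//.
by rewrite -expr2 lerDl sqr_ge0.
Qed.

Lemma bmf2_abelW e B : 0 < e -> bmf2 (fun z : R * R => abelW e B (z.1 - z.2)).
Proof.
move=> e0; apply: (@bmf2_diff _ (e^-1 + expR (- e * B) * (2 / e))) => x.
  have H0 := lt0r_neq0 (poisson_den x e0).
  by apply: der_continuous; rewrite /abelW; derive_auto.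
rewrite -(subrK (poisson e x) (abelW e B x)) (le_trans (ler_normD _ _))// addrC.
rewrite lerD ?abelW_close//.
have H0 := poisson_den x e0.
rewrite /poisson ger0_norm ?divr_ge0 ?(ltW e0) ?(ltW H0)// ler_pdivrMr// mulrC ler_pdivlMr//.
by rewrite -expr2 lerDl sqr_ge0.
Qed.

Variable f : R -> R.
Hypothesis bf : bmf f.

(** The mass put on the segment by the Poisson kernel centred at [r]: at most [pi], and near [pi]
    for small [e] if [r] is away from both ends. *)
Definition poisson_mass e r : R := atan ((be - r) / e) + atan ((r - al) / e).

Let tail M e B := M ^+ 2 * (expR (- e * B) * (2 / e)).

Let int2_poisson e : 0 < e ->
  int2 (fun z => f z.1 * f z.1 * poisson e (z.1 - z.2)) =
  \int[mu]_(r in `[al, be]) (f r * f r * poisson_mass e r).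
Proof.
move=> e0; apply: int_eq => r _ /=.
by rewrite intZ ?int_poisson ?(ltW albe)//; exact: (bmf2_section r (bmf2_poisson e0)).
Qed.

Let bsq : bmf (fun r => f r * f r). Proof. exact: bmfM. Qed.

Let bsqP e : 0 < e -> bmf2 (fun z => f z.1 * f z.1 * poisson e (z.1 - z.2)).
Proof.
move=> e0; apply: bmf2M; last exact: bmf2_poisson.
exact: (bmf2_fst (f := fun r => f r * f r)).
Qed.

Let bsqP' e : 0 < e -> bmf2 (fun z => f z.2 * f z.2 * poisson e (z.1 - z.2)).
Proof.
move=> e0; apply: bmf2M; last exact: bmf2_poisson.
exact: (bmf2_snd (f := fun r => f r * f r)).
Qed.

Let int2_poisson' e : 0 < e ->
  int2 (fun z => f z.2 * f z.2 * poisson e (z.1 - z.2)) =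
  \int[mu]_(r in `[al, be]) (f r * f r * poisson_mass e r).
Proof.
move=> e0; apply: etrans (int2_poisson e0); rewrite /int2.
rewrite (int_swap al be al be (bsqP' e0)).
by apply: int_eq => r _; apply: int_eq => x _ /=; rewrite /poisson -[r - x]opprB sqrrN.
Qed.

Let bffW e B : 0 < e -> bmf2 (fun z => f z.1 * f z.2 * abelW e B (z.1 - z.2)).
Proof.
move=> e0; apply: bmf2M; last exact: bmf2_abelW.
by apply: bmf2M; [exact: bmf2_fst|exact: bmf2_snd].
Qed.

Let poisson_ge0 e x : 0 < e -> 0 <= poisson e x.
Proof. by move=> e0; rewrite divr_ge0 ?(ltW e0) ?ltW// poisson_den. Qed.

Let ffW_close M e B r x : 0 < e -> (forall x, `|f x| <= M) ->
  `|f r * f x * abelW e B (r - x) - f r * f x * poisson e (r - x)| <= tail M e B.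
Proof.
move=> e0 fM; rewrite -mulrBr normrM normrM ler_pM ?abelW_close//.
by rewrite expr2 ler_pM.
Qed.

(* Both bounds come from
   [2 f(r) f(x) = f(r)^2 + f(x)^2 - (f(r) - f(x))^2]. *)
Lemma abel_energy_le M e B : 0 < e -> (forall x, `|f x| <= M) ->
  int2 (fun z => f z.1 * f z.2 * abelW e B (z.1 - z.2)) <=
  \int[mu]_(r in `[al, be]) (f r * f r * poisson_mass e r) + tail M e B * D ^+ 2.
Proof.
move=> e0 fM; set S := \int[mu]_(_ in _) _.
have : int2 (fun z => f z.1 * f z.2 * abelW e B (z.1 - z.2)
    + f z.1 * f z.2 * abelW e B (z.1 - z.2)) <=
   int2 (fun z => f z.1 * f z.1 * poisson e (z.1 - z.2) +
      (f z.2 * f z.2 * poisson e (z.1 - z.2) + 2 * tail M e B)).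
  have b0 := bffW B e0; have b1 := bsqP e0; have b2 := bsqP' e0.
  have b3 := bmf2_cst (2 * tail M e B).
  apply: int2_le; [exact: bmf2D|by repeat apply: bmf2D|] => r x _ _ /=.
  have := @ffW_close M e B r x e0 fM; have := @poisson_ge0 e (r - x) e0.
  rewrite ler_norml => P0 /andP[_ H].
  have := mulr_ge0 (sqr_ge0 (f r - f x)) P0; move: H; set W := abelW _ _ _.
  by move: (tail M e B) (poisson e (r - x)) => T P H1 H2; nra.
rewrite int2D; [|exact: bffW..].
rewrite int2D; [|exact: bsqP|by apply: bmf2D; [exact: bsqP'|exact: bmf2_cst]].
rewrite int2D; [|exact: bsqP'|exact: bmf2_cst].
rewrite int2_cst int2_poisson// int2_poisson'// -/S; lra.
Qed.

Lemma abel_energy_ge M l e B : 0 < e -> (forall x, `|f x| <= M) ->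
  (forall r x, al <= r <= be -> al <= x <= be -> `|f r - f x| <= l * `|r - x|) ->
  \int[mu]_(r in `[al, be]) (f r * f r * poisson_mass e r)
    - (l ^+ 2 * e / 2 + tail M e B) * D ^+ 2 <=
  int2 (fun z => f z.1 * f z.2 * abelW e B (z.1 - z.2)).
Proof.
move=> e0 fM fl; set S := \int[mu]_(_ in _) _.
have : int2 (fun z => f z.1 * f z.1 * poisson e (z.1 - z.2) +
      (f z.2 * f z.2 * poisson e (z.1 - z.2) + (- (l ^+ 2 * e + 2 * tail M e B)))) <=
   int2 (fun z => f z.1 * f z.2 * abelW e B (z.1 - z.2)
    + f z.1 * f z.2 * abelW e B (z.1 - z.2)).
  have b0 := bffW B e0; have b1 := bsqP e0; have b2 := bsqP' e0.
  have b3 := bmf2_cst (- (l ^+ 2 * e + 2 * tail M e B)).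
  apply: int2_le; [by repeat apply: bmf2D|exact: bmf2D|] => r x rab xab /=.
  have := @ffW_close M e B r x e0 fM; have P0 := @poisson_ge0 e (r - x) e0.
  rewrite ler_norml => /andP[H _].
  (* [x^2] times the Poisson kernel at [x] is at most [e], so a Lipschitz [f] loses only an amount
     of order [e]. *)
  have H2 : (f r - f x) ^+ 2 * poisson e (r - x) <= l ^+ 2 * e.
    apply: (@le_trans _ _ ((l * (r - x)) ^+ 2 * poisson e (r - x))).
      rewrite ler_wpM2r// -[leLHS]real_normK ?num_real// -[leRHS]real_normK ?num_real//.
      rewrite ler_pXn2r ?nnegrE// normrM (le_trans (fl r x rab xab))//.
      by rewrite ler_wpM2r// ler_norm.
    rewrite exprMn -mulrA ler_wpM2l ?sqr_ge0// /poisson mulrCA mulrA.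
    by rewrite ler_pdivrMr ?poisson_den// ler_wpM2l ?(ltW e0)// lerDr sqr_ge0.
  move: H H2; set W := abelW _ _ _.
  by move: (tail M e B) (poisson e (r - x)) => T P H1 H2; nra.
rewrite [X in _ <= X]int2D; [|exact: bffW..].
rewrite int2D; [|exact: bsqP|by apply: bmf2D; [exact: bsqP'|exact: bmf2_cst]].
rewrite int2D; [|exact: bsqP'|exact: bmf2_cst].
rewrite int2_cst int2_poisson// int2_poisson'// -/S; lra.
Qed.

End EnergyBounds.

(** * Plancherel inequalities on the half-line of frequencies *)

Section PlancherelBounds.
Context {R : realType}.
Variables al be : R.
Hypothesis albe : al < be.
Local Notation mu := (@lebesgue_measure R).
Variable f : R -> R.
Hypothesis bf : bmf f.

Let D := be - al.
Let D0 : 0 < D. Proof. by rewrite subr_gt0. Qed.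

Lemma int_subset (a b c d : R) (h : R -> R) : bmf h -> a <= c -> d <= b ->
  (forall x, a <= x <= b -> 0 <= h x) ->
  \int[mu]_(x in `[c, d]) h x <= \int[mu]_(x in `[a, b]) h x.
Proof.
move=> bh ac db h0; rewrite /Rintegral fine_le//.
- by apply: integrable_fin_num => //; exact: bmf_integrable.
- by apply: integrable_fin_num => //; exact: bmf_integrable.
- apply: ge0_subset_integral => //=.
  + by have [mh _] := bh; apply/measurable_EFinP; exact: measurable_funS mh.
  + by move=> x /=; rewrite !in_itv/= => /andP[cx xd]; rewrite (le_trans ac)// (le_trans xd).
Qed.

Let g p := cosT al be f p ^+ 2 + sinT al be f p ^+ 2.

Let bg : bmf g.
Proof.
have bc := bmf_cosT albe bf; have bs := bmf_sinT albe bf.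
by apply: bmfD; rewrite -[X in bmf X]/(fun p => _ * _); exact: bmfM.
Qed.

Let g0 p : 0 <= g p. Proof. by rewrite addr_ge0 ?sqr_ge0. Qed.

Let bdampg e : 0 < e -> bmf (fun p => expR (- e * `|p|) * g p).
Proof.
move=> e0; apply: bmfM => //; apply: (@bmf_continuous _ _ 1).
  move=> x; apply: continuous_comp; last exact: continuous_expR.
  by apply: cvgM; [exact: cvg_cst|exact: norm_continuous].
move=> x; rewrite ger0_norm ?expR_ge0// -expR0 ler_expR mulNr oppr_le0.
by rewrite mulr_ge0// ltW.
Qed.

Let damped (e B : R) := \int[mu]_(p in `[0, B]) (expR (- e * p) * g p).

Let dampedE e B : damped e B = \int[mu]_(p in `[0, B]) (expR (- e * `|p|) * g p).
Proof. by apply: int_eq => p /andP[p0 _]; rewrite ger0_norm. Qed.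

Let damped_le e B : 0 < e -> 0 <= B -> damped e B <= \int[mu]_(p in `[0, B]) g p.
Proof.
move=> e0 B0; rewrite dampedE; apply: int_le => // [|p _]; first exact: bdampg.
by rewrite ler_piMl// -expR0 ler_expR mulNr oppr_le0 mulr_ge0// ltW.
Qed.

Let damped_ge e A B : 0 < e -> 0 <= A <= B ->
  (1 - e * A) * \int[mu]_(p in `[0, A]) g p <= damped e B.
Proof.
move=> e0 /andP[A0 AB]; rewrite dampedE; have bd := bdampg e0.
apply: le_trans (int_subset bd (lexx 0) AB _); last first.
  by move=> x _; rewrite mulr_ge0 ?expR_ge0.
rewrite -intZ//; apply: int_le => // [|p /andP[p0 pA]]; first exact: bmfZ.
rewrite ler_wpM2r// (le_trans _ (expR_ge1Dx _))// mulNr lerD2l lerN2.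
by rewrite ler_wpM2l ?(ltW e0)// ger0_norm.
Qed.

(** [exp (e B) >= 1 + e B] reduces the bound to [K <= e^2 B]. *)
Let large_B (e K A : R) : 0 < e -> 0 <= K -> exists2 B, A <= B & 0 <= B /\
  expR (- e * B) * K <= e.
Proof.
move=> e0 K0; exists (Num.max A (K / e ^+ 2)); first by rewrite le_max lexx.
set B := Num.max _ _; have KB : K / e ^+ 2 <= B by rewrite le_max lexx orbT.
have B0 : 0 <= B by rewrite (le_trans _ KB)// divr_ge0 ?sqr_ge0.
split => //; rewrite mulNr expRN mulrC ler_pdivrMr ?expR_gt0//.
apply: (@le_trans _ _ (e * (1 + e * B))); last by rewrite ler_wpM2l ?(ltW e0)// expR_ge1Dx.
move: KB; rewrite ler_pdivrMr ?exprn_gt0// => KB.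
by rewrite mulrDr mulr1 ler_wpDl ?(ltW e0)// mulrA -expr2 mulrC.
Qed.

Let energyE (e B : R) : 0 < e -> 0 <= B ->
  damped e B = int2 al be (fun z => f z.1 * f z.2 * abelW e B (z.1 - z.2)).
Proof. exact: abel_energy. Qed.

Let mass_lt_pi e r : poisson_mass al be e r <= pi.
Proof.
by have := atan_ltpi2 ((be - r) / e); have := atan_ltpi2 ((r - al) / e); rewrite /poisson_mass; lra.
Qed.

Let bmass (e : R) : bmf (poisson_mass al be e).
Proof.
apply: (@bmf_continuous _ _ pi) => x.
  apply: (@der_continuous _ _ _ ((1 + ((be - x) / e) ^+ 2)^-1 * ((0 + - 1) * e^-1 + (be - x) * 0)
    + (1 + ((x - al) / e) ^+ 2)^-1 * ((1 + - 0) * e^-1 + (x - al) * 0))).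
  by rewrite /poisson_mass; derive_auto.
rewrite ler_norml mass_lt_pi andbT.
have := atan_gtNpi2 ((be - x) / e); have := atan_gtNpi2 ((x - al) / e).
by rewrite /poisson_mass; lra.
Qed.

Let bff : bmf (fun r => f r * f r). Proof. exact: bmfM. Qed.

(** The constant is [pi], half of Plancherel's [2 pi], since the energy is even in [p]. On [[0, A]]
    the damping costs at most a factor [1 - e A], the Poisson mass is at most [pi], and [B] is taken
    so large that the tail is at most [e]. *)
Lemma energy_le (A : R) : 0 <= A -> \int[mu]_(p in `[0, A]) g p <=
  pi * \int[mu]_(r in `[al, be]) (f r * f r).
Proof.
move=> A0; set S := \int[mu]_(_ in `[al, be]) _; set X := \int[mu]_(_ in _) _.
have [_ [M fM]] := bf.
have M0 : 0 <= M by exact: le_trans (fM 0).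
have X0 : 0 <= X by exact: Rintegral_ge0.
have H e : 0 < e -> (1 - e * A) * X <= pi * S + e.
  move=> e0; pose K := M ^+ 2 * (2 / e) * D ^+ 2.
  have K0 : 0 <= K.
    by rewrite mulr_ge0 ?sqr_ge0// mulr_ge0 ?sqr_ge0// divr_ge0// ltW.
  have [B AB [B0 KB]] := large_B A e0 K0.
  apply: (@le_trans _ _ (damped e B)); first by apply: damped_ge; rewrite ?A0.
  rewrite energyE//; apply: (le_trans (abel_energy_le albe bf _ e0 fM)).
  rewrite lerD//.
    rewrite -intZ//; apply: int_le; [exact: bmfM|exact: bmfZ|] => r _.
    by rewrite mulrC ler_wpM2r// -expr2 sqr_ge0.
  by rewrite (le_trans _ KB)// /K /D; rewrite le_eqVlt; apply/orP; left; apply/eqP; ring.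
apply/ler_addgt0Pr => e e0.
have AX0 : 0 < A * X + 1 by rewrite ltr_wpDl// mulr_ge0.
(* With this parameter [e'], the damping loss [e' A X] and the error [e'] add up to exactly [e]. *)
have := H (e / (A * X + 1)); rewrite divr_gt0// => /(_ isT).
have -> : (1 - e / (A * X + 1) * A) * X = X - e / (A * X + 1) * (A * X) by ring.
have -> : pi * S + e / (A * X + 1) = pi * S + e - e / (A * X + 1) * (A * X).
  by field; rewrite gt_eqF.
lra.
Qed.

(** Near an endpoint of [[al, be]] the Poisson mass stays close to [pi / 2], so the sharp constant
    is claimed only for the inner segment [[c, d]], where the mass tends to [pi] uniformly. *)
Lemma plancherel_lower (l c d delta : R) : al < c -> d < be -> c <= d -> 0 < delta ->
  (forall r x, al <= r <= be -> al <= x <= be -> `|f r - f x| <= l * `|r - x|) ->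
  exists2 B, 0 <= B &
  pi * \int[mu]_(r in `[c, d]) (f r * f r) - delta <= \int[mu]_(p in `[0, B]) g p.
Proof.
move=> alc dbe cd dl0 fl; have [_ [M fM]] := bf.
have M0 : 0 <= M by exact: le_trans (fM 0).
(* [delta] is spent in thirds: on the mass defect [ka], on the Lipschitz loss, and on the truncation
   at [B]. *)
pose ka := delta / (3 * (M ^+ 2 * D + 1)).
have MD : 0 < M ^+ 2 * D + 1 by rewrite ltr_wpDl// mulr_ge0 ?sqr_ge0// ltW.
have ka0 : 0 < ka by rewrite divr_gt0// mulr_gt0.
have [Y0 [_ HY]] : \forall y \near +oo, pi / 2 - ka / 2 < atan y.
  have := @cvgy_atan R => /cvgrPdist_lt /(_ (ka / 2)).
  rewrite divr_gt0// => /(_ isT); apply: filterS => y.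
  by rewrite ltr_norml => /andP[_]; lra.
pose ga := Num.min (c - al) (be - d).
have ga0 : 0 < ga by rewrite lt_min !subr_gt0 alc.
pose Y := Num.max (Y0 + 1) 1.
have Yg0 : 0 < Y by rewrite lt_max ltr01 orbT.
have L1 : 0 < l ^+ 2 * D ^+ 2 + 1 by rewrite ltr_wpDl// mulr_ge0 ?sqr_ge0.
pose e := Num.min (ga / Y) (Num.min (delta / 3) (2 * delta / (3 * (l ^+ 2 * D ^+ 2 + 1)))).
have e0 : 0 < e.
  by rewrite !lt_min !divr_gt0//; apply: mulr_gt0.
have e1 : e <= ga / Y by rewrite ge_min lexx.
have e2 : e <= delta / 3 by rewrite !ge_min lexx !orbT.
have e3 : l ^+ 2 * e / 2 * D ^+ 2 <= delta / 3.
  have : e <= 2 * delta / (3 * (l ^+ 2 * D ^+ 2 + 1)) by rewrite !ge_min lexx !orbT.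
  rewrite ler_pdivlMr; last exact: mulr_gt0.
  by move=> H; lra.
pose K := M ^+ 2 * (2 / e) * D ^+ 2.
have K0 : 0 <= K by rewrite mulr_ge0 ?sqr_ge0// mulr_ge0 ?sqr_ge0// divr_ge0// ltW.
have [B _ [B0 KB]] := large_B 0 e0 K0.
exists B => //; apply: le_trans (damped_le e0 B0); rewrite energyE//.
apply: le_trans (abel_energy_ge albe bf B e0 fM fl).
have atan_large y : ga / e <= y -> pi / 2 - ka / 2 < atan y.
  move=> gy; apply: HY; apply: (@lt_le_trans _ _ (ga / e)) => //.
  rewrite ltr_pdivlMr//; apply: (@lt_le_trans _ _ (Y * e)).
    by rewrite ltr_pM2r// /Y lt_max ltrDl ltr01.
  by move: e1; rewrite ler_pdivlMr// mulrC.
have mass_ge r : c <= r <= d -> pi - ka <= poisson_mass al be e r.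
  move=> /andP[cr rd]; rewrite /poisson_mass.
  have : pi / 2 - ka / 2 < atan ((be - r) / e).
    apply: atan_large; rewrite ler_pM2r ?invr_gt0// ge_min; apply/orP; right; lra.
  have : pi / 2 - ka / 2 < atan ((r - al) / e).
    apply: atan_large; rewrite ler_pM2r ?invr_gt0// ge_min; apply/orP; left; lra.
  lra.
have mass_ge0 r : al <= r <= be -> 0 <= poisson_mass al be e r.
  move=> /andP[ar rb]; rewrite addr_ge0// -atan0 le_atan// divr_ge0 ?(ltW e0)// subr_ge0//.
have bm : bmf (fun r => f r * f r * poisson_mass al be e r) by exact: bmfM.
have S1 : (pi - ka) * \int[mu]_(r in `[c, d]) (f r * f r) <=
    \int[mu]_(r in `[al, be]) (f r * f r * poisson_mass al be e r).
  apply: le_trans (int_subset bm (ltW alc) (ltW dbe) _).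
    rewrite -intZ//; apply: int_le => //; first exact: bmfZ.
    by move=> r /mass_ge H; rewrite mulrC ler_wpM2l// -expr2 sqr_ge0.
  by move=> r /mass_ge0 H; rewrite mulr_ge0// -expr2 sqr_ge0.
have S2 : ka * \int[mu]_(r in `[c, d]) (f r * f r) <= delta / 3.
  apply: (@le_trans _ _ (ka * (M ^+ 2 * D))).
    rewrite ler_wpM2l ?(ltW ka0)//.
    apply: (@le_trans _ _ (M ^+ 2 * (d - c))).
      apply: le_trans (ler_norm _) _; apply: int_norm_cst => // x _.
      by rewrite normrM expr2 ler_pM.
    by rewrite ler_wpM2l ?sqr_ge0// /D; lra.
  rewrite /ka mulrAC ler_pdivrMr ?mulr_gt0//.
  have -> : delta / 3 * (3 * (M ^+ 2 * D + 1)) = delta * (M ^+ 2 * D) + delta by field.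
  by rewrite lerDl ltW.
have S3 : M ^+ 2 * (expR (- e * B) * (2 / e)) * D ^+ 2 <= delta / 3.
  by apply: le_trans e2; rewrite (le_trans _ KB)// /K; rewrite le_eqVlt; apply/orP; left; apply/eqP; ring.
rewrite -[be - al]/D [X in _ <= _ - X]mulrDl; move: S1; rewrite mulrBl => S1.
by move: S1 S2 S3 e3; lra.
Qed.

End PlancherelBounds.

(** * An oscillatory integral and its amplitude *)

Section OscillatoryIntegral.
Context {R : realType}.
Local Notation mu := (@lebesgue_measure R).
Implicit Types (eta th x a b p : R).

(* The substitution [y = z ^ 2] turns the integral over [0, x] of
   [cos (y + eta ln y + th) / sqrt y] into one with a bounded integrand. *)
Definition osc eta th x : R :=
  \int[mu]_(z in `[0, Num.sqrt x]) (2 * cos (z ^+ 2 + 2 * eta * ln z + th)).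

Lemma bmf_cos (f : R -> R) : measurable_fun setT f -> bmf (fun x => cos (f x)).
Proof.
move=> mf; split; last by exists 1 => x; rewrite ler_norml cos_geN1 cos_le1.
by apply: measurableT_comp => //; apply: continuous_measurable_fun; exact: continuous_cos.
Qed.

Let bmf_osc eta th : bmf (fun z => 2 * cos (z ^+ 2 + 2 * eta * ln z + th)).
Proof.
apply: bmfZ; apply: bmf_cos; apply: measurable_funD => //.
apply: measurable_funD; first exact: measurable_funX.
by apply: measurable_funM => //; exact: measurable_ln.
Qed.

Lemma sqrt_gt0_ex x : 0 < x -> exists2 s : R, 0 < s & x = s ^+ 2.
Proof.
by move=> x0; exists (Num.sqrt x); rewrite ?sqrtr_gt0// sqr_sqrtr ?ltW.
Qed.

Lemma ln_sqr (s : R) : 0 < s -> ln (s ^+ 2) = 2 * ln s.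
Proof. by move=> s0; rewrite lnXn// mulr_natl. Qed.

Lemma sqrt_sqr (s : R) : 0 < s -> Num.sqrt (s ^+ 2) = s.
Proof. by move=> s0; rewrite sqrtr_sqr gtr0_norm. Qed.

Lemma has_der_osc eta th x : 0 < x ->
  has_der (osc eta th) x (cos (x + eta * ln x + th) / Num.sqrt x).
Proof.
move=> x0; have [s s0 xs] := sqrt_gt0_ex x0.
pose f z := 2 * cos (z ^+ 2 + 2 * eta * ln z + th).
pose G y := \int[mu]_(z in `[0, y]) f z.
have cf : {for s, continuous f}.
  have [l] : exists l, has_der f s l by eexists; rewrite /f; derive_auto.
  exact: der_continuous.
have ss : s < s + 1 by rewrite ltrDl.
have [dG GE] := @continuous_FTC1_closed R f 0 s (s + 1) ss (bmf_integrable _ _ (bmf_osc eta th)) s0 cf.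
have derG : has_der G s (f s).
  by split; [exact: dG|rewrite -GE derive1E].
have derG' : is_derive (Num.sqrt x) 1 G (f s) by rewrite xs sqrt_sqr//; exact: derG.
apply: der_eq; first exact: (is_derive1_comp derG' (is_derive1_sqrt x0)).
rewrite xs sqrt_sqr// ln_sqr// /f (_ : eta * (2 * _) = 2 * eta * ln s); last by ring.
by field; rewrite gt_eqF.
Qed.

Lemma osc_le eta th x : 0 <= x -> `|osc eta th x| <= 2 * Num.sqrt x.
Proof.
move=> x0; rewrite -[X in 2 * X]subr0; apply: int_norm_cst; [exact: sqrtr_ge0|exact: bmf_osc|].
by move=> z _; rewrite normrM ger0_norm// ler_piMr// ler_norml cos_geN1 cos_le1.
Qed.

(** By the addition formula every phase is a combination of two, so only two limits have to be
    studied. *)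
Lemma osc_phase eta th x : osc eta th x =
  cos th * osc eta 0 x - sin th * osc eta (- (pi / 2)) x.
Proof.
have b0 := bmf_osc eta 0; have b1 := bmf_osc eta (- (pi / 2)).
rewrite /osc -(intZ _ _ _ b0) -(intZ _ _ _ b1).
rewrite -(intB _ _ (bmfZ (cos th) b0) (bmfZ (sin th) b1)).
apply: int_eq => z _; set u := z ^+ 2 + _.
by rewrite addr0 (cosD u th) (cosD u) cosN sinN cos_pihalf sin_pihalf; ring.
Qed.

Let sin1 (x : R) : `|sin x| <= 1.
Proof. by rewrite ler_norml sin_geN1 sin_le1. Qed.

Let cos1 (x : R) : `|cos x| <= 1.
Proof. by rewrite ler_norml cos_geN1 cos_le1. Qed.

(** Integration by parts: after subtracting [sin (ph x) / sqrt x], the derivative is of order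
    [x^(-3/2)] with constant [k / 2]. The two boundary terms raise [k = 2 |eta| + 1] to
    [3 + 2 |eta|]. *)
Lemma osc_tail eta th a b : 0 < a <= b ->
  `|osc eta th b - osc eta th a| <= (3 + 2 * `|eta|) / Num.sqrt a.
Proof.
move=> /andP[a0 ab]; have b0 : 0 < b by exact: lt_le_trans ab.
pose ph x := x + eta * ln x + th.
pose F x := osc eta th x - sin (ph x) / Num.sqrt x.
pose f x := (- eta * cos (ph x) + sin (ph x) / 2) / (x * Num.sqrt x).
pose k := 2 * `|eta| + 1.
have dF x : a <= x <= b -> has_der F x (f x).
  move=> /andP[ax _]; have x0 : 0 < x by exact: lt_le_trans ax.
  have dO := has_der_osc eta th x0; have sx : Num.sqrt x != 0 by rewrite gt_eqF// sqrtr_gt0.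
  apply: der_eq; first by rewrite /F /ph; derive_auto.
  rewrite /f /= /ph; have [s s0 ->] := sqrt_gt0_ex x0; rewrite sqrt_sqr//.
  by field; rewrite gt_eqF.
have dG x : a <= x <= b -> has_der (fun x => - k / Num.sqrt x) x (k / 2 / (x * Num.sqrt x)).
  move=> /andP[ax _]; have x0 : 0 < x by exact: lt_le_trans ax.
  have sx : Num.sqrt x != 0 by rewrite gt_eqF// sqrtr_gt0.
  apply: der_eq; first by derive_auto.
  move=> /=; have [s s0 ->] := sqrt_gt0_ex x0; rewrite sqrt_sqr//.
  by field; rewrite gt_eqF.
have fg x : a <= x <= b -> `|f x| <= k / 2 / (x * Num.sqrt x).
  move=> /andP[ax _]; have x0 : 0 < x by exact: lt_le_trans ax.
  have xs0 : 0 < x * Num.sqrt x by rewrite mulr_gt0// sqrtr_gt0.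
  rewrite /f normrM normfV (gtr0_norm xs0) ler_wpM2r ?invr_ge0 ?(ltW xs0)//.
  rewrite (le_trans (ler_normD _ _))// !normrM normrN normfV [`|2|]ger0_norm//.
  have := ler_wpM2l (normr_ge0 eta) (cos1 (ph x)); have := sin1 (ph x).
  rewrite /k; lra.
have := der_norm_increment ab dF dG fg.
have sa0 : 0 < Num.sqrt a by rewrite sqrtr_gt0.
have sb0 : 0 < Num.sqrt b by rewrite sqrtr_gt0.
have ba : (Num.sqrt b)^-1 <= (Num.sqrt a)^-1 by rewrite lef_pV2// ler_wsqrtr.
have k0 : 0 <= k / Num.sqrt b by rewrite divr_ge0 ?(ltW sb0)// /k addr_ge0// mulr_ge0.
have Sb : `|sin (ph b) / Num.sqrt b| <= (Num.sqrt a)^-1.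
  rewrite normrM normfV (gtr0_norm sb0) (le_trans _ ba)// ler_piMl// invr_ge0 ltW//.
have Sa : `|sin (ph a) / Num.sqrt a| <= (Num.sqrt a)^-1.
  by rewrite normrM normfV (gtr0_norm sa0) ler_piMl// invr_ge0 ltW.
rewrite /F => H.
have -> : osc eta th b - osc eta th a =
  (osc eta th b - sin (ph b) / Num.sqrt b - (osc eta th a - sin (ph a) / Num.sqrt a)) +
  sin (ph b) / Num.sqrt b - sin (ph a) / Num.sqrt a by ring.
rewrite (le_trans (ler_normB _ _))// (le_trans (lerD (ler_normD _ _) (lexx _)))//.
rewrite (_ : (3 + _) / _ = k / Num.sqrt a + (Num.sqrt a)^-1 + (Num.sqrt a)^-1); last first.
  by rewrite /k; ring.
by rewrite !lerD// (le_trans H)// !mulNr opprK gerDr oppr_le0.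
Qed.

(** For [eta > 0] the phase derivative [(x + eta) / x] never vanishes, so one integrates by parts
    against it; [w] is [1 / (sqrt x * ph')]. By the arithmetic-geometric inequality
    [w <= 1 / (2 sqrt eta)], and the remainder has an arctangent as majorant, of variation at most
    [2 / sqrt eta]. *)
Lemma osc_small eta th a b : 0 < eta -> 0 < a <= b ->
  `|osc eta th b - osc eta th a| <= 3 / Num.sqrt eta.
Proof.
move=> eta0 /andP[a0 ab]; have b0 : 0 < b by exact: lt_le_trans ab.
have [h h0 eh] := sqrt_gt0_ex eta0.
pose ph x := x + eta * ln x + th.
pose w x := Num.sqrt x / (x + eta).
pose F x := osc eta th x - sin (ph x) * w x.
pose w' x := (eta - x) / (2 * Num.sqrt x * (x + eta) ^+ 2).
pose f x := - sin (ph x) * w' x.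
have wE x : 0 < x -> w x <= (2 * Num.sqrt eta)^-1.
  move=> /sqrt_gt0_ex[s s0 ->]; rewrite /w eh !sqrt_sqr//.
  rewrite ler_pdivrMr ?addr_gt0 ?exprn_gt0// mulrC ler_pdivlMr ?mulr_gt0//.
  by have := sqr_ge0 (s - h); nra.
have w0 x : 0 < x -> 0 <= w x.
  by move=> x0; rewrite divr_ge0 ?sqrtr_ge0// addr_ge0// ltW.
have dF x : a <= x <= b -> has_der F x (f x).
  move=> /andP[ax _]; have x0 : 0 < x by exact: lt_le_trans ax.
  have dO := has_der_osc eta th x0.
  have xe : x + eta != 0 by rewrite gt_eqF// addr_gt0.
  apply: der_eq; first by rewrite /F /ph /w; derive_auto.
  rewrite /f /w' /= /ph; move: xe; have [s s0 ->] := sqrt_gt0_ex x0; rewrite sqrt_sqr//.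
  by move=> xe; field; rewrite xe gt_eqF.
have dG x : a <= x <= b -> has_der (fun x => atan (Num.sqrt x / h) / h) x
    (1 / (2 * Num.sqrt x * (x + eta))).
  move=> /andP[ax _]; have x0 : 0 < x by exact: lt_le_trans ax.
  apply: der_eq; first by derive_auto.
  move=> /=; rewrite eh; have [s s0 ->] := sqrt_gt0_ex x0; rewrite sqrt_sqr//.
  have H1 : 0 < s ^+ 2 + h ^+ 2 by rewrite addr_gt0// exprn_gt0.
  have H2 : 1 + (s / h) ^+ 2 = (s ^+ 2 + h ^+ 2) / h ^+ 2 by field; rewrite gt_eqF.
  by rewrite H2; field; rewrite !gt_eqF.
have fg x : a <= x <= b -> `|f x| <= 1 / (2 * Num.sqrt x * (x + eta)).
  move=> /andP[ax _]; have x0 : 0 < x by exact: lt_le_trans ax.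
  have s0 : 0 < Num.sqrt x by rewrite sqrtr_gt0.
  have e0 : 0 < x + eta by exact: addr_gt0.
  rewrite /f normrM normrN (le_trans (ler_piMl _ (sin1 _)))//.
  have d0 : 0 < 2 * Num.sqrt x * (x + eta) ^+ 2 by rewrite mulr_gt0 ?exprn_gt0// mulr_gt0.
  rewrite /w' normrM normfV (gtr0_norm d0).
  rewrite ler_pdivrMr//.
  rewrite (_ : 1 / _ * _ = x + eta); last by field; rewrite !gt_eqF.
  by rewrite ler_norml; apply/andP; split; lra.
have := der_norm_increment ab dF dG fg.
have G2 : atan (Num.sqrt b / h) / h - atan (Num.sqrt a / h) / h <= 2 / h.
  rewrite -mulrBl ler_wpM2r ?invr_ge0 ?(ltW h0)//.
  have : 0 <= atan (Num.sqrt a / h) by rewrite -atan0 le_atan// divr_ge0 ?sqrtr_ge0 ?(ltW h0).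
  have := atan_ltpi2 (Num.sqrt b / h); have := @pihalf_02 R; lra.
have sw x : 0 < x -> `|sin (ph x) * w x| <= 2^-1 / h.
  move=> x0; rewrite normrM (ger0_norm (w0 _ x0)) (le_trans (ler_piMl _ (sin1 _)))//.
    exact: w0.
  by rewrite (le_trans (wE _ x0))// eh sqrt_sqr// invfM.
have := sw _ a0; have := sw _ b0; rewrite /F => Sb Sa H.
have -> : osc eta th b - osc eta th a =
  (osc eta th b - sin (ph b) * w b - (osc eta th a - sin (ph a) * w a)) +
  sin (ph b) * w b - sin (ph a) * w a by ring.
rewrite (le_trans (ler_normB _ _))// (le_trans (lerD (ler_normD _ _) (lexx _)))//.
have -> : Num.sqrt eta = h by rewrite eh sqrt_sqr.
rewrite (_ : 3 / h = 2 / h + 2^-1 / h + 2^-1 / h); last by field; rewrite gt_eqF.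
apply: lerD => //; apply: lerD => //; exact: le_trans H G2.
Qed.

(** Substituting [y = p r] trades the frequency for the phase shift [- eta ln p]; this shift is the
    origin of the dual packet. *)
Lemma int_osc eta th p a b : 0 < p -> 0 < a <= b ->
  \int[mu]_(r in `[a, b]) (cos (p * r + eta * ln r + th) / Num.sqrt r) =
  (osc eta (th - eta * ln p) (p * b) - osc eta (th - eta * ln p) (p * a)) / Num.sqrt p.
Proof.
move=> p0 /andP[a0 ab]; set t := th - _; rewrite mulrBl.
have x0 x : a <= x <= b -> 0 < x by move=> /andP[ax _]; exact: lt_le_trans ax.
apply: (@int_FTC2 _ a b _ (fun x => osc eta t (p * x) / Num.sqrt p)) => // x /x0 {}x0.
- have px0 : 0 < p * x by exact: mulr_gt0.
  have dO : has_der (fun x => osc eta t (p * x)) x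
      (cos (p * x + eta * ln (p * x) + t) / Num.sqrt (p * x) * p).
    apply: (is_derive1_comp (has_der_osc eta t px0)).
    by apply: der_eq (derM (der_cst x p) (der_id x)) _; rewrite mul0r mulr1 add0r.
  apply: der_eq; first by derive_auto.
  rewrite /= lnM ?posrE// /t.
  rewrite (_ : p * x + eta * (ln p + ln x) + (th - eta * ln p) = p * x + eta * ln x + th); last by ring.
  have [s s0 ->] := sqrt_gt0_ex x0; have [q q0 ->] := sqrt_gt0_ex p0.
  rewrite -exprMn !sqrt_sqr ?mulr_gt0//.
  by field; rewrite !gt_eqF.
- have sx : Num.sqrt x != 0 by rewrite gt_eqF// sqrtr_gt0.
  by eexists; derive_auto.
Qed.

(** A Cauchy criterion that keeps the rate: the limit is the supremum of the lower bounds
    [h a - C / sqrt a]. *)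
Lemma tail_limit (h : R -> R) C :
  (forall a b, 0 < a <= b -> `|h b - h a| <= C / Num.sqrt a) ->
  exists L, forall a, 0 < a -> `|h a - L| <= C / Num.sqrt a.
Proof.
move=> H; pose E := [set y | exists2 a, 0 < a & y = h a - C / Num.sqrt a].
have C0 a : 0 < a -> 0 <= C / Num.sqrt a.
  by move=> a0; apply: le_trans (H a a _); rewrite ?a0/=.
have ub b : 0 < b -> ubound E (h b + C / Num.sqrt b).
  move=> b0 _ [a a0 ->]; have := C0 a a0; have := C0 b b0.
  have [ab|/ltW ba] := leP a b.
    have := H a b; rewrite a0 ab => /(_ isT); rewrite ler_norml => /andP[]; lra.
  have := H b a; rewrite b0 ba => /(_ isT); rewrite ler_norml => /andP[]; lra.
have hs : has_sup E.
  by split; [exists (h 1 - C / Num.sqrt 1); exists 1|exists (h 1 + C / Num.sqrt 1); exact: ub].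
exists (sup E) => a a0; rewrite ler_norml; apply/andP; split.
  have : sup E <= h a + C / Num.sqrt a by apply: ge_sup; [exact: hs.1|exact: ub].
  lra.
have : h a - C / Num.sqrt a <= sup E by apply: ub_le_sup; [exact: hs.2|exists a].
lra.
Qed.

End OscillatoryIntegral.

(** * Limits of the oscillatory integrals, their decay and continuity in [eta] *)

Section OscillatoryLimit.
Context {R : realType}.
Local Notation mu := (@lebesgue_measure R).
Implicit Types (eta th x a b p : R).

Definition osc_const eta : R := 3 + 2 * `|eta|.

Lemma osc_const_gt0 eta : 0 < osc_const eta.
Proof. by rewrite ltr_wpDr// mulr_ge0. Qed.

Lemma osc_limit_ex eta th : exists L, forall a, 0 < a ->
  `|osc eta th a - L| <= osc_const eta / Num.sqrt a.
Proof. by apply: tail_limit => a b; exact: osc_tail. Qed.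

Definition oscL eta th : R := sval (cid (osc_limit_ex eta th)).

Lemma oscLP eta th a : 0 < a -> `|osc eta th a - oscL eta th| <= osc_const eta / Num.sqrt a.
Proof. by rewrite /oscL; case: cid => L /= H; exact: H. Qed.

(** Squared modulus of the integral of [y^(-1/2 + i eta) exp (i y)] over the half-line: the phase
    [- (pi / 2)] turns the cosine into a sine and yields the imaginary part. *)
Definition amp2 eta : R := oscL eta 0 ^+ 2 + oscL eta (- (pi / 2)) ^+ 2.

Lemma amp2_ge0 eta : 0 <= amp2 eta.
Proof. by rewrite addr_ge0 ?sqr_ge0. Qed.

Lemma polar (u v : R) : exists om, u = Num.sqrt (u ^+ 2 + v ^+ 2) * cos om /\
  v = Num.sqrt (u ^+ 2 + v ^+ 2) * sin om.
Proof.
set s := u ^+ 2 + v ^+ 2.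
have s0 : 0 <= s by rewrite addr_ge0 ?sqr_ge0.
have [sz|sn0] := eqVneq s 0.
  have /andP[/eqP u0 /eqP v0] : (u ^+ 2 == 0) && (v ^+ 2 == 0).
    by rewrite -paddr_eq0 ?sqr_ge0// -/s sz.
  exists 0; move/eqP: u0; move/eqP: v0; rewrite !sqrf_eq0 => /eqP -> /eqP ->.
  by rewrite sz sqrtr0 !mul0r.
have q0 : 0 < Num.sqrt s by rewrite sqrtr_gt0 lt_neqAle eq_sym sn0.
have qs : Num.sqrt s ^+ 2 = s by rewrite sqr_sqrtr.
have uq : -1 <= u / Num.sqrt s <= 1.
  rewrite -ler_norml normrM normfV (gtr0_norm q0) ler_pdivrMr// mul1r.
  rewrite -(@ler_pXn2r _ 2)// ?nnegrE ?(ltW q0)// qs real_normK ?num_real//.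
  by rewrite lerDl sqr_ge0.
have sq : Num.sqrt (1 - (u / Num.sqrt s) ^+ 2) = `|v| / Num.sqrt s.
  have -> : 1 - (u / Num.sqrt s) ^+ 2 = (v / Num.sqrt s) ^+ 2.
    by rewrite !exprMn !exprVn qs /s; field; rewrite -/s.
  by rewrite sqrtr_sqr normrM normfV (gtr0_norm q0).
have [v0|v0] := leP 0 v.
- exists (acos (u / Num.sqrt s)); rewrite acosK ?in_itv// sin_acos// sq ger0_norm//.
  by split; field; rewrite gt_eqF.
- exists (- acos (u / Num.sqrt s)); rewrite cosN sinN acosK ?in_itv// sin_acos// sq ltr0_norm//.
  by split; field; rewrite gt_eqF.
Qed.

(** The error has to be uniform in [th], because [th] will vary with the frequency through
    [eta * ln p]. *)
Lemma osc_phase_limit eta : exists om, forall th x, 0 < x ->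
  `|osc eta th x - Num.sqrt (amp2 eta) * cos (om + th)| <= 2 * osc_const eta / Num.sqrt x.
Proof.
have [om [uE vE]] := polar (oscL eta 0) (oscL eta (- (pi / 2))).
exists om => th x x0; rewrite osc_phase cosD mulrBr !mulrA -uE -vE.
set u := oscL eta 0; set v := oscL eta _.
rewrite (_ : _ - _ = cos th * (osc eta 0 x - u) - sin th * (osc eta (- (pi / 2)) x - v)); last by ring.
rewrite (le_trans (ler_normB _ _))// !normrM -mulrA mulr_natl mulr2n.
apply: lerD; apply: (@le_trans _ _ (1 * (osc_const eta / Num.sqrt x))); rewrite ?mul1r//.
- by rewrite -[leRHS]mul1r ler_pM ?oscLP// ler_norml cos_geN1 cos_le1.
- by rewrite -[leRHS]mul1r ler_pM ?oscLP// ler_norml sin_geN1 sin_le1.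
Qed.

(** The bound of [osc_small] ignores both ends of the interval, so the lower one can go to 0 and the
    upper one to infinity. *)
Lemma oscL_le eta th : 0 < eta -> `|oscL eta th| <= 3 / Num.sqrt eta.
Proof.
move=> eta0; apply/ler_addgt0Pr => e e0; have C0 := osc_const_gt0 eta.
pose b := (e / 4) ^+ 2; have b0 : 0 < b by rewrite exprn_gt0// divr_gt0.
have b2 : `|osc eta th b| <= e / 2.
  rewrite (le_trans (osc_le _ _ (ltW b0)))// sqrt_sqr ?divr_gt0//; lra.
pose a := Num.max b ((2 * osc_const eta / e) ^+ 2).
have ba : b <= a by rewrite le_max lexx.
have a0 : 0 < a by exact: lt_le_trans ba.
have q0 : 0 < 2 * osc_const eta / e by rewrite divr_gt0// mulr_gt0.
have a2 : `|osc eta th a - oscL eta th| <= e / 2.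
  rewrite (le_trans (oscLP _ _ a0))// ler_pdivrMr ?sqrtr_gt0//.
  rewrite -ler_pdivrMl ?divr_gt0// (_ : _ * _ = 2 * osc_const eta / e); last by field; rewrite gt_eqF.
  by rewrite -[leLHS]sqrt_sqr// ler_wsqrtr// le_max lexx orbT.
have := @osc_small _ eta th b a eta0; rewrite b0 ba => /(_ isT) H.
have -> : oscL eta th = (osc eta th a - osc eta th b) - (osc eta th a - oscL eta th) + osc eta th b by ring.
rewrite (le_trans (ler_normD _ _))// (le_trans (lerD (ler_normB _ _) (lexx _)))//.
move: H a2 b2; lra.
Qed.

Lemma cos_lipschitz x y : `|cos x - cos y| <= `|x - y|.
Proof.
wlog yx : x y / y <= x.
  move=> H; have [/H//|/ltW/H] := leP y x.
  by rewrite distrC [X in _ <= X -> _]distrC.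
rewrite (ger0_norm (_ : 0 <= x - y)) ?subr_ge0//.
apply: (@der_norm_increment _ y x cos id (fun z => - sin z) (fun=> 1)) => // z _.
- exact: is_derive_cos.
- exact: der_id.
- by rewrite normrN ler_norml sin_geN1 sin_le1.
Qed.

Lemma ln_norm_le x : 0 < x -> `|ln x| <= x + x^-1.
Proof.
move=> x0; have xi : 0 < x^-1 by rewrite invr_gt0.
have := le_ln1Dx (x := x - 1); have := le_ln1Dx (x := x^-1 - 1).
rewrite ![1 + (_ - _)]addrC !subrK lnV ?posrE// => H1 H2.
have {}H1 : - ln x <= x^-1 - 1 by apply: H1; lra.
have {}H2 : ln x <= x - 1 by apply: H2; lra.
rewrite ler_norml; apply/andP; split; lra.
Qed.

(** The parts below [x0] and beyond [X] are small uniformly for [|eta - eta0| <= 1], where [C1]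
    bounds [osc_const eta]; in between the integrand is Lipschitz in [eta] with constant [La]. *)
Lemma oscL_continuous th : continuous (oscL ^~ th).
Proof.
move=> eta0; apply/cvgrPdist_le => e e0.
pose C1 := 5 + 2 * `|eta0|.
have C10 : 0 < C1 by rewrite ltr_wpDr// mulr_ge0.
(* Budget: [e / 10] for each of two heads, [e / 5] for each of two tails and for the middle part, in
   all below [e]. *)
pose x0 := (e / 20) ^+ 2; have x00 : 0 < x0 by rewrite exprn_gt0// divr_gt0.
pose X := Num.max x0 ((5 * C1 / e) ^+ 2).
have x0X : x0 <= X by rewrite le_max lexx.
have X0 : 0 < X by exact: lt_le_trans x0X.
have q0 : 0 < 5 * C1 / e by rewrite divr_gt0// mulr_gt0.
have XC : C1 / Num.sqrt X <= e / 5.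
  rewrite ler_pdivrMr ?sqrtr_gt0//.
  rewrite -ler_pdivrMl ?divr_gt0// (_ : _ * _ = 5 * C1 / e); last by field; rewrite gt_eqF.
  by rewrite -[leLHS]sqrt_sqr// ler_wsqrtr// le_max lexx orbT.
pose La := (X + x0^-1) / Num.sqrt x0.
have La0 : 0 < La by rewrite divr_gt0 ?sqrtr_gt0// addr_gt0// invr_gt0.
near=> eta.
have eta1 : `|eta - eta0| <= 1.
  by rewrite distrC; near: eta; apply: cvgr_dist_le => //; exact: cvg_id.
have eta2 : `|eta - eta0| <= e / 5 / (La * X).
  rewrite distrC; near: eta; apply: cvgr_dist_le; first exact: cvg_id.
  by rewrite !divr_gt0// mulr_gt0.
have Ceta : osc_const eta <= C1.
  have := ler_normD (eta - eta0) eta0; rewrite subrK /osc_const /C1; lra.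
have Ceta0 : osc_const eta0 <= C1 by rewrite /osc_const /C1; lra.
have close et : osc_const et <= C1 -> `|osc et th X - oscL et th| <= e / 5.
  move=> H; rewrite (le_trans (oscLP _ _ X0))// (le_trans _ XC)//.
  by rewrite ler_wpM2r// invr_ge0 sqrtr_ge0.
have small et : `|osc et th x0| <= e / 10.
  rewrite (le_trans (osc_le _ _ (ltW x00)))// sqrt_sqr ?divr_gt0//; lra.
have mid : `|(osc eta th X - osc eta0 th X) - (osc eta th x0 - osc eta0 th x0)| <= e / 5.
  pose f x := (cos (x + eta * ln x + th) - cos (x + eta0 * ln x + th)) / Num.sqrt x.
  have H1 x : x0 <= x <= X -> has_der (fun x => osc eta th x - osc eta0 th x) x (f x).
    move=> /andP[x0x _]; have xx : 0 < x by exact: lt_le_trans x0x.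
    rewrite /f mulrBl; apply: derD; first exact: has_der_osc.
    by apply: derN; exact: has_der_osc.
  have H2 x : x0 <= x <= X -> has_der (fun x => `|eta - eta0| * La * x) x (`|eta - eta0| * La).
    by move=> _; apply: der_eq; [derive_auto|rewrite /=; ring].
  have H3 x : x0 <= x <= X -> `|f x| <= `|eta - eta0| * La.
    move=> /andP[x0x xX]; have xx : 0 < x by exact: lt_le_trans x0x.
    rewrite /f normrM normfV [`|Num.sqrt _|]ger0_norm ?sqrtr_ge0//.
    rewrite /La mulrA ler_pM ?invr_ge0 ?sqrtr_ge0//; last first.
      by rewrite lef_pV2 ?posrE ?sqrtr_gt0// ler_wsqrtr.
    rewrite (le_trans (cos_lipschitz _ _))//.
    rewrite (_ : _ - _ = (eta - eta0) * ln x); last by ring.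
    rewrite normrM ler_wpM2l// (le_trans (ln_norm_le xx))// lerD//.
    by rewrite lef_pV2.
  apply: (le_trans (der_norm_increment x0X H1 H2 H3)).
  apply: (@le_trans _ _ (`|eta - eta0| * (La * X))).
    have := mulr_ge0 (mulr_ge0 (normr_ge0 (eta - eta0)) (ltW La0)) (ltW x00).
    by rewrite /= [X in _ -> _ <= X]mulrA; lra.
  by rewrite -ler_pdivlMr// mulr_gt0.
rewrite distrC.
have -> : oscL eta th - oscL eta0 th =
   ((osc eta th X - osc eta0 th X) - (osc eta th x0 - osc eta0 th x0)) +
   ((osc eta th x0 - osc eta0 th x0) + ((osc eta0 th X - oscL eta0 th) - (osc eta th X - oscL eta th))).
  move: (osc eta th X) (osc eta0 th X) (osc eta th x0) (osc eta0 th x0).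
  by move: (oscL eta th) (oscL eta0 th) => *; ring.
have := close _ Ceta; have := close _ Ceta0; have := small eta; have := small eta0.
move=> s1 s2 c1 c2.
rewrite (le_trans (ler_normD _ _))// (le_trans (lerD mid (ler_normD _ _)))//.
have := ler_normB (osc eta th x0) (osc eta0 th x0).
have := ler_normB (osc eta0 th X - oscL eta0 th) (osc eta th X - oscL eta th).
move: s1 s2 c1 c2; lra.
Unshelve. all: by end_near.
Qed.

Lemma amp2_continuous : continuous amp2.
Proof.
move=> eta; rewrite /amp2; apply: cvgD.
- by apply: (@cvg_comp _ _ _ (oscL ^~ 0) (fun x => x ^+ 2));
    [exact: oscL_continuous|exact: exprn_continuous].
- by apply: (@cvg_comp _ _ _ (oscL ^~ (- (pi / 2))) (fun x => x ^+ 2));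
    [exact: oscL_continuous|exact: exprn_continuous].
Qed.

Lemma amp2_le eta : 0 < eta -> amp2 eta <= 18 / eta.
Proof.
move=> eta0; have H th : oscL eta th ^+ 2 <= 9 / eta.
  rewrite -real_normK ?num_real// (le_trans (_ : _ <= (3 / Num.sqrt eta) ^+ 2))//.
    by rewrite ler_pXn2r ?nnegrE// ?oscL_le// divr_ge0 ?sqrtr_ge0.
  by rewrite exprMn exprVn sqr_sqrtr ?(ltW eta0)// -natrX.
by rewrite (le_trans (lerD (H _) (H _)))// -mulrDl -natrD.
Qed.

End OscillatoryLimit.

(** * Transforms of packets cut off to a window [[a, b]] *)

Section WaveTransform.
Context {R : realType}.
Local Notation mu := (@lebesgue_measure R).
Implicit Types (eta th x p : R).

Lemma int_indic (a b c d : R) (h : R -> R) : a <= c -> d <= b ->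
  \int[mu]_(x in `[a, b]) (h x * \1_(`[c, d] : set R) x) = \int[mu]_(x in `[c, d]) h x.
Proof.
move=> ac db.
have -> : `[c, d]%classic = `[a, b]%classic `&` `[c, d]%classic :> set R.
  apply/seteqP; split => x /=; rewrite !in_itv/=; last by case.
  by move=> /andP[cx xd]; rewrite cx xd (le_trans ac)// (le_trans xd).
rewrite Rintegral_mkcondr; apply: int_eq => x xab.
rewrite patchE indicE; have -> : (x \in `[a, b]%classic `&` `[c, d]%classic) = (x \in (`[c, d]%classic : set R)).
  by rewrite in_setI (_ : x \in (`[a, b]%classic : set R)) ?andTb// inE/= in_itv.
by case: ifP; rewrite ?mulr1 ?mulr0.
Qed.

Variables a b : R.
Hypothesis a0 : 0 < a.
Hypothesis ab : a < b.

Let b0 : 0 < b. Proof. exact: lt_trans ab. Qed.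
Let aleb : a <= b. Proof. exact: ltW. Qed.

Definition isq r : R := (Num.sqrt r)^-1 * \1_(`[a, b] : set R) r.

Let smooth_isqrt (c d : R) : 0 < c -> smooth_on c d (fun r => (Num.sqrt r)^-1).
Proof.
move=> c0 x /andP[cx _]; have x0 : 0 < x by exact: lt_le_trans cx.
have sx : Num.sqrt x != 0 by rewrite gt_eqF// sqrtr_gt0.
by eexists; derive_auto.
Qed.

Lemma bmf_isq : bmf isq.
Proof. by apply: bmf_smooth => //; exact: smooth_isqrt. Qed.

Definition waveT eta th p : R :=
  \int[mu]_(r in `[a, b]) (cos (p * r + eta * ln r + th) / Num.sqrt r).

Let isqE r : a <= r <= b -> isq r = (Num.sqrt r)^-1.
Proof. by move=> rab; rewrite /isq indicE mem_set ?mulr1//= in_itv. Qed.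

Let waveTE eta th p : waveT eta th p =
  \int[mu]_(r in `[a, b]) (cos (p * r + eta * ln r + th) * isq r).
Proof. by apply: int_eq => r rab; rewrite isqE. Qed.

Let bphase eta th p : bmf (fun r => cos (p * r + eta * ln r + th)).
Proof.
apply: bmf_cos; apply: measurable_funD => //; apply: measurable_funD.
  exact: measurable_funM.
by apply: measurable_funM => //; exact: measurable_ln.
Qed.

Lemma bmf_waveT eta th : bmf (waveT eta th).
Proof.
have -> : waveT eta th = fun p => \int[mu]_(r in `[a, b])
    ((fun z : R * R => cos (z.1 * z.2 + eta * ln z.2 + th) * isq z.2) (p, r)).
  by apply/funext => p; rewrite waveTE.
apply: (@bmf_param _ a b (fun z => cos (z.1 * z.2 + eta * ln z.2 + th) * isq z.2)) => //.
apply: bmf2M; last exact/bmf2_snd/bmf_isq.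
split; last by exists 1 => z; rewrite ler_norml cos_geN1 cos_le1.
apply: measurableT_comp; first by apply: continuous_measurable_fun; exact: continuous_cos.
apply: measurable_funD => //; apply: measurable_funD; first exact: measurable_funM.
apply: measurable_funM => //; apply: measurableT_comp => //; exact: measurable_ln.
Qed.

Let C eta : R := osc_const eta.

Lemma waveT_le eta th p : `|waveT eta th p| <= 2 * Num.sqrt b.
Proof.
rewrite waveTE; apply: (@le_trans _ _ (\int[mu]_(r in `[a, b]) isq r)).
  apply: int_norm_le; [by apply: bmfM => //; exact: bmf_isq|exact: bmf_isq|].
  move=> r rab; rewrite normrM isqE// [X in _ * X]ger0_norm ?invr_ge0 ?sqrtr_ge0//.
  by rewrite ler_piMl ?invr_ge0 ?sqrtr_ge0// ler_norml cos_geN1 cos_le1.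
rewrite (_ : \int[_]_(_ in _) _ = 2 * Num.sqrt b - 2 * Num.sqrt a).
  by rewrite gerBl mulr_ge0// sqrtr_ge0.
transitivity (\int[mu]_(r in `[a, b]) (Num.sqrt r)^-1).
  by apply: int_eq => r /isqE.
apply: (@int_FTC2 _ _ _ _ (fun x => 2 * Num.sqrt x)) => //; last exact: smooth_isqrt.
move=> x /andP[ax _]; have x0 : 0 < x by exact: lt_le_trans ax.
apply: der_eq; first by derive_auto.
by rewrite /=; field; rewrite gt_eqF// sqrtr_gt0.
Qed.

Let waveT_osc eta th p : 0 < p -> waveT eta th p =
  (osc eta (th - eta * ln p) (p * b) - osc eta (th - eta * ln p) (p * a)) / Num.sqrt p.
Proof. by move=> p0; apply: int_osc => //; rewrite a0. Qed.

Let sqrt_p p : 0 < p -> Num.sqrt p * Num.sqrt p = p.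
Proof. by move=> p0; rewrite -expr2 sqr_sqrtr ?ltW. Qed.

Lemma waveT_decay eta th p : 0 < p -> `|waveT eta th p| <= C eta / (p * Num.sqrt a).
Proof.
move=> p0; have sp : 0 < Num.sqrt p by rewrite sqrtr_gt0.
rewrite waveT_osc// normrM normfV (gtr0_norm sp) ler_pdivrMr//.
have : 0 < p * a <= p * b by rewrite mulr_gt0//= ler_pM2l.
move=> /(osc_tail eta (th - eta * ln p)) /le_trans; apply.
rewrite sqrtrM ?(ltW p0)// -/(osc_const eta) -/(C eta) -{2}(sqrt_p p0).
rewrite le_eqVlt; apply/orP; left; apply/eqP.
by field; rewrite !gt_eqF// sqrtr_gt0.
Qed.

Definition amp eta : R := Num.sqrt (amp2 eta).
Definition phase eta : R := sval (cid (osc_phase_limit eta)).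

Definition waveM eta th p : R := amp eta * cos (phase eta + th - eta * ln p) / Num.sqrt p.

(** The transform is a difference of values of [osc] at [p b] and [p a]. The first is replaced by
    its limit; the second is bounded trivially by [2 sqrt (p a)]. *)
Lemma waveT_main eta th p : 0 < p ->
  `|waveT eta th p - waveM eta th p| <= 2 * C eta / (p * Num.sqrt b) + 2 * Num.sqrt a.
Proof.
move=> p0; have sp : 0 < Num.sqrt p by rewrite sqrtr_gt0.
rewrite waveT_osc// /waveM -mulrBl normrM normfV (gtr0_norm sp) ler_pdivrMr//.
have H x := svalP (cid (osc_phase_limit eta)) (th - eta * ln p) x.
have pa0 : 0 < p * a by exact: mulr_gt0.
have pb0 : 0 < p * b by exact: mulr_gt0.
have := H _ pb0; rewrite addrA -/(phase eta) -/(amp eta) => H1.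
have H2 := osc_le eta (th - eta * ln p) (ltW pa0).
rewrite addrAC (le_trans (ler_normB _ _))// (le_trans (lerD H1 H2))//.
rewrite !sqrtrM ?(ltW p0)// -/(C eta) -{3}(sqrt_p p0).
rewrite le_eqVlt; apply/orP; left; apply/eqP.
by field; rewrite !gt_eqF// sqrtr_gt0.
Qed.

Let smooth_isqr (c d k : R) : 0 < c -> smooth_on c d (fun p => k / p ^+ 2).
Proof.
move=> c0 x /andP[cx _]; have x0 : 0 < x by exact: lt_le_trans cx.
have sx : x ^+ 2 != 0 by rewrite gt_eqF// exprn_gt0.
by eexists; derive_auto.
Qed.

Let int_isqr (c d k : R) : 0 < c <= d ->
  \int[mu]_(p in `[c, d]) (k / p ^+ 2) = k / c - k / d.
Proof.
move=> /andP[c0 cd]; transitivity (- k / d - (- k / c)); last by rewrite !mulNr opprK addrC.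
apply: (@int_FTC2 _ _ _ _ (fun x => - k / x)) => //; last exact: smooth_isqr.
move=> x /andP[cx _]; have x0 : 0 < x by exact: lt_le_trans cx.
have sx : x != 0 by rewrite gt_eqF.
by apply: der_eq; [derive_auto|rewrite /=; field; rewrite gt_eqF].
Qed.

Let int_isqr_cst (c d k m : R) : 0 < c <= d ->
  \int[mu]_(p in `[c, d]) (k / p ^+ 2 + m) = k / c - k / d + m * (d - c).
Proof.
move=> /andP[c0 cd]; transitivity ((- k / d + m * d) - (- k / c + m * c)); last first.
  by rewrite mulrBr !mulNr; ring.
apply: (@int_FTC2 _ c d (fun p => k / p ^+ 2 + m) (fun x => - k / x + m * x)) => // x xcd.
  have x0 : x != 0 by rewrite gt_eqF//; case/andP: xcd => + _; exact: lt_le_trans.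
  by apply: der_eq; [derive_auto|rewrite /=; field].
have [l dl] := smooth_isqr k c0 xcd.
by exists (l + 0); apply: derD => //; exact: der_cst.
Qed.

Let smooth_waveM eta th c d : 0 < c -> smooth_on c d (waveM eta th).
Proof.
move=> c0 x /andP[cx _]; have x0 : 0 < x by exact: lt_le_trans cx.
have sx : Num.sqrt x != 0 by rewrite gt_eqF// sqrtr_gt0.
by eexists; rewrite /waveM; derive_auto.
Qed.

Let ai0 : 0 < a^-1. Proof. by rewrite invr_gt0. Qed.
Let bi0 : 0 < b^-1. Proof. by rewrite invr_gt0. Qed.
Let bai : b^-1 <= a^-1. Proof. by rewrite lef_pV2. Qed.

Lemma bmf_waveM eta th : bmf (fun p => waveM eta th p * \1_(`[b^-1, a^-1] : set R) p).
Proof. by apply: bmf_smooth => //; exact: smooth_waveM. Qed.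

Lemma waveT_L2 eta th B : a^-1 <= B ->
  \int[mu]_(p in `[0, B]) ((waveT eta th p - waveM eta th p * \1_(`[b^-1, a^-1] : set R) p) *
    (waveT eta th p - waveM eta th p * \1_(`[b^-1, a^-1] : set R) p))
  <= 12 + 9 * osc_const eta ^+ 2.
Proof.
move=> aB; have B0 : 0 < B by exact: lt_le_trans aB.
pose c := C eta; have c0 : 0 < c by exact: osc_const_gt0.
pose g1 p := 4 * b * \1_(`[0, b^-1] : set R) p.
pose g2 p := (8 * c ^+ 2 / b / p ^+ 2 + 8 * a) * \1_(`[b^-1, a^-1] : set R) p.
pose g3 p := c ^+ 2 / a / p ^+ 2 * \1_(`[a^-1, B] : set R) p.
have bg1 : bmf g1.
  by apply: (@bmf_smooth _ _ _ (fun=> 4 * b)); [exact: ltW|move=> x _; exists 0; exact: der_cst].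
have bg2 : bmf g2.
  apply: bmf_smooth => // x xab; have [l dl] := smooth_isqr (8 * c ^+ 2 / b) bi0 xab.
  by exists (l + 0); apply: derD => //; exact: der_cst.
have bg3 : bmf g3 by apply: bmf_smooth => //; exact: smooth_isqr.
have bT := bmf_waveT eta th; have bM := bmf_waveM eta th.
have bd := bmfB bT bM.
apply: (@le_trans _ _ (\int[mu]_(p in `[0, B]) (g1 p + (g2 p + g3 p)))).
  apply: int_le; [exact: bmfM|by apply: bmfD => //; exact: bmfD|] => p /andP[p0 pB].
  have sqr_b (x y : R) : `|x| <= y -> x * x <= y ^+ 2.
    move=> xy; rewrite -expr2 -real_normK ?num_real// ler_pXn2r ?nnegrE//.
    exact: le_trans xy.
  have g1_ge0 : 0 <= g1 p by rewrite /g1 indicE mulr_ge0// mulr_ge0// ltW.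
  have g2_ge0 : 0 <= g2 p.
    rewrite /g2 indicE mulr_ge0// addr_ge0//; last by rewrite mulr_ge0// ltW.
    rewrite divr_ge0 ?sqr_ge0// divr_ge0 ?(ltW b0)// mulr_ge0// sqr_ge0//.
  have g3_ge0 : 0 <= g3 p.
    by rewrite /g3 indicE mulr_ge0// divr_ge0 ?sqr_ge0// divr_ge0 ?sqr_ge0// ltW.
  have [pb|bp] := ltP p b^-1.
    rewrite indicE memNset/= ?in_itv/= ?(leNgt b^-1) ?pb// mulr0 subr0.
    apply: (le_trans (sqr_b _ _ (waveT_le _ _ _))).
    rewrite exprMn sqr_sqrtr ?(ltW b0)// -[leLHS]addr0 lerD ?addr_ge0//.
    by rewrite /g1 indicE mem_set/= ?in_itv/= ?p0 ?(ltW pb)// mulr1 -natrX.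
  have p0' : 0 < p by exact: lt_le_trans bp.
  have [pa|ap] := leP p a^-1.
    rewrite indicE mem_set/= ?in_itv/= ?bp ?pa// mulr1.
    apply: (le_trans (sqr_b _ _ (waveT_main _ _ p0'))).
    rewrite -[leLHS]add0r lerD// -[leLHS]addr0 lerD//.
    rewrite /g2 indicE mem_set/= ?in_itv/= ?bp ?pa// mulr1 -/c.
    set u := 2 * c / _; set v := 2 * _.
    have -> : 8 * c ^+ 2 / b / p ^+ 2 = 2 * u ^+ 2.
      rewrite /u -{1}(sqr_sqrtr (ltW b0)); field.
      by rewrite !gt_eqF// sqrtr_gt0.
    have -> : 8 * a = 2 * v ^+ 2 by rewrite /v exprMn sqr_sqrtr ?(ltW a0)//; ring.
    by have := sqr_ge0 (u - v); nra.
  rewrite indicE memNset/= ?in_itv/= ?(leNgt p) ?ap ?andbF// mulr0 subr0.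
  apply: (le_trans (sqr_b _ _ (waveT_decay _ _ p0'))).
  rewrite -[leLHS]add0r lerD// -[leLHS]add0r lerD//.
  rewrite /g3 indicE mem_set/= ?in_itv/= ?pB ?(ltW ap)// mulr1 -/c.
  rewrite exprMn exprVn exprMn sqr_sqrtr ?(ltW a0)//.
  rewrite le_eqVlt; apply/orP; left; apply/eqP.
  by field; rewrite !gt_eqF.
rewrite intD//; last exact: bmfD.
have bB : b^-1 <= B by exact: le_trans aB.
rewrite intD// /g1 /g2 /g3 !int_indic// ?(ltW ai0) ?(ltW bi0)//.
rewrite int_cst ?(ltW bi0)// subr0 int_isqr ?ai0//.
rewrite int_isqr_cst ?bi0//.
have H1 : 0 <= c ^+ 2 / a / B by rewrite !divr_ge0 ?sqr_ge0 ?(ltW a0) ?(ltW B0).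
have H2 : 0 <= 8 * a * b^-1 by rewrite !mulr_ge0 ?(ltW a0) ?(ltW bi0).
have H3 : c ^+ 2 / a / a^-1 = c ^+ 2 by field; rewrite gt_eqF.
have H4 : 8 * c ^+ 2 / b / b^-1 = 8 * c ^+ 2 by field; rewrite gt_eqF.
have H5 : 0 <= 8 * c ^+ 2 / b / a^-1.
  by rewrite divr_ge0 ?(ltW ai0)// divr_ge0 ?(ltW b0)// mulr_ge0// sqr_ge0.
have H6 : 8 * a * (a^-1 - b^-1) = 8 - 8 * a * b^-1 by field; rewrite !gt_eqF.
have H7 : 4 * b * b^-1 = 4 by rewrite -mulrA divff ?mulr1// gt_eqF.
rewrite -[osc_const eta]/c H3 H4 H6 H7; move: H1 H2 H5; lra.
Qed.

End WaveTransform.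

(** * The range of the amplitude *)

Section AmplitudeRange.
Context {R : realType}.
Local Notation mu := (@lebesgue_measure R).
Implicit Types (eta th x p : R).

Lemma int_inv (c d k : R) : 0 < c <= d ->
  \int[mu]_(p in `[c, d]) (k / p) = k * (ln d - ln c).
Proof.
move=> /andP[c0 cd]; rewrite mulrBr.
apply: (@int_FTC2 _ c d (fun p => k / p) (fun x => k * ln x)) => // x /andP[cx _];
  have x0 : 0 < x by exact: lt_le_trans cx.
  by apply: der_eq; [derive_auto|rewrite /=; field; rewrite gt_eqF].
have xn0 : x != 0 by rewrite gt_eqF.
by eexists; derive_auto.
Qed.

Lemma cosBpihalf x : cos (x - pi / 2) = sin x.
Proof. by rewrite cosB cos_pihalf sin_pihalf; ring. Qed.

Lemma amp_sqr eta : amp eta * amp eta = amp2 eta.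
Proof. by rewrite -expr2 sqr_sqrtr// amp2_ge0. Qed.

(** Over the two phases the squares of the main terms add up to [amp2 eta / p], whose integral is
    logarithmic. The error is split off by [t^2 <= (1 + ka) m^2 + (1 + 1 / ka) (t - m)^2], so [ka]
    perturbs only the leading coefficient. *)
Lemma waveT_energy_le eta (ka a b B : R) : 0 < a < b -> 0 < ka -> a^-1 <= B ->
  \int[mu]_(p in `[0, B]) (waveT a b eta 0 p * waveT a b eta 0 p
      + waveT a b eta (- (pi / 2)) p * waveT a b eta (- (pi / 2)) p) <=
  (1 + ka) * amp2 eta * (ln b - ln a) +
    2 * (1 + ka^-1) * (12 + 9 * osc_const eta ^+ 2).
Proof.
move=> /andP[a0 ab] ka0 aB; have b0 : 0 < b by exact: lt_trans ab.
have ai0 : 0 < a^-1 by rewrite invr_gt0.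
have bi0 : 0 < b^-1 by rewrite invr_gt0.
have bai : b^-1 <= a^-1 by rewrite lef_pV2// ltW.
have B0 : 0 < B by exact: lt_le_trans aB.
set K := 12 + _.
pose M th p := waveM eta th p * \1_(`[b^-1, a^-1] : set R) p.
pose T th := waveT a b eta th.
have bM th : bmf (M th) by exact: bmf_waveM.
have bT th : bmf (T th) by exact: bmf_waveT.
have bTM th : bmf (fun p => T th p - M th p) by exact: bmfB.
have one th : \int[mu]_(p in `[0, B]) (T th p * T th p) <=
    (1 + ka) * \int[mu]_(p in `[0, B]) (M th p * M th p) + (1 + ka^-1) * K.
  apply: (@le_trans _ _ ((1 + ka) * \int[mu]_(p in `[0, B]) (M th p * M th p) +
    (1 + ka^-1) * \int[mu]_(p in `[0, B]) ((T th p - M th p) * (T th p - M th p)))).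
    have b1 := bmfM (bM th) (bM th); have b2 := bmfM (bTM th) (bTM th).
    have b3 := bmfM (bT th) (bT th).
    rewrite -!intZ// -intD; [|exact: bmfZ..].
    apply: int_le => //; first by apply: bmfD; exact: bmfZ.
    move=> p _; set m := M th p; set t := T th p; rewrite -subr_ge0.
    rewrite (_ : _ - _ = (ka * m - (t - m)) ^+ 2 / ka); last by field; rewrite gt_eqF.
    by rewrite divr_ge0 ?sqr_ge0// ltW.
  rewrite lerD2l ler_wpM2l//; last exact: waveT_L2.
  by rewrite addr_ge0// invr_ge0 ltW.
have bMM th := bmfM (bM th) (bM th); have bTT th := bmfM (bT th) (bT th).
rewrite intD; [|exact: bTT..].
rewrite (le_trans (lerD (one _) (one _)))//.
have H : amp2 eta * (ln b - ln a) = \int[mu]_(p in `[0, B]) (M 0 p * M 0 p) +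
    \int[mu]_(p in `[0, B]) (M (- (pi / 2)) p * M (- (pi / 2)) p).
  rewrite -intD; [|exact: bMM..].
  rewrite (_ : \int[mu]_(_ in _) _ =
    \int[mu]_(p in `[0, B]) (amp2 eta / p * \1_(`[b^-1, a^-1] : set R) p)).
    rewrite int_indic ?(ltW bi0)// int_inv ?bi0// !lnV ?posrE//; ring.
  apply: int_eq => p _; rewrite /M indicE; case: (boolP (p \in _)) => [|_]; last by rewrite !mulr0 addr0.
  rewrite inE/= in_itv/= => /andP[bp _]; have p0 : 0 < p by exact: lt_le_trans bp.
  rewrite !mulr1 /waveM addr0 addrAC cosBpihalf -amp_sqr [X in _ = _ / X](_ : p = Num.sqrt p ^+ 2); last by rewrite sqr_sqrtr ?(ltW p0).
  set u := phase eta - _; set q := Num.sqrt p.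
  have q0 : q != 0 by rewrite gt_eqF// sqrtr_gt0.
  transitivity (amp eta * amp eta * (cos u ^+ 2 + sin u ^+ 2) / q ^+ 2).
    by field.
  by rewrite cos2Dsin2 mulr1.
rewrite -[(1 + ka) * amp2 eta * _]mulrA H; lra.
Qed.

Section SharpWindow.
Variables (eta a b : R).
Hypothesis a0 : 0 < a.
Hypothesis ab : a < b.

(** A packet without carrier: its cosine contains both waves [eta] and [- eta], so that the
    amplitudes of both enter the energy. *)
Let h th r := cos (eta * ln r + th) * isq a b r.

Let bh th : bmf (h th).
Proof.
apply: bmfM; last exact: bmf_isq.
by apply: bmf_cos; apply: measurable_funD => //; apply: measurable_funM => //; exact: measurable_ln.
Qed.

Let hE th r : a <= r <= b -> h th r = cos (eta * ln r + th) / Num.sqrt r.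
Proof. by move=> rab; rewrite /h /isq indicE mem_set ?mulr1//= in_itv. Qed.

Let biwave et th p : bmf (fun r => cos (p * r + et * ln r + th) * isq a b r).
Proof.
apply: bmfM; last exact: bmf_isq.
apply: bmf_cos; apply: measurable_funD => //; apply: measurable_funD.
  exact: measurable_funM.
by apply: measurable_funM => //; exact: measurable_ln.
Qed.

Let waveTE et th p : waveT a b et th p =
  \int[mu]_(r in `[a, b]) (cos (p * r + et * ln r + th) * isq a b r).
Proof.
apply: int_eq => r rab.
by rewrite /isq indicE mem_set ?mulr1//= in_itv.
Qed.

Lemma cosT_window th p :
  cosT a b (h th) p = (waveT a b eta th p + waveT a b (- eta) (- th) p) / 2.
Proof.
rewrite !waveTE -intD; [|exact: biwave..].
rewrite mulrC -intZ; last by apply: bmfD; exact: biwave.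
apply: int_eq => r _; rewrite /h.
have -> : p * r + eta * ln r + th = p * r + (eta * ln r + th) by ring.
have -> : p * r + - eta * ln r - th = p * r - (eta * ln r + th) by ring.
by rewrite (cosD (p * r)) (cosB (p * r)); field.
Qed.

Lemma sinT_window th p : sinT a b (h th) p =
  (waveT a b eta (th - pi / 2) p + waveT a b (- eta) (- th - pi / 2) p) / 2.
Proof.
rewrite !waveTE -intD; [|exact: biwave..].
rewrite mulrC -intZ; last by apply: bmfD; exact: biwave.
apply: int_eq => r _; rewrite /h.
have -> : p * r + eta * ln r + (th - pi / 2) = p * r + (eta * ln r + th) - pi / 2 by ring.
have -> : p * r + - eta * ln r + (- th - pi / 2) = p * r - (eta * ln r + th) - pi / 2 by ring.
by rewrite !cosBpihalf (sinD (p * r)) (sinB (p * r)); field.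
Qed.

Lemma waveT_pi et th p : waveT a b et (th - pi) p = - waveT a b et th p.
Proof.
rewrite -[RHS]mulN1r !waveTE -intZ; last exact: biwave.
by apply: int_eq => r _; rewrite addrA cosB cospi sinpi; ring.
Qed.

(** Adding the two phases cancels the cross terms between the waves [eta] and [- eta]. *)
Let energyE p :
  (cosT a b (h 0) p ^+ 2 + sinT a b (h 0) p ^+ 2) +
  (cosT a b (h (- (pi / 2))) p ^+ 2 + sinT a b (h (- (pi / 2))) p ^+ 2) =
  2^-1 * ((waveT a b eta 0 p * waveT a b eta 0 p
      + waveT a b eta (- (pi / 2)) p * waveT a b eta (- (pi / 2)) p) +
   (waveT a b (- eta) 0 p * waveT a b (- eta) 0 p
      + waveT a b (- eta) (- (pi / 2)) p * waveT a b (- eta) (- (pi / 2)) p)).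
Proof.
rewrite !cosT_window !sinT_window oppr0 !sub0r opprK subrr.
have -> : - (pi / 2) - pi / 2 = 0 - pi :> R by field.
have piE : waveT a b (- eta) (pi / 2) p = - waveT a b (- eta) (- (pi / 2)) p.
  rewrite (_ : - (pi / 2) = pi / 2 - pi :> R); last by field.
  by rewrite waveT_pi opprK.
by rewrite waveT_pi piE; field.
Qed.

Let window_energy_le (ka B : R) : 0 < ka -> a^-1 <= B ->
  \int[mu]_(p in `[0, B]) ((cosT a b (h 0) p ^+ 2 + sinT a b (h 0) p ^+ 2) +
    (cosT a b (h (- (pi / 2))) p ^+ 2 + sinT a b (h (- (pi / 2))) p ^+ 2)) <=
  2^-1 * ((1 + ka) * (amp2 eta + amp2 (- eta)) * (ln b - ln a) +
    4 * (1 + ka^-1) * (12 + 9 * osc_const eta ^+ 2)).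
Proof.
move=> ka0 aB; have H1 := @waveT_energy_le eta ka a b B _ ka0 aB.
have H2 := @waveT_energy_le (- eta) ka a b B _ ka0 aB.
move: H1 H2; rewrite a0 ab => /(_ isT) H1 /(_ isT) H2.
have bTT et th : bmf (fun p => waveT a b et th p * waveT a b et th p).
  by apply: bmfM; exact: bmf_waveT.
have bE et : bmf (fun p => waveT a b et 0 p * waveT a b et 0 p
      + waveT a b et (- (pi / 2)) p * waveT a b et (- (pi / 2)) p) by exact: bmfD.
rewrite (_ : \int[_]_(_ in _) _ = 2^-1 *
   (\int[mu]_(p in `[0, B]) (waveT a b eta 0 p * waveT a b eta 0 p
      + waveT a b eta (- (pi / 2)) p * waveT a b eta (- (pi / 2)) p) +
    \int[mu]_(p in `[0, B]) (waveT a b (- eta) 0 p * waveT a b (- eta) 0 p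
      + waveT a b (- eta) (- (pi / 2)) p * waveT a b (- eta) (- (pi / 2)) p))).
  rewrite ler_wpM2l ?invr_ge0// (le_trans (lerD H1 H2))//.
  rewrite /osc_const normrN le_eqVlt; apply/orP; left; apply/eqP; ring.
rewrite -intD// -intZ; last exact: bmfD.
by apply: int_eq => p _; exact: energyE.
Qed.

Let h_lip th r x : a <= r <= b -> a <= x <= b ->
  `|h th r - h th x| <= (`|eta| + 1) / (a * Num.sqrt a) * `|r - x|.
Proof.
set l := _ / _ => rab xab; rewrite !hE//.
wlog xr : r x rab xab / x <= r.
  move=> H; have [/(H _ _ rab xab)//|/ltW rx] := leP x r.
  by rewrite distrC [X in _ <= _ * X]distrC; exact: H.
rewrite (ger0_norm (_ : 0 <= r - x)) ?subr_ge0// mulrBr.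
pose f z := (- eta * sin (eta * ln z + th) - cos (eta * ln z + th) / 2) / (z * Num.sqrt z).
apply: (@der_norm_increment _ x r (fun z => cos (eta * ln z + th) / Num.sqrt z)
  (fun z => l * z) f (fun=> l)) => // z /andP[xz zr];
  have z0 : 0 < z by apply: lt_le_trans xz; case/andP: xab => + _; exact: lt_le_trans.
- have sz : Num.sqrt z != 0 by rewrite gt_eqF// sqrtr_gt0.
  apply: der_eq; first by derive_auto.
  rewrite /f /=; have [s s0 ->] := sqrt_gt0_ex z0; rewrite sqrt_sqr//.
  by field; rewrite gt_eqF.
- by apply: der_eq; [derive_auto|rewrite /=; ring].
- have az : a <= z by apply: le_trans xz; case/andP: xab.
  have sa : 0 < Num.sqrt a by rewrite sqrtr_gt0.
  have sz : 0 < z * Num.sqrt z by rewrite mulr_gt0// sqrtr_gt0.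
  rewrite /f /l normrM normfV (gtr0_norm sz) ler_pM//; first by rewrite invr_ge0 ltW.
    rewrite (le_trans (ler_normB _ _))// !normrM normrN lerD//.
      by rewrite ler_piMr// ler_norml sin_geN1 sin_le1.
    rewrite normfV [`|2|]ger0_norm// ler_pdivrMr// mul1r.
    by rewrite (@le_trans _ _ 1)// ?ler1n// ler_norml cos_geN1 cos_le1.
  have asa : 0 < a * Num.sqrt a by exact: mulr_gt0.
  have aszz : a * Num.sqrt a <= z * Num.sqrt z.
    by apply: ler_pM; rewrite ?(ltW a0) ?(ltW sa) ?ler_wsqrtr.
  by rewrite lef_pV2.
Qed.

(** Plancherel from below meets the packet asymptotics from above. The two phases have total energy
    [ln d - ln c] on [[c, d]], and each loses 1 as its [delta], whence the 2. *)
Lemma window_amp_bound (ka c d : R) : 0 < ka -> a < c -> c <= d -> d < b ->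
  pi * (ln d - ln c) - 2 <=
  2^-1 * ((1 + ka) * (amp2 eta + amp2 (- eta)) * (ln b - ln a) +
    4 * (1 + ka^-1) * (12 + 9 * osc_const eta ^+ 2)).
Proof.
move=> ka0 ac cd db; have c0 : 0 < c by exact: lt_trans ac.
pose g th p := cosT a b (h th) p ^+ 2 + sinT a b (h th) p ^+ 2.
have bg th : bmf (g th).
  have bc := bmf_cosT ab (bh th); have bs := bmf_sinT ab (bh th).
  by apply: bmfD; rewrite -[X in bmf X]/(fun p => _ * _); exact: bmfM.
have g0 th p : 0 <= g th p by rewrite addr_ge0 ?sqr_ge0.
have P th : exists2 B, 0 <= B & forall B', B <= B' ->
    pi * \int[mu]_(r in `[c, d]) (h th r * h th r) - 1 <= \int[mu]_(p in `[0, B']) g th p.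
  have [B B0 H] := plancherel_lower ab (bh th) ac db cd ltr01 (@h_lip th).
  exists B => // B' BB'; apply: (le_trans H).
  by apply: (@int_subset _ 0 B' 0 B (g th)).
have [B1 B10 P1] := P 0; have [B2 B20 P2] := P (- (pi / 2)).
pose B := Num.max (Num.max B1 B2) a^-1.
have {}P1 := P1 B; have {}P2 := P2 B.
move: P1 P2; rewrite /B !le_max !lexx !orbT /= -/B => /(_ isT) P1 /(_ isT) P2.
have aB : a^-1 <= B by rewrite /B le_max lexx orbT.
apply: le_trans (window_energy_le ka0 aB).
rewrite [leRHS](_ : _ = \int[mu]_(p in `[0, B]) g 0 p +
    \int[mu]_(p in `[0, B]) g (- (pi / 2)) p); last by rewrite -intD.
apply: le_trans (lerD P1 P2).
have bhh th := bmfM (bh th) (bh th).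
suff -> : ln d - ln c = \int[mu]_(r in `[c, d]) (h 0 r * h 0 r) +
   \int[mu]_(r in `[c, d]) (h (- (pi / 2)) r * h (- (pi / 2)) r) by lra.
rewrite -[LHS]mul1r -int_inv ?c0// -intD//; apply: int_eq => r /andP[cr rd].
have r0 : 0 < r by exact: lt_le_trans cr.
rewrite !hE ?(le_trans (ltW ac) cr) ?(le_trans rd (ltW db))// addr0 cosBpihalf.
rewrite [X in 1 / X](_ : r = Num.sqrt r ^+ 2); last by rewrite sqr_sqrtr ?(ltW r0).
set u := eta * _; set q := Num.sqrt r.
have q0 : q != 0 by rewrite gt_eqF// sqrtr_gt0.
by rewrite -(cos2Dsin2 u); field.
Qed.

End SharpWindow.

(** Take the window [[a, 1]] with inner segment [[2 a, 1 / 2]] and let [a] tend to 0: both sides of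
    [window_amp_bound] grow like [- ln a], and their coefficients compare as
    [pi <= (1 + ka) S / 2]. *)
Lemma amp2_sum_ge eta : 2 * pi <= amp2 eta + amp2 (- eta).
Proof.
set S := _ + _; have S0 : 0 <= S by rewrite addr_ge0 ?amp2_ge0.
apply/ler_addgt0Pr => e e0.
pose ka := e / (S + 1).
have ka0 : 0 < ka by rewrite divr_gt0// ltr_wpDl.
have kaS : ka * S <= e.
  by rewrite /ka mulrAC ler_pdivrMr ?ltr_wpDl// ler_wpM2l ?(ltW e0)// lerDl.
suff : 2 * pi <= (1 + ka) * S by lra.
rewrite leNgt; apply/negP => lt.
pose K := 4 * (1 + ka^-1) * (12 + 9 * osc_const eta ^+ 2).
(* Twice the window bound says [(2 pi - (1 + ka) S) L <= Q] for [a = exp (- L)], which fails for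
   large [L]; [ln 4 + 1 <= L] guarantees [2 a <= 1 / 2]. *)
pose Q := 2 * pi * ln 4 + 4 + K.
have gap : 0 < 2 * pi - (1 + ka) * S by rewrite subr_gt0.
pose L := Num.max (ln 4 + 1) (Q / (2 * pi - (1 + ka) * S) + 1).
have L1 : ln 4 + 1 <= L by rewrite le_max lexx.
have L2 : Q / (2 * pi - (1 + ka) * S) < L.
  by rewrite lt_max; apply/orP; right; rewrite ltrDl.
pose a := expR (- L).
have a0 : 0 < a by exact: expR_gt0.
have lna : ln a = - L by rewrite expRK.
have a4 : 4 * a < 1.
  rewrite -(@ltr_ln _ (4 * a) 1) ?posrE ?mulr_gt0// lnM ?posrE// lna ln1; lra.
have [H1 H2 H3] : [/\ a < 2 * a, 2 * a <= 2^-1 & 2^-1 < 1 :> R] by split; lra.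
have a1 : a < 1 by lra.
have := window_amp_bound eta a0 a1 ka0 H1 H2 H3.
rewrite -/S -/K ln1 lna lnM ?posrE// lna lnV ?posrE//.
have ln4 : ln 4 = ln 2 + ln 2 :> R by rewrite -lnM ?posrE// -natrM.
move: L2; rewrite ltr_pdivrMr// {1}/Q ln4.
lra.
Qed.

(** Intermediate values on [[- X, X]]: decay puts [amp2 X] below both [v] and [2 pi - v], and
    [amp2_sum_ge] then puts [amp2 (- X)] above [v]. *)
Lemma amp_surjective s : 0 < s < 1 -> exists eta, amp eta = Num.sqrt (2 * pi) * s.
Proof.
move=> /andP[s0 s1]; have pi2 : 0 < 2 * pi :> R by rewrite mulr_gt0// pi_gt0.
pose v := 2 * pi * s ^+ 2.
have s21 : s ^+ 2 < 1 by rewrite expr_lt1// ltW.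
have v0 : 0 < v by rewrite mulr_gt0// exprn_gt0.
have vpi : 0 < 2 * pi - v by rewrite /v; nra.
pose X := Num.max (18 / v) (18 / (2 * pi - v)).
have X1 : 18 / v <= X by rewrite le_max lexx.
have X2 : 18 / (2 * pi - v) <= X by rewrite le_max lexx orbT.
have X0 : 0 < X by apply: lt_le_trans X1; rewrite divr_gt0.
have HX : amp2 X <= 18 / X by exact: amp2_le.
have vX : amp2 X <= v.
  by rewrite (le_trans HX)// ler_pdivrMr// -ler_pdivrMl// mulrC.
have vNX : v <= amp2 (- X).
  have := amp2_sum_ge X; have : amp2 X <= 2 * pi - v; last lra.
  by rewrite (le_trans HX)// ler_pdivrMr// -ler_pdivrMl// mulrC.
have NX : - X <= X by lra.
have [||eta _ etaE] := @IVT R amp2 (- X) X v NX.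
- by apply: continuous_in_subspaceT => x _; exact: amp2_continuous.
- by rewrite ge_min le_max vX vNX !orbT.
exists eta; rewrite /amp etaE /v sqrtrM ?(ltW pi2)// sqrtr_sqr gtr0_norm//.
Qed.

End AmplitudeRange.

(** * Wave packets at the corners of phase space *)

Section CornerWavePackets.
Context {R : realType}.
Local Notation mu := (@lebesgue_measure R).
Implicit Types (eta th w x p r a b L : R).

(** The cosine ([w = 0]) or sine ([w = pi / 2]) kernel with both variables measured from the
    endpoint [L]; [sqrt (2 / pi)] is twice [1 / sqrt (2 pi)], from folding [[- L, L]] onto its
    half. *)
Definition cker L w (z : R * R) : R := Num.sqrt (2 / pi) * cos ((L - z.1) * (L - z.2) - w).

Lemma bmf2_cker L w : bmf2 (cker L w).
Proof.
apply: bmf2M; first exact: bmf2_cst.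
apply: (@bmf2_continuous_comp _ cos (fun z => (L - z.1) * (L - z.2) - w) 1).
- exact: continuous_cos.
- by apply: measurable_funB => //; apply: measurable_funM => //; exact: measurable_funB.
- by move=> x; rewrite ler_norml cos_geN1 cos_le1.
Qed.

Lemma smoothing_cker L w : 0 < L -> exists C, smoothing 0 L (kop 0 L (cker L w)) C.
Proof.
move=> L0; eexists; apply: (@smoothing_kop _ 0 L L0 _ (Num.sqrt (2 / pi)) (Num.sqrt (2 / pi) * L)).
- exact: bmf2_cker.
- by move=> t r; rewrite /cker /= [(L - t) * _]mulrC.
- move=> t r _; rewrite /cker normrM ger0_norm ?sqrtr_ge0// ler_piMr ?sqrtr_ge0//.
  by rewrite ler_norml cos_geN1 cos_le1.
- move=> t u r /andP[r0 rL]; rewrite /cker -mulrBr normrM ger0_norm ?sqrtr_ge0// -mulrA.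
  rewrite ler_wpM2l ?sqrtr_ge0// (le_trans (cos_lipschitz _ _))//=.
  rewrite (_ : _ - _ = (u - t) * (L - r)); last by ring.
  rewrite normrM distrC mulrC ler_wpM2r// ger0_norm ?subr_ge0//; lra.
Qed.

Definition packet L eta th a b r : R := cos (L * r + eta * ln r + th) * isq a b r.

Lemma bmf_packet L eta th a b : 0 < a -> a < b -> bmf (packet L eta th a b).
Proof.
move=> a0 ab; apply: bmfM; last exact: bmf_isq.
apply: bmf_cos; apply: measurable_funD => //; apply: measurable_funD.
  exact: measurable_funM.
by apply: measurable_funM => //; exact: measurable_ln.
Qed.

(** In the corner the phase depends on [p]; [waveT_L2], which is about a fixed phase, applies only
    after this splitting. *)
Lemma waveT_phase a b eta th p : 0 < a -> a < b -> waveT a b eta th p =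
  cos th * waveT a b eta 0 p - sin th * waveT a b eta (- (pi / 2)) p.
Proof.
move=> a0 ab.
have bw t : bmf (fun r => cos (p * r + eta * ln r + t) * isq a b r).
  apply: bmfM; last exact: bmf_isq.
  apply: bmf_cos; apply: measurable_funD => //; apply: measurable_funD.
    exact: measurable_funM.
  by apply: measurable_funM => //; exact: measurable_ln.
have wE t : waveT a b eta t p = \int[mu]_(r in `[a, b]) (cos (p * r + eta * ln r + t) * isq a b r).
  by apply: int_eq => r rab; rewrite /isq indicE mem_set ?mulr1//= in_itv.
rewrite !wE -(intZ _ _ _ (bw 0)) -(intZ _ _ _ (bw (- (pi / 2)))).
rewrite -(intB _ _ (bmfZ (cos th) (bw 0)) (bmfZ (sin th) (bw (- (pi / 2))))).
apply: int_eq => r _; set u := p * r + _.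
by rewrite addr0 (cosD u th) cosBpihalf; ring.
Qed.

Lemma waveM_phase eta th p : waveM eta th p =
  cos th * waveM eta 0 p - sin th * waveM eta (- (pi / 2)) p.
Proof.
rewrite /waveM addr0; set u := phase eta - eta * ln p.
rewrite (_ : phase eta + th - _ = u + th); last by rewrite /u; ring.
rewrite (_ : phase eta + _ - _ = u - pi / 2); last by rewrite /u; ring.
by rewrite (cosD u th) cosBpihalf; ring.
Qed.

Lemma kop_packet L w eta th a b p : 0 < a -> a < b -> b <= L ->
  kop 0 L (cker L w) (packet L eta th a b) p = Num.sqrt (2 / pi) / 2 *
   (waveT a b eta (th + L ^+ 2 - w - L * p) p +
    waveT a b eta (th + w - L ^+ 2 + L * p) (2 * L - p)).
Proof.
move=> a0 ab bL.
have bw t q : bmf (fun r => cos (q * r + eta * ln r + t) * isq a b r).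
  apply: bmfM; last exact: bmf_isq.
  apply: bmf_cos; apply: measurable_funD => //; apply: measurable_funD.
    exact: measurable_funM.
  by apply: measurable_funM => //; exact: measurable_ln.
have wE t q : waveT a b eta t q = \int[mu]_(r in `[a, b]) (cos (q * r + eta * ln r + t) * isq a b r).
  by apply: int_eq => r rab; rewrite /isq indicE mem_set ?mulr1//= in_itv.
rewrite !wE -intD// -intZ; last exact: bmfD.
rewrite /kop; transitivity (\int[mu]_(r in `[0, L]) (cker L w (p, r) *
    (cos (L * r + eta * ln r + th) / Num.sqrt r) * \1_(`[a, b] : set R) r)).
  by apply: int_eq => r _; rewrite /packet /isq; ring.
rewrite int_indic ?(ltW a0)//; apply: int_eq => r rab.
rewrite /isq indicE mem_set/= ?in_itv//= mulr1 /cker /=.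
set X := (L - p) * (L - r) - w; set Y := L * r + eta * ln r + th.
have -> : p * r + eta * ln r + (th + L ^+ 2 - w - L * p) = X + Y by rewrite /X /Y; ring.
have -> : (2 * L - p) * r + eta * ln r + (th + w - L ^+ 2 + L * p) = - (X - Y).
  by rewrite /X /Y; ring.
by rewrite cosN (cosD X) (cosB X); field; rewrite gt_eqF// sqrtr_gt0; case/andP: rab => + _; exact: lt_le_trans.
Qed.

(** Four times the constant of [waveT_L2] (two phases, and a factor 2 for separating the
    non-resonant term), plus [2 C^2] for that term, with [C = osc_const eta]. *)
Definition packet_err eta : R := 48 + 38 * osc_const eta ^+ 2.

Lemma sqrt_2pi : Num.sqrt (2 / pi) / 2 * Num.sqrt (2 * pi) = 1 :> R.
Proof.
have p0 := @pi_gt0 R; have [q q0 ->] := sqrt_gt0_ex p0.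
have two0 : (0 : R) < 2 by []; have [t t0 tE] := sqrt_gt0_ex two0.
rewrite {1 3}tE -exprVn -!exprMn !sqrt_sqr ?divr_gt0 ?mulr_gt0//.
rewrite (_ : _ * _ = t ^+ 2 / 2); last by field; rewrite gt_eqF.
by rewrite -tE divff.
Qed.

(* The corner of the phase-space square [0, L]^2 couples a packet on [a, b]
   to the dual packet on [1/b, 1/a]. *)
Lemma kop_packet_close L w eta th a b s : 0 < a -> a < b -> b <= L -> a^-1 <= L ->
  amp eta = Num.sqrt (2 * pi) * s ->
  ip 0 L (fun p => - s * packet L eta (- (phase eta + (th + L ^+ 2 - w))) b^-1 a^-1 p
      + kop 0 L (cker L w) (packet L eta th a b) p)
    (fun p => - s * packet L eta (- (phase eta + (th + L ^+ 2 - w))) b^-1 a^-1 p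
      + kop 0 L (cker L w) (packet L eta th a b) p) <= packet_err eta.
Proof.
move=> a0 ab bL aL ampE.
have b0 : 0 < b by exact: lt_trans ab.
have ai0 : 0 < a^-1 by rewrite invr_gt0.
have bi0 : 0 < b^-1 by rewrite invr_gt0.
have bai : b^-1 < a^-1 by rewrite ltf_pV2.
have L0 : 0 < L by exact: lt_le_trans bL.
set th' := - (phase eta + _); pose c : R := Num.sqrt (2 / pi) / 2.
pose C := osc_const eta; have C0 : 0 < C by exact: osc_const_gt0.
have [Cs sK] := smoothing_cker w L0.
have bp := bmf_packet L eta th a0 ab.
have bp' := bmf_packet L eta th' bi0 bai.
have bK := smoothing_bmf sK bp.
pose D th p := waveT a b eta th p - waveM eta th p * \1_(`[b^-1, a^-1] : set R) p.
have bD t : bmf (D t) by apply: bmfB; [exact: bmf_waveT|exact: bmf_waveM].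
have inv2 (y : R) : (y == 0) = false -> 2 / y * 2^-1 ^+ 2 = (2 * y)^-1.
  by move=> y0; field; rewrite y0.
have c2 : c ^+ 2 <= 1.
  rewrite /c exprMn sqr_sqrtr ?divr_ge0 ?pi_ge0//.
  rewrite [leLHS](_ : _ = (2 * pi)^-1); last by apply: inv2 (gt_eqF (@pi_gt0 R)).
  by rewrite invf_le1 ?mulr_gt0 ?pi_gt0//; have := @pi_ge2 R; lra.
apply: (@le_trans _ _ (\int[mu]_(p in `[0, L])
    (2 * (D 0 p * D 0 p) + (2 * (D (- (pi / 2)) p * D (- (pi / 2)) p) + 2 * (C ^+ 2 / L))))).
  have b1 := bmfM (bD 0) (bD 0); have b2 := bmfM (bD (- (pi / 2))) (bD (- (pi / 2))).
  have bl := bmf_lin (- s) bp' bK.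
  apply: int_le; [exact: (bmfM bl bl)|by apply: bmfD; [exact: bmfZ|apply: bmfD; [exact: bmfZ|exact: bmf_cst]]|].
  move=> p /andP[p0 pL]; rewrite kop_packet// -/c.
  set t1 := th + L ^+ 2 - w - L * p; set t2 := th + w - _ + _.
  (* The phase [th'] is chosen for this: the dual packet is the main term of the resonant part,
     normalised by [sqrt_2pi]. *)
  have sE : s * packet L eta th' b^-1 a^-1 p =
      c * (waveM eta t1 p * \1_(`[b^-1, a^-1] : set R) p).
    rewrite /waveM ampE /packet /isq.
    rewrite (_ : L * p + eta * ln p + th' = - (phase eta + t1 - eta * ln p)); last first.
      by rewrite /th' /t1; ring.
    rewrite cosN; transitivity ((c * Num.sqrt (2 * pi)) * (s * (cos (phase eta + t1 - eta * ln p) *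
      ((Num.sqrt p)^-1 * \1_(`[b^-1, a^-1]%classic : set R) p)))); last by ring.
    by rewrite sqrt_2pi mul1r.
  rewrite mulNr sE; set E2 := waveT _ _ _ t2 _.
  (* The non-resonant frequency is at least [L], and [1 / a <= L]; integrated over [[0, L]] this
     costs only [C^2]. *)
  have E2b : E2 ^+ 2 <= C ^+ 2 / L.
    have q0 : 0 < 2 * L - p by lra.
    have qL : L <= 2 * L - p by lra.
    have sa : 0 < Num.sqrt a by rewrite sqrtr_gt0.
    rewrite -real_normK ?num_real//.
    apply: (@le_trans _ _ ((C / (L * Num.sqrt a)) ^+ 2)).
      rewrite ler_pXn2r ?nnegrE ?divr_ge0 ?mulr_ge0 ?(ltW C0) ?(ltW L0) ?(ltW sa)//.
      rewrite (le_trans (waveT_decay a0 ab eta t2 q0))// -/C.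
      rewrite ler_wpM2l ?(ltW C0)// lef_pV2 ?posrE ?mulr_gt0//.
      by rewrite ler_wpM2r// ltW.
    rewrite exprMn exprVn exprMn sqr_sqrtr ?(ltW a0)// ler_wpM2l ?sqr_ge0//.
    rewrite lef_pV2 ?posrE ?mulr_gt0 ?exprn_gt0// expr2 -mulrA ler_pMr//.
    by rewrite -(@ler_pM2r _ a^-1)// mul1r mulfK ?gt_eqF.
  rewrite waveT_phase// waveM_phase.
  set A0 := waveT _ _ _ 0 _; set A1 := waveT _ _ _ _ _.
  set M0 := waveM _ 0 _; set M1 := waveM _ _ _; set ii := \1__ _.
  rewrite [X in X * X <= _](_ : _ = c * ((cos t1 * (A0 - M0 * ii) - sin t1 * (A1 - M1 * ii)) + E2)); last by ring.
  rewrite -expr2 exprMn (le_trans (ler_piMl (sqr_ge0 _) c2))//.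
  rewrite /D -/A0 -/A1 -/M0 -/M1 -/ii.
  set d0 := A0 - _; set d1 := A1 - _.
  apply: (@le_trans _ _ (2 * (d0 * d0 + d1 * d1) + 2 * E2 ^+ 2)); last first.
    by rewrite mulrDr -addrA lerD2l lerD2l ler_wpM2l.
  (* Cauchy-Schwarz against the unit vector [(cos t1, - sin t1)], which removes the [p]-dependent
     phase. *)
  have cs : (cos t1 * d0 - sin t1 * d1) ^+ 2 <= d0 * d0 + d1 * d1.
    rewrite -[leRHS]mul1r -(cos2Dsin2 t1) -subr_ge0.
    rewrite (_ : _ - _ = (sin t1 * d0 + cos t1 * d1) ^+ 2); last by ring.
    exact: sqr_ge0.
  move: cs; set q := cos t1 * _ - _ => cs.
  have := sqr_ge0 (q - E2); nra.
have b1 := bmfM (bD 0) (bD 0); have b2 := bmfM (bD (- (pi / 2))) (bD (- (pi / 2))).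
rewrite intD; [|exact: bmfZ|by apply: bmfD; [exact: bmfZ|exact: bmf_cst]].
rewrite intD; [|exact: bmfZ|exact: bmf_cst].
rewrite intZ// intZ// int_cst ?(ltW L0)// subr0.
have := waveT_L2 a0 ab eta 0 aL; have := waveT_L2 a0 ab eta (- (pi / 2)) aL.
have -> : 2 * (C ^+ 2 / L) * L = 2 * C ^+ 2 by field; rewrite gt_eqF.
rewrite /packet_err /D -/C => H1 H2; lra.
Qed.

(** The squared norms for the phases [0] and [- (pi / 2)] add up to [ln b - ln 2], so one of them
    has at least half. *)
Lemma packet_norm L eta b : 2 < b -> b <= L -> exists th,
  2^-1 * (ln b - ln 2) <= ip 0 L (packet L eta th 2 b) (packet L eta th 2 b).
Proof.
move=> b2 bL.
have bp th : bmf (packet L eta th 2 b) by apply: bmf_packet.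
have sum : ip 0 L (packet L eta 0 2 b) (packet L eta 0 2 b) +
    ip 0 L (packet L eta (- (pi / 2)) 2 b) (packet L eta (- (pi / 2)) 2 b) = ln b - ln 2.
  rewrite /ip -intD; [|exact: bmfM..].
  transitivity (\int[mu]_(p in `[0, L]) (1 / p * \1_(`[2, b] : set R) p)); last first.
    by rewrite int_indic// int_inv ?mul1r// (ltW b2) andbT.
  apply: int_eq => p _; rewrite /packet /isq indicE.
  case: (boolP (p \in _)) => [|_]; last by rewrite !mulr0 addr0.
  rewrite inE/= in_itv/= => /andP[p2 _]; have p0 : 0 < p by exact: lt_le_trans p2.
  rewrite addr0 cosBpihalf; set u := L * p + _; move: u => u; have [q q0 ->] := sqrt_gt0_ex p0.
  rewrite sqrt_sqr// !mulr1 mul1r.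
  transitivity ((cos u ^+ 2 + sin u ^+ 2) / q ^+ 2); last by rewrite cos2Dsin2 mul1r.
  by field; rewrite gt_eqF.
have [H|H] := leP (2^-1 * (ln b - ln 2)) (ip 0 L (packet L eta 0 2 b) (packet L eta 0 2 b)).
  by exists 0.
by exists (- (pi / 2)); move: sum H; lra.
Qed.

Lemma packet_disjoint L eta th th' a b a' b' r : b' < a ->
  packet L eta th a b r * packet L eta th' a' b' r = 0.
Proof.
move=> ba; rewrite /packet /isq !indicE.
case: (boolP (r \in (`[a, b]%classic : set R))) => [|_]; last by rewrite !mulr0 mul0r.
case: (boolP (r \in (`[a', b']%classic : set R))) => [|_]; last by rewrite !mulr0.
rewrite !inE/= !in_itv/= => /andP[_ rb] /andP[ar _].
by move: (lt_le_trans ba (le_trans ar rb)); rewrite ltxx.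
Qed.

(** [L0] is fixed before [L], [w] and the sign: the packet window depends on [s] and [e] alone, and
    a larger [L] only changes phases. *)
Lemma corner_eigenvalue s e : 0 < s < 1 -> 0 < e < s ->
  exists2 L0, 0 < L0 & forall L, L0 <= L -> forall w sg, `|sg| = 1 ->
  exists m h, [/\ `|m - sg * s| <= e, bmf h, 0 < ip 0 L h h &
    forall t, 0 <= t <= L -> kop 0 L (cker L w) h t = m * h t].
Proof.
have half2 : 2^-1 < 2 :> R by lra.
have aux (x y z t N : R) : 0 <= x + 2 * - t * y + z -> z <= N -> x <= N ->
    x + 2 * t * y + z <= 4 * N by lra.
move=> s01 /andP[e0 es]; have [eta ampE] := amp_surjective s01.
have N0 : 0 < packet_err eta.
  by rewrite /packet_err ltr_wpDr// mulr_ge0// sqr_ge0.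
(* With this [b], half of [ln b - ln 2] is [4 * packet_err eta / e ^+ 2], the norm needed to make
   the error relatively smaller than [e]. *)
pose b := 2 * expR (8 * packet_err eta / e ^+ 2).
have b2 : 2 < b by rewrite /b ltr_pMr// -expR0 ltr_expR divr_gt0 ?exprn_gt0// mulr_gt0.
have b0 : 0 < b by lra.
exists b => // L bL w sg sg1; have L0 : 0 < L by exact: lt_le_trans bL.
have sg2 : sg * sg = 1 by rewrite -expr2 -real_normK ?num_real// sg1 expr1n.
have [C sK] := smoothing_cker w L0.
have [th th_norm] := packet_norm eta b2 bL.
pose th' := - (phase eta + (th + L ^+ 2 - w)).
pose u := packet L eta th 2 b; pose v := packet L eta th' b^-1 2^-1.
have bi0 : 0 < b^-1 by rewrite invr_gt0.
have bi2 : b^-1 < 2^-1 by rewrite ltf_pV2 ?posrE.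
have L2 : 2^-1 <= L by lra.
have bu : bmf u by exact: bmf_packet.
have bv : bmf v by exact: bmf_packet.
have close1 := kop_packet_close w th (ltr0n _ 2) b2 bL L2 ampE.
(* Duality is an involution on windows and phases, so the operator sends [v] back to nearly
   [s u]. *)
have := kop_packet_close w th' bi0 bi2 L2 _ ampE.
rewrite !invrK => /(_ bL).
rewrite (_ : - (phase eta + (th' + L ^+ 2 - w)) = th); last by rewrite /th'; ring.
rewrite -/v -/u => close2; move: close1; rewrite -/th' -/u -/v => close1.
pose K := kop 0 L (cker L w).
have bKu : bmf (K u) by exact: smoothing_bmf sK _ bu.
have bKv : bmf (K v) by exact: smoothing_bmf sK _ bv.
pose f x := sg * v x + u x.
have bf : bmf f by exact: bmf_lin.
have uv : ip 0 L v u = 0.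
  rewrite /ip (@int_eq _ _ _ _ (fun=> 0)) ?int_cst ?(ltW L0) ?mul0r//.
  by move=> x _; rewrite [LHS]mulrC; exact: packet_disjoint half2.
have ff : ip 0 L f f = ip 0 L v v + ip 0 L u u.
  by rewrite ip_sqr_lin// uv mulr0 addr0 expr2 sg2 mul1r.
have uu0 : 4 * packet_err eta <= e ^+ 2 * ip 0 L u u.
  apply: (@le_trans _ _ (e ^+ 2 * (2^-1 * (ln b - ln 2)))); last first.
    by rewrite ler_wpM2l ?sqr_ge0.
  rewrite /b lnM ?posrE ?expR_gt0// expRK.
  rewrite [leRHS](_ : _ = 4 * packet_err eta)//.
  by move: (packet_err eta) (ln 2) => N l2; field; rewrite gt_eqF.
have uu1 : 0 < ip 0 L u u.
  have := lt_le_trans (mulr_gt0 (ltr0n R 4) N0) uu0.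
  by rewrite pmulr_rgt0// exprn_gt0.
apply: (near_eigenvalue L0 sK bf).
- by rewrite ff ltr_wpDl ?ip_ge0.
- by rewrite e0 normrM sg1 mul1r gtr0_norm// (lt_trans e0).
pose g1 x := - s * v x + K u x; pose g2 x := - s * u x + K v x.
have bg1 : bmf g1 by exact: bmf_lin.
have bg2 : bmf g2 by exact: bmf_lin.
have fE : (fun x => - (sg * s) * f x + kop 0 L (cker L w) f x) = fun x => sg * g2 x + g1 x.
  apply/funext => x; rewrite /f (smoothing_lin sK)// /g1 /g2 -/K.
  rewrite (_ : - s * v x = - s * (sg * sg) * v x); last by rewrite sg2 mulr1.
  ring.
rewrite fE; apply: (@le_trans _ _ (4 * packet_err eta)); last first.
  by rewrite (le_trans uu0)// ler_wpM2l ?sqr_ge0// ff lerDr ip_ge0.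
have sgq : sg ^+ 2 = 1 by rewrite expr2.
(* Parallelogram bound: the cross term of [|g1 + sg g2|^2] is absorbed by [|g1 - sg g2|^2 >= 0],
   giving twice the sum of the squared norms. *)
have H := ip_ge0 0 L (fun x => - sg * g2 x + g1 x).
rewrite (ip_sqr_lin _ _ _ bg2 bg1) sqrrN sgq mul1r in H.
rewrite (ip_sqr_lin _ _ _ bg2 bg1) sgq mul1r.
exact: aux H close1 close2.
Qed.

End CornerWavePackets.

(** * From the corner operator to the truncated Fourier operator *)

Section Flip.
Context {R : realType}.
Local Notation mu := (@lebesgue_measure R).
Implicit Types (f : R -> R) (c d u : R).

Let flip_preimage u c d : (fun x : R => u - x) @^-1` `[c, d]%classic = `[u - d, u - c]%classic.
Proof.
apply/seteqP; split => x /=; rewrite !in_itv/= => /andP[H1 H2]; apply/andP; split; lra.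
Qed.

Let flip u (x : measurableTypeR R) : measurableTypeR R := u - x.

Let measurable_flip u : measurable_fun setT (flip u).
Proof. by apply: (measurable_funB (f := cst u) (g := id)). Qed.

(** Lebesgue measure is determined by its values on half-open intervals; reflection moves the closed
    end but keeps the length. *)
Let flip_measure u (A : set R) : measurable A ->
  pushforward mu (flip u) A = mu A.
Proof.
move=> mA.
pose mf := measurable_flip u.
apply/esym/(@lebesgue_measure_unique _ (pushforward mu (flip u))) => //= _ [[a b]] _ <-.
rewrite /pushforward.
rewrite (_ : flip u @^-1` _ = [set` Interval (BLeft (u - b)) (BLeft (u - a))]); last first.
  by apply/seteqP; split => x /=; rewrite !in_itv/= /flip => /andP[H1 H2]; apply/andP; split; lra.
rewrite !lebesgue_measure_itv/= !lte_fin ltrD2l ltrN2 -!EFinB.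
by rewrite (_ : u - a - (u - b) = b - a)//; ring.
Qed.

Lemma int_flip u c d f : bmf f ->
  \int[mu]_(x in `[c, d]) f (u - x) = \int[mu]_(x in `[u - d, u - c]) f x.
Proof.
move=> [mf [M fM]]; have bff : bmf (fun x => f (u - x)).
  split; last by exists M => x; exact: fM.
  by apply: measurableT_comp => //; exact: measurable_flip u.
have pre : flip u @^-1` `[u - d, u - c]%classic = `[c, d]%classic.
  by rewrite flip_preimage !subKr.
rewrite /Rintegral; congr fine.
transitivity (\int[mu]_(x in flip u @^-1` `[(u - d)%R, (u - c)%R]) ((EFin \o f) \o flip u) x)%E.
  by rewrite pre.
rewrite -(integral_pushforward (measurable_flip u))//.
- by apply: eq_measure_integral => A mA _; exact: flip_measure.
- exact/measurable_EFinP.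
- rewrite pre; exact: bmf_integrable bff.
Qed.

Lemma int_odd a f : bmf f -> (forall x, f (- x) = - f x) ->
  \int[mu]_(x in `[- a, a]) f x = 0.
Proof.
move=> bf fo; have := int_flip 0 (- a) a bf; rewrite !sub0r opprK.
rewrite (_ : \int[_]_(_ in _) f (0 - _) = - \int[mu]_(x in `[- a, a]) f x); first by lra.
by rewrite -[RHS]mulN1r -intZ//; apply: int_eq => x _; rewrite sub0r fo mulN1r.
Qed.

Lemma int_even a f : 0 < a -> bmf f -> (forall x, f (- x) = f x) ->
  \int[mu]_(x in `[- a, a]) f x = 2 * \int[mu]_(x in `[0, a]) f x.
Proof.
move=> a0 bf fe; have := int_flip 0 0 a bf; rewrite !sub0r oppr0.
rewrite (_ : \int[_]_(_ in _) f (0 - _) = \int[mu]_(x in `[0, a]) f x); last first.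
  by apply: int_eq => x _; rewrite sub0r fe.
have ia := bmf_integrable (- a) a bf.
have := @Rintegral_itvB R f (BLeft (- a)) (BRight a) 0 ia.
rewrite !bnd_simp => /(_ _ _) H; have {}H := H ltac:(by rewrite oppr_le0 ltW) ltac:(by rewrite ltW).
move: H; rewrite Rintegral_itv_obnd_cbnd; first by lra.
apply: integrableS ia => //; apply: subset_itv; rewrite bnd_simp//.
by rewrite oppr_le0 ltW.
Qed.

End Flip.

Lemma ae_imp {R : realType} (P Q : R -> Prop) : (forall t, P t -> Q t) ->
  {ae lebesgue_measure, forall t : R, P t} -> {ae lebesgue_measure, forall t : R, Q t}.
Proof. by move=> PQ; apply: (@filterS _ _ (ae_filter_ringOfSetsType _)) => t /PQ. Qed.

Section TruncatedFourier.
Context {R : realType}.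
Local Open Scope complex_scope.
Local Notation mu := (@lebesgue_measure R).
Variable a : R.
Hypothesis a0 : 0 < a.
Implicit Types (f g : R -> R) (t w : R).

Let na : - a < a. Proof. by rewrite gtrN. Qed.
Local Notation k := ((Num.sqrt (2 * pi))^-1 : R).

Let bcosf f t : bmf f -> bmf (fun r => cos (t * r) * f r).
Proof.
move=> bf; apply: bmfM => //; apply: bmf_cos.
exact: measurable_funM.
Qed.

Let bsinf f t : bmf f -> bmf (fun r => sin (t * r) * f r).
Proof.
move=> bf; apply: bmfM => //; split; last by exists 1 => x; rewrite ler_norml sin_geN1 sin_le1.
apply: measurableT_comp; last exact: measurable_funM.
by apply: continuous_measurable_fun; exact: continuous_sin.
Qed.

Lemma truncated_FourierE f g t : bmf f -> bmf g ->
  truncated_Fourier a (fun x => f x +i* g x) t =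
  (k * (cosT (- a) a f t - sinT (- a) a g t)) +i* (k * (sinT (- a) a f t + cosT (- a) a g t)).
Proof.
move=> bf bg; rewrite /truncated_Fourier /Cintegral /= /cosT /sinT.
rewrite -intB; [|exact: bcosf|exact: bsinf].
rewrite -intD; [|exact: bsinf|exact: bcosf].
transitivity (k%:C *
   (\int[mu]_(x in `[- a, a]) (cos (t * x) * f x - sin (t * x) * g x) +i*
    \int[mu]_(x in `[- a, a]) (sin (t * x) * f x + cos (t * x) * g x))).
  by congr (_ * (_ +i* _)); apply: int_eq => x _ //=; rewrite addrC.
by apply/eqP; rewrite eq_complex /= !mul0r subr0 addr0 !eqxx.
Qed.

Lemma eigenvalue_intro f g (lam : R[i]) : bmf f -> bmf g ->
  0 < ip (- a) a f f + ip (- a) a g g ->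
  (forall t, - a <= t <= a ->
    truncated_Fourier a (fun x => f x +i* g x) t = lam * (f t +i* g t)) ->
  eigenvalues `[- a, a]%classic (truncated_Fourier a) lam.
Proof.
move=> bf bg fg0 H; exists (fun x => f x +i* g x); split.
- have [mf _] := bf; have [mg _] := bg.
  split; [exact: measurable_funS mf|exact: measurable_funS mg|].
  have bfg : bmf (fun x => f x * f x + g x * g x) by apply: bmfD; exact: bmfM.
  apply: le_lt_trans (integrable_lty _ (bmf_integrable (- a) a bfg)) => //.
  rewrite le_eqVlt; apply/orP; left; apply/eqP; apply: eq_integral => t _ /=.
  by rewrite sqr_sqrtr ?addr_ge0 ?sqr_ge0// !expr2.
- move=> H0; move: fg0.
  have fg_ae : {ae mu, forall t, `[- a, a]%classic t -> (f t = 0 /\ g t = 0)}.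
    by apply: ae_imp H0 => t /= H0 /H0 [].
  have z h : bmf h -> {ae mu, forall t, `[- a, a]%classic t -> h t = 0} -> ip (- a) a h h = 0.
    move=> [mh _] h0; rewrite /ip /Rintegral.
    rewrite (ae_eq_integral (cst 0%E))//; first by rewrite integral0.
      apply/measurable_EFinP; apply: measurable_funM; exact: measurable_funS mh.
    by apply: ae_imp h0 => t /= h0 /h0 ->; rewrite mul0r.
  rewrite !z ?addr0 ?ltxx//; apply: ae_imp fg_ae => t /= h0 /h0; by case.
- by apply: aeW => t /=; rewrite in_itv/=; exact: H.
Qed.

Lemma cosT_even f t : (forall x, f (- x) = f x) -> bmf f ->
  cosT (- a) a f t = 2 * \int[mu]_(r in `[0, a]) (cos (t * r) * f r).
Proof.
move=> fe bf; apply: int_even => //; first exact: bcosf.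
by move=> x; rewrite fe [t * - x]mulrN cosN.
Qed.

Lemma cosT_odd f t : (forall x, f (- x) = - f x) -> bmf f -> cosT (- a) a f t = 0.
Proof.
move=> fe bf; apply: int_odd => //; first exact: bcosf.
by move=> x; rewrite fe [t * - x]mulrN cosN mulrN.
Qed.

Lemma sinT_odd f t : (forall x, f (- x) = - f x) -> bmf f ->
  sinT (- a) a f t = 2 * \int[mu]_(r in `[0, a]) (sin (t * r) * f r).
Proof.
move=> fe bf; apply: int_even => //; first exact: bsinf.
by move=> x; rewrite fe [t * - x]mulrN sinN mulrNN.
Qed.

Lemma sinT_even f t : (forall x, f (- x) = f x) -> bmf f -> sinT (- a) a f t = 0.
Proof.
move=> fe bf; apply: int_odd => //; first exact: bsinf.
by move=> x; rewrite fe [t * - x]mulrN sinN mulNr.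
Qed.

Let k2 : k * 2 = Num.sqrt (2 / pi).
Proof.
have s0 : Num.sqrt (2 * pi) != 0 :> R by rewrite gt_eqF// sqrtr_gt0 mulr_gt0// pi_gt0.
move: (@sqrt_2pi R) s0; move: (Num.sqrt (2 * pi)) (Num.sqrt (2 / pi)) => x y H x0.
have <- : (y / 2 * x) * (x^-1 * 2) = y by rewrite mulrA mulfK// divfK.
by rewrite H mul1r.
Qed.

(* A corner eigenfunction [h], read from the endpoint [a] inwards, extends to an
   even (w = 0) or odd (w = pi / 2) eigenfunction on the whole segment. *)
Section FromCorner.
Variables (w m : R) (h : R -> R).
Hypotheses (bh : bmf h) (m0 : m != 0) (h0 : 0 < ip 0 a h h)
  (hE : forall t, 0 <= t <= a -> kop 0 a (cker a w) h t = m * h t).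

(** On [[0, a]] this is [m h], but unlike [h] it satisfies the eigenvalue equation at every real
    point. *)
Let psi := kop 0 a (cker a w) h.

Let bpsi : bmf psi.
Proof. by have [C sK] := smoothing_cker w a0; exact: smoothing_bmf sK _ bh. Qed.

Let psiE t : kop 0 a (cker a w) psi t = m * psi t.
Proof.
rewrite {2}/psi /kop -intZ; last first.
  by apply: bmfM => //; exact: (bmf2_section _ (bmf2_cker a w)).
by apply: int_eq => r rab; rewrite /psi hE//; ring.
Qed.

Let psi0 : 0 < ip 0 a psi psi.
Proof.
rewrite (_ : ip 0 a psi psi = m ^+ 2 * ip 0 a h h).
  by rewrite mulr_gt0// exprn_even_gt0.
rewrite /ip -intZ; last exact: bmfM.
by apply: int_eq => r rab; rewrite /psi hE//; ring.
Qed.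

Let bpsi_flip : bmf (fun x => psi (a - `|x|)).
Proof.
have [mp [M pM]] := bpsi; split; last by exists M => x; exact: pM.
apply: measurableT_comp => //; apply: measurable_funB => //.
Qed.

(** Covers the constant 1 and the sign function at once; the sign vanishes at 0, so the point 0 is
    removed from the segment before comparing. *)
Let half_norm (s : R -> R) : bmf s -> (forall x, 0 < x -> s x * s x = 1) ->
  \int[mu]_(x in `[0, a]) (s x * psi (a - `|x|) * (s x * psi (a - `|x|))) = ip 0 a psi psi.
Proof.
move=> bs s1.
have bpp := bmfM bpsi bpsi.
have := int_flip a 0 a bpp; rewrite subrr subr0 -/(ip 0 a psi psi) => <-.
have bl : bmf (fun x => s x * psi (a - `|x|) * (s x * psi (a - `|x|))).
  by apply: bmfM; apply: bmfM.
have br : bmf (fun x => psi (a - `|x|) * psi (a - `|x|)) by exact: bmfM.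
transitivity (\int[mu]_(x in `[0, a]) (psi (a - `|x|) * psi (a - `|x|))); last first.
  by apply: int_eq => x /andP[x0 _]; rewrite ger0_norm.
rewrite -Rintegral_itv_obnd_cbnd; last first.
  by apply: integrableS (bmf_integrable 0 a bl) => //; apply: subset_itvr; rewrite bnd_simp.
rewrite -[RHS]Rintegral_itv_obnd_cbnd; last first.
  by apply: integrableS (bmf_integrable 0 a br) => //; apply: subset_itvr; rewrite bnd_simp.
apply: eq_Rintegral => x; rewrite inE/= in_itv/= => /andP[x0 _].
by rewrite mulrACA s1// mul1r.
Qed.

Lemma even_eigenvalue : w = 0 ->
  eigenvalues `[- a, a]%classic (truncated_Fourier a) (m +i* 0).
Proof.
move=> w0; pose f (x : R) := psi (a - `|x|).
have fe x : f (- x) = f x by rewrite /f normrN.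
apply: (@eigenvalue_intro f (fun=> 0)) => //; first exact: bmf_cst.
  rewrite [ip _ _ (fun=> 0) _](_ : _ = 0); last first.
    by rewrite /ip; under eq_Rintegral do rewrite mul0r; rewrite int_cst ?(ltW na)// mul0r.
  rewrite addr0 /ip int_even//; [|exact: bmfM|by move=> x; rewrite fe].
  have := half_norm (bmf_cst 1); under eq_Rintegral do rewrite !mul1r.
  by move=> ->; [rewrite mulr_gt0|move=> x _; rewrite mulr1].
move=> t /andP[ta at_]; rewrite truncated_FourierE//; last exact: bmf_cst.
have zc : cosT (- a) a (fun=> 0) t = 0.
  by rewrite /cosT; under eq_Rintegral do rewrite mulr0; rewrite int_cst ?(ltW na)// mul0r.
have zs : sinT (- a) a (fun=> 0) t = 0.
  by rewrite /sinT; under eq_Rintegral do rewrite mulr0; rewrite int_cst ?(ltW na)// mul0r.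
rewrite zc zs subr0 addr0 sinT_even// cosT_even// mulrA k2.
have -> : Num.sqrt (2 / pi) * \int[mu]_(r in `[0, a]) (cos (t * r) * f r) = m * f t.
  rewrite /f -psiE /kop -intZ; last exact: bcosf.
  have bg : bmf (fun r => cker a w (a - `|t|, r) * psi r).
    by apply: bmfM => //; exact: (bmf2_section _ (bmf2_cker a w)).
  have := int_flip a 0 a bg; rewrite subrr subr0 => <-.
  apply: int_eq => r /andP[r0 ra]; rewrite ger0_norm// /cker /= !subKr w0 subr0.
  rewrite -mulrA; congr (_ * (_ * _)).
  by have [t0|t0] := leP 0 t; [rewrite ger0_norm|rewrite ltr0_norm// mulNr cosN].
by apply/eqP; rewrite eq_complex /= !mulr0 !mul0r subr0 addr0 !eqxx.
Qed.

Lemma odd_eigenvalue : w = pi / 2 ->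
  eigenvalues `[- a, a]%classic (truncated_Fourier a) (0 +i* m).
Proof.
move=> w0; pose f (x : R) := Num.sg x * psi (a - `|x|).
have bsg : bmf (@Num.sg R).
  split.
    rewrite (_ : Num.sg = fun x : R => \1_(`]0, +oo[%classic : set R) x - \1_(`]-oo, 0[%classic : set R) x).
      by apply: measurable_funB; exact: measurable_indic.
    apply/funext => x; rewrite !indicE.
    rewrite (_ : (x \in _) = (0 < x)); last first.
      by apply/idP/idP; rewrite inE/= in_itv/= andbT.
    rewrite (_ : (x \in _) = (x < 0)); last by apply/idP/idP; rewrite inE/= in_itv/=.
    have [x0|x0|->] := ltrgtP x 0; last by rewrite sgr0 subrr.
      by rewrite ltr0_sg// sub0r.
    by rewrite gtr0_sg// subr0.
  exists 1 => x; rewrite normr_sg; by case: (x != 0).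
have fe x : f (- x) = - f x by rewrite /f normrN sgrN mulNr.
have bf : bmf f by exact: bmfM.
apply: (@eigenvalue_intro f (fun=> 0)) => //; first exact: bmf_cst.
  rewrite [ip _ _ (fun=> 0) _](_ : _ = 0); last first.
    by rewrite /ip; under eq_Rintegral do rewrite mul0r; rewrite int_cst ?(ltW na)// mul0r.
  rewrite addr0 /ip int_even//; [|exact: bmfM|by move=> x; rewrite fe mulrNN].
  rewrite half_norm ?mulr_gt0// => x x0.
  by rewrite gtr0_sg// mulr1.
move=> t /andP[ta at_]; rewrite truncated_FourierE//; last exact: bmf_cst.
have zc : cosT (- a) a (fun=> 0) t = 0.
  by rewrite /cosT; under eq_Rintegral do rewrite mulr0; rewrite int_cst ?(ltW na)// mul0r.
have zs : sinT (- a) a (fun=> 0) t = 0.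
  by rewrite /sinT; under eq_Rintegral do rewrite mulr0; rewrite int_cst ?(ltW na)// mul0r.
rewrite zc zs subr0 addr0 sinT_odd// cosT_odd// mulrA k2.
have -> : Num.sqrt (2 / pi) * \int[mu]_(r in `[0, a]) (sin (t * r) * f r) = m * f t.
  have pos (u : R) : 0 <= u ->
      Num.sqrt (2 / pi) * \int[mu]_(r in `[0, a]) (sin (u * r) * f r) = m * psi (a - u).
    move=> u0; rewrite -psiE /kop -intZ; last exact: bsinf.
    have bg : bmf (fun r => cker a w (a - u, r) * psi r).
      by apply: bmfM => //; exact: (bmf2_section _ (bmf2_cker a w)).
    have := int_flip a 0 a bg; rewrite subrr subr0 => <-.
    apply: int_eq => r /andP[r0 ra]; rewrite /f ger0_norm// /cker /= !subKr w0 cosBpihalf.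
    (* At [r = 0] the sign is 0, but the sine vanishes there too. *)
    move: r0; rewrite le_eqVlt => /predU1P[<-|r0]; first by rewrite mulr0 sin0 !(mulr0, mul0r).
    by rewrite gtr0_sg// mul1r mulrA.
  have [t0|t0|<-] := ltrgtP 0 t.
  - by rewrite pos ?(ltW t0)// /f gtr0_sg// mul1r gtr0_norm.
  - rewrite (_ : \int[_]_(_ in _) _ = - \int[mu]_(r in `[0, a]) (sin (- t * r) * f r)).
      rewrite mulrN pos; last by rewrite oppr_ge0 ltW.
      by rewrite /f ltr0_sg// ltr0_norm// mulN1r mulrN.
    rewrite -[RHS]mulN1r -intZ; last exact: bsinf.
    by apply: int_eq => r _; rewrite [- t * r]mulNr sinN; ring.
  - rewrite /f sgr0 mul0r mulr0 (@int_eq _ _ _ _ (fun=> 0)) ?int_cst ?(ltW a0) ?mul0r ?mulr0//.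
    by move=> r _; rewrite mul0r sin0 mul0r.
by apply/eqP; rewrite eq_complex /= !mulr0 !mul0r subr0 add0r !eqxx.
Qed.

End FromCorner.

End TruncatedFourier.

(** * Eigenvalues lie in the cross *)

Section EigenvaluesInCross.
Context {R : realType}.
Local Open Scope complex_scope.
Local Notation mu := (@lebesgue_measure R).
Variable a : R.
Hypothesis a0 : 0 < a.
Implicit Types (f g h : R -> R) (t : R).

Let na : - a < a. Proof. by rewrite gtrN. Qed.
Local Notation D := (`[- a, a]%classic : set R).
Local Notation k := ((Num.sqrt (2 * pi))^-1 : R).
Local Notation C := (cosT (- a) a).
Local Notation S := (sinT (- a) a).
Local Notation ip := (ip (- a) a).

Lemma sin_lipschitz (x y : R) : `|sin x - sin y| <= `|x - y|.
Proof.
rewrite -!cosBpihalf (le_trans (cos_lipschitz _ _))//.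
by rewrite (_ : x - pi / 2 - (y - pi / 2) = x - y)//; ring.
Qed.

Let wave_lip (b : R -> R) t u r : (forall x y, `|b x - b y| <= `|x - y|) ->
  - a <= r <= a -> `|b (t * r) - b (u * r)| <= a * `|t - u|.
Proof.
move=> bl rD; rewrite (le_trans (bl _ _))// -mulrBl normrM mulrC ler_wpM2r//.
by rewrite ler_norml.
Qed.

Let sym_wave (b : R -> R) f g : continuous b -> (forall x, `|b x| <= 1) ->
  (forall x y, `|b x - b y| <= `|x - y|) -> bmf f -> bmf g ->
  ip (kop (- a) a (fun z => b (z.1 * z.2)) f) g =
  ip f (kop (- a) a (fun z => b (z.1 * z.2)) g).
Proof.
move=> cb b1 bl bf bg.
have bk : bmf2 (fun z : R * R => b (z.1 * z.2)).
  by apply: (bmf2_continuous_comp _ _ b1) => //; exact: measurable_funM.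
have sK := @smoothing_kop R (- a) a na (fun z => b (z.1 * z.2)) 1 a bk
  (fun t r => congr1 b (mulrC t r)) (fun t r _ => b1 _)
  (fun t u r rD => @wave_lip b t u r bl rD).
exact: smoothing_sym sK f g bf bg.
Qed.

Lemma ip_cosT f g : bmf f -> bmf g -> ip (C f) g = ip f (C g).
Proof.
apply: (@sym_wave cos); [exact: continuous_cos| |exact: cos_lipschitz].
by move=> x; rewrite ler_norml cos_geN1 cos_le1.
Qed.

Lemma ip_sinT f g : bmf f -> bmf g -> ip (S f) g = ip f (S g).
Proof.
apply: (@sym_wave sin); [exact: continuous_sin| |exact: sin_lipschitz].
by move=> x; rewrite ler_norml sin_geN1 sin_le1.
Qed.

(* The eigenvalue [alpha + i beta] of a real symmetric operator is real. *)
Lemma symmetric_pair_real (T : (R -> R) -> R -> R) f g (al be : R) :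
  bmf f -> bmf g -> ip (T f) g = ip f (T g) ->
  (forall t, T f t = al * f t - be * g t) ->
  (forall t, T g t = be * f t + al * g t) ->
  0 < ip f f + ip g g -> be = 0.
Proof.
move=> bf bg sT Tf Tg fg0.
have H1 : ip (T f) g = - be * ip g g + al * ip f g.
  have bal := bmfZ al bf.
  rewrite (_ : T f = fun t => - be * g t + al * f t); last first.
    by apply/funext => t; rewrite Tf; ring.
  rewrite ipDl//; congr (_ + _).
  rewrite /ip -intZ; last exact: bmfM.
  by apply: int_eq => x _; ring.
have H2 : ip f (T g) = be * ip f f + al * ip f g.
  have bal := bmfZ al bg.
  rewrite (_ : T g = fun t => be * f t + al * g t); last by apply/funext => t; rewrite Tg.
  rewrite ipDr//; congr (_ + _).
  rewrite /ip -intZ; last exact: bmfM.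
  by apply: int_eq => x _; ring.
have : be * (ip f f + ip g g) = 0 by move: sT; rewrite H1 H2; lra.
by move=> /eqP; rewrite mulf_eq0 (gt_eqF fg0) orbF => /eqP.
Qed.

Let half h : bmf h -> (forall x, h (- x) * h (- x) = h x * h x) ->
  ip h h = 2 * \int[mu]_(x in `[0, a]) (h x * h x).
Proof. by move=> bh he; apply: int_even => //; exact: bmfM. Qed.

(** On a function of definite parity one of the two transforms vanishes, so [energy_le] bounds the
    integral of [T^2] over [[0, a]] by [pi] times the full squared norm, which is [2 pi] times the
    half one. Real and imaginary parts are summed since only their joint norm is known to be
    positive. *)
Lemma contraction_pair (T : (R -> R) -> R -> R) f g (al : R) :
  bmf f -> bmf g -> 0 < ip f f + ip g g ->
  (forall x, f (- x) * f (- x) = f x * f x) -> (forall x, g (- x) * g (- x) = g x * g x) ->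
  (forall t, k * T f t = al * f t) -> (forall t, k * T g t = al * g t) ->
  (forall t, C f t ^+ 2 + S f t ^+ 2 = T f t ^+ 2) ->
  (forall t, C g t ^+ 2 + S g t ^+ 2 = T g t ^+ 2) ->
  -1 <= al <= 1.
Proof.
move=> bf bg fg0 fe ge Tf Tg ef eg.
have p0 : 0 < 2 * pi :> R by rewrite mulr_gt0// pi_gt0.
have kk : k ^+ 2 = (2 * pi)^-1 by rewrite exprVn sqr_sqrtr// ltW.
have k0 : k != 0 by rewrite invr_eq0 gt_eqF// sqrtr_gt0.
have one h : bmf h -> (forall x, h (- x) * h (- x) = h x * h x) ->
    (forall t, k * T h t = al * h t) -> (forall t, C h t ^+ 2 + S h t ^+ 2 = T h t ^+ 2) ->
    al ^+ 2 * ip h h <= ip h h.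
  move=> bh he Th eh; have := energy_le na bh (ltW a0).
  rewrite [leLHS](_ : _ =
      2 * pi * al ^+ 2 * \int[mu]_(x in `[0, a]) (h x * h x)); last first.
    rewrite -intZ; last exact: bmfM.
    apply: int_eq => t _; rewrite eh.
    have -> : T h t = k^-1 * (al * h t) by rewrite -Th mulKf.
    by rewrite exprMn exprVn kk invrK exprMn; ring.
  rewrite -/(ip h h) half//; move: (\int[mu]_(x in `[0, a]) (h x * h x)) => I.
  rewrite (_ : pi * (2 * I) = 2 * pi * I); last by ring.
  rewrite -mulrA ler_pM2l// => H.
  by rewrite mulrCA ler_pM2l.
have := lerD (one f bf fe Tf ef) (one g bg ge Tg eg).
rewrite -mulrDr -[leRHS]mul1r ler_pM2r// => al2.
by rewrite -ler_norml -(@ler_pXn2r _ 2)// ?nnegrE// real_normK ?num_real// expr1n.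
Qed.

(* A bounded eigenfunction splits into its even part, an eigenfunction of the
   real symmetric cosine transform, and its odd part, one of [i] times the sine
   transform. *)
Lemma bounded_eigenvalue_cross f g (m n : R) : bmf f -> bmf g ->
  0 < ip f f + ip g g ->
  (forall t, k * (C f t - S g t) = m * f t - n * g t) ->
  (forall t, k * (S f t + C g t) = n * f t + m * g t) ->
  cross (m +i* n).
Proof.
move=> bf bg fg0 E1 E2.
have bflip h : bmf h -> bmf (fun x => h (- x)).
  move=> [mh [M hM]]; split; last by exists M => x; exact: hM.
  by apply: measurableT_comp => //; exact: measurable_funN.
pose ev h x : R := 2^-1 * (h x + h (- x)); pose od h x : R := 2^-1 * (h x - h (- x)).
have bev h : bmf h -> bmf (ev h) by move=> bh; apply/bmfZ/bmfD => //; exact: bflip.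
have bod h : bmf h -> bmf (od h) by move=> bh; apply/bmfZ/bmfB => //; exact: bflip.
have evN h x : ev h (- x) = ev h x by rewrite /ev opprK addrC.
have odN h x : od h (- x) = - od h x by rewrite /od opprK -mulrN opprB.
have bcosf h t : bmf h -> bmf (fun r => cos (t * r) * h r).
  by move=> bh; apply: bmfM => //; apply: bmf_cos; exact: measurable_funM.
have bsinf h t : bmf h -> bmf (fun r => sin (t * r) * h r).
  move=> bh; apply: bmfM => //.
  rewrite (_ : (fun r => sin (t * r)) = fun r => cos (t * r - pi / 2)).
    by apply: bmf_cos; apply: measurable_funB => //; exact: measurable_funM.
  by apply/funext => r; rewrite cosBpihalf.
have Cev h t : bmf h -> C h t = C (ev h) t.
  move=> bh; have := @cosT_odd _ a (od h) t (odN h) (bod _ bh).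
  move=> H; rewrite -[RHS]addr0 -H /cosT -intD; [|exact/bcosf/bev|exact/bcosf/bod].
  by apply: int_eq => x _; rewrite /ev /od; field.
have Sod h t : bmf h -> S h t = S (od h) t.
  move=> bh; have := @sinT_even _ a (ev h) t (evN h) (bev _ bh).
  move=> H; rewrite -[RHS]addr0 -H /sinT -intD; [|exact/bsinf/bod|exact/bsinf/bev].
  by apply: int_eq => x _; rewrite /ev /od; field.
have CN h t : C h (- t) = C h t by apply: int_eq => x _; rewrite mulNr cosN.
have SN h t : bmf h -> S h (- t) = - S h t.
  move=> bh; rewrite -[RHS]mulN1r /sinT -intZ; last exact: bsinf.
  by apply: int_eq => x _; rewrite [- t * x]mulNr sinN; ring.
(* Adding the equations at [t] and [- t] isolates the cosine transform; subtracting them isolates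
   the sine transform below. *)
have Ce1 t : k * C (ev f) t = m * ev f t - n * ev g t.
  have := E1 t; have := E1 (- t); rewrite CN SN// (Cev f)// /ev; lra.
have Ce2 t : k * C (ev g) t = n * ev f t + m * ev g t.
  have := E2 t; have := E2 (- t); rewrite CN SN// (Cev g)// /ev; lra.
have So1 t : k * S (od g) t = - m * od f t + n * od g t.
  have := E1 t; have := E1 (- t); rewrite CN SN// (Sod g)// /od; lra.
have So2 t : k * S (od f) t = n * od f t - - m * od g t.
  have := E2 t; have := E2 (- t); rewrite CN SN// (Sod f)// /od; lra.
have S_ev h t : bmf h -> S (ev h) t = 0 by move=> bh; apply: sinT_even; [exact: evN|exact: bev].
have C_od h t : bmf h -> C (od h) t = 0 by move=> bh; apply: cosT_odd; [exact: odN|exact: bod].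
have ipk (T : (R -> R) -> R -> R) u v : bmf u -> bmf v -> bmf (T u) -> bmf (T v) ->
    ip (T u) v = ip u (T v) -> ip (fun t => k * T u t) v = ip u (fun t => k * T v t).
  move=> bu bv bTu bTv H.
  transitivity (k * ip (T u) v).
    by rewrite /ip -intZ; [apply: int_eq => x _; ring|exact: bmfM].
  by rewrite H /ip -intZ; [apply: int_eq => x _; ring|exact: bmfM].
(* A nonzero even part forces [n = 0]; otherwise the odd part carries all the norm and forces
   [m = 0]. *)
have [ee|ee] := ltP 0 (ip (ev f) (ev f) + ip (ev g) (ev g)).
  have bC h : bmf h -> bmf (C h) by exact: bmf_cosT.
  have n0 : n = 0.
    apply: (@symmetric_pair_real (fun h t => k * C h t) (ev f) (ev g) m n) => //; try exact: bev.
    by apply: ipk; try (exact: bev || (apply: bC; exact: bev)); apply: ip_cosT; exact: bev.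
  have mm : -1 <= m <= 1.
    apply: (@contraction_pair C (ev f) (ev g)) => //; try exact: bev.
    - by move=> x; rewrite evN.
    - by move=> x; rewrite evN.
    - by move=> t; rewrite Ce1 n0; ring.
    - by move=> t; rewrite Ce2 n0; ring.
    - by move=> t; rewrite S_ev// expr0n addr0.
    - by move=> t; rewrite S_ev// expr0n addr0.
  by exists m => //; left; rewrite n0.
have oo : 0 < ip (od f) (od f) + ip (od g) (od g).
  have split h : bmf h -> ip h h = ip (ev h) (ev h) + ip (od h) (od h).
    move=> bh; have bo := bod _ bh; have be := bev _ bh.
    have eo : ip (ev h) (od h) = 0.
      by apply: int_odd; [exact: bmfM|move=> x; rewrite evN odN mulrN].
    transitivity (ip (fun x => 1 * ev h x + od h x) (fun x => 1 * ev h x + od h x)).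
      by apply: int_eq => x _; rewrite /ev /od; field.
    by rewrite ip_sqr_lin// eo; ring.
  by move: fg0; rewrite (split f)// (split g)//; lra.
have bS h : bmf h -> bmf (S h) by exact: bmf_sinT.
have m0 : - m = 0.
  apply: (@symmetric_pair_real (fun h t => k * S h t) (od f) (od g) n (- m)) => //; try exact: bod.
  by apply: ipk; try (exact: bod || (apply: bS; exact: bod)); apply: ip_sinT; exact: bod.
have nn : -1 <= n <= 1.
  apply: (@contraction_pair S (od f) (od g)) => //; try exact: bod.
  - by move=> x; rewrite odN mulrNN.
  - by move=> x; rewrite odN mulrNN.
  - by move=> t; rewrite So2 m0; ring.
  - by move=> t; rewrite So1 m0; ring.
  - by move=> t; rewrite C_od// expr0n add0r.
  - by move=> t; rewrite C_od// expr0n add0r.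
by exists n => //; right; move/eqP: m0; rewrite oppr_eq0 => /eqP ->.
Qed.

End EigenvaluesInCross.

(** * Replacing L2 eigenfunctions by bounded ones *)

Section CrossInclusion.
Context {R : realType}.
Local Open Scope complex_scope.
Local Notation mu := (@lebesgue_measure R).
Variable a : R.
Hypothesis a0 : 0 < a.
Local Notation D := (`[- a, a]%classic : set R).
Local Notation k := ((Num.sqrt (2 * pi))^-1 : R).

Let na : - a < a. Proof. by rewrite gtrN. Qed.

Section WaveIntegral.
Variables (b h : R -> R).
Hypotheses (cb : continuous b) (b1 : forall x, `|b x| <= 1)
  (bl : forall x y, `|b x - b y| <= `|x - y|)
  (ih : mu.-integrable D (EFin \o h)).

Let bwave (t : R) : bmf (fun r => b (t * r)).
Proof.
split; last by exists 1 => x; exact: b1.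
by apply: measurableT_comp; [exact: continuous_measurable_fun|exact: measurable_funM].
Qed.

Lemma integrable_bmfM (g : R -> R) : bmf g -> mu.-integrable D (EFin \o (fun r => g r * h r)).
Proof.
move=> [mg [M gM]]; apply: (@integrableMr _ _ R mu D _ g (EFin \o h)) => //.
  exact: measurable_funS mg.
exists M; split; first exact: num_real.
by move=> x Mx y _; exact: le_trans (gM y) (ltW Mx).
Qed.

Let wave_norm (g : R -> R) (M : R) : bmf g -> (forall r, - a <= r <= a -> `|g r| <= M) ->
  `|\int[mu]_(r in D) (g r * h r)| <= M * \int[mu]_(r in D) `|h r|.
Proof.
move=> bg gM; have ig := integrable_bmfM bg.
rewrite (le_trans (le_normr_Rintegral _ ig))//.
have ihn : mu.-integrable D (EFin \o (fun r => `|h r|)) by exact: integrable_norm.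
rewrite -RintegralZl//; apply: le_Rintegral => //.
- exact: integrable_norm ig.
- exact: (integrableZl _ M ihn).
- by move=> r /=; rewrite in_itv/= => rD; rewrite normrM ler_wpM2r// gM.
Qed.

(** An integrable [h] already has a transform bounded by its L1 norm and Lipschitz with constant [a]
    times that norm. *)
Lemma bmf_wave_integral : bmf (fun t => \int[mu]_(r in D) (b (t * r) * h r)).
Proof.
set I := fun t => _; pose N := \int[mu]_(r in D) `|h r|.
have N0 : 0 <= N by exact: Rintegral_ge0.
have IL t u : `|I t - I u| <= a * `|t - u| * N.
  rewrite /I -RintegralB//; [|exact: integrable_bmfM..].
  rewrite (_ : \int[mu]_(x in _) _ = \int[mu]_(r in D) ((b (t * r) - b (u * r)) * h r)).
    apply: wave_norm; first exact: bmfB.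
    move=> r rD; rewrite (le_trans (bl _ _))// -mulrBl normrM mulrC ler_wpM2r//.
    by rewrite ler_norml.
  by apply: eq_Rintegral => r _; ring.
apply: (@bmf_continuous _ _ (1 * N)); last by move=> t; exact: wave_norm.
move=> t; apply/cvgrPdist_le => e e0.
have aN : 0 < a * N + 1 by rewrite ltr_wpDl// mulr_ge0// ltW.
near=> u; rewrite (le_trans (IL _ _))// mulrAC.
apply: (@le_trans _ _ ((a * N + 1) * `|t - u|)).
  by rewrite ler_wpM2r// lerDl.
rewrite mulrC -ler_pdivlMr//.
near: u; apply: cvgr_dist_le; first exact: cvg_id.
by rewrite divr_gt0.
Unshelve. all: by end_near.
Qed.

Lemma wave_integral_ae (g : R -> R) (t : R) : bmf g ->
  {ae lebesgue_measure, forall r : R, `[- a, a]%classic r -> h r = g r} ->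
  \int[mu]_(r in D) (b (t * r) * h r) = \int[mu]_(r in D) (b (t * r) * g r).
Proof.
move=> bg hg; congr fine; apply: ae_eq_integral => //.
- by have /measurable_int := integrable_bmfM (bwave t).
- by have /(bmf_integrable (- a) a)/measurable_int := bmfM (bwave t) bg.
- by apply: ae_imp hg => r H /H /= ->.
Qed.

End WaveIntegral.

Let cos1 (x : R) : `|cos x| <= 1. Proof. by rewrite ler_norml cos_geN1 cos_le1. Qed.
Let sin1 (x : R) : `|sin x| <= 1. Proof. by rewrite ler_norml sin_geN1 sin_le1. Qed.

(** [|u| <= 1 + u^2 + v^2], and constants are integrable on a segment. *)
Lemma L2_integrable (x : R -> R[i]) : inL2 D x ->
  mu.-integrable D (EFin \o (fun t => complex.Re (x t))) /\
  mu.-integrable D (EFin \o (fun t => complex.Im (x t))).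
Proof.
move=> [mr mi x2].
pose n2 t := complex.Re (x t) * complex.Re (x t) + complex.Im (x t) * complex.Im (x t).
have n2E t : Normc.normc (x t) ^+ 2 = n2 t.
  rewrite /n2; case: (x t) => u v /=.
  by rewrite sqr_sqrtr ?addr_ge0 ?sqr_ge0// !expr2.
have mn2 : measurable_fun D n2 by apply: measurable_funD; exact: measurable_funM.
have n20 t : 0 <= n2 t by rewrite addr_ge0// -expr2 sqr_ge0.
have in2 : mu.-integrable D (EFin \o n2).
  apply/integrableP; split; first exact/measurable_EFinP.
  apply: le_lt_trans x2; rewrite le_eqVlt; apply/orP; left; apply/eqP.
  by apply: eq_integral => t _ /=; rewrite n2E ger0_norm.
have i1 : mu.-integrable D (EFin \o (fun=> 1 : R)) by exact: bmf_integrable (bmf_cst 1).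
have id : mu.-integrable D (EFin \o (fun t => 1 + n2 t)).
  by have := integrableD _ i1 in2; apply.
have bound (u v : R) : `|u| <= 1 + (u * u + v * v).
  have := sqr_ge0 (`|u| - 1); have := sqr_ge0 v; have := normr_ge0 u.
  have : `|u| ^+ 2 = u ^+ 2 by rewrite real_normK ?num_real.
  rewrite !expr2; nra.
split; apply: le_integrable id => //; try exact/measurable_EFinP.
- move=> t _ /=; rewrite lee_fin [leRHS]ger0_norm ?(addr_ge0 ler01 (n20 t))//.
  exact: bound.
- move=> t _ /=; rewrite lee_fin [leRHS]ger0_norm ?(addr_ge0 ler01 (n20 t))//.
  by rewrite /n2 [X in _ <= _ + X]addrC; exact: bound.
Qed.

Lemma truncated_Fourier_integrable (x : R -> R[i]) t : inL2 D x ->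
  let fr r := complex.Re (x r) in let fi r := complex.Im (x r) in
  truncated_Fourier a x t =
  (k * (\int[mu]_(r in D) (cos (t * r) * fr r) - \int[mu]_(r in D) (sin (t * r) * fi r))) +i*
  (k * (\int[mu]_(r in D) (sin (t * r) * fr r) + \int[mu]_(r in D) (cos (t * r) * fi r))).
Proof.
move=> /L2_integrable[ir ii] fr fi.
have bc : bmf (fun r => cos (t * r)) by apply: bmf_cos; exact: measurable_funM.
have bs : bmf (fun r => sin (t * r)).
  split; last by exists 1 => r; exact: sin1.
  apply: measurableT_comp; last exact: measurable_funM.
  by apply: continuous_measurable_fun; exact: continuous_sin.
rewrite -RintegralB//; [|exact: integrable_bmfM..].
rewrite -RintegralD//; [|exact: integrable_bmfM..].
transitivity (k%:C *
   (\int[mu]_(r in D) (cos (t * r) * fr r - sin (t * r) * fi r) +i*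
    \int[mu]_(r in D) (sin (t * r) * fr r + cos (t * r) * fi r))).
  rewrite /truncated_Fourier /Cintegral /expi /fr /fi; congr (_ * (_ +i* _));
    apply: eq_Rintegral => r _; case: (x r) => u v //=.
  by rewrite addrC.
by apply/eqP; rewrite eq_complex /= !mul0r subr0 addr0 !eqxx.
Qed.

(** For [lam != 0], [x] agrees almost everywhere with its transform divided by [lam], which is
    bounded; the transform cannot tell the two apart, so the new pair satisfies the equation at
    every point. *)
Lemma eigenvalue_cross (lam : R[i]) :
  eigenvalues D (truncated_Fourier a) lam -> cross lam.
Proof.
have eta (z : R[i]) : z = complex.Re z +i* complex.Im z by case: z.
have [->|lam0] := eqVneq lam 0.
  by move=> _; exists 0; [rewrite lerN10 ler01|left].
move=> [x [x2 x_n0 Fx]].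
have [ir ii] := L2_integrable x2.
pose fr r := complex.Re (x r); pose fi r := complex.Im (x r).
pose X1 t := k * (\int[mu]_(r in D) (cos (t * r) * fr r) - \int[mu]_(r in D) (sin (t * r) * fi r)).
pose X2 t := k * (\int[mu]_(r in D) (sin (t * r) * fr r) + \int[mu]_(r in D) (cos (t * r) * fi r)).
have FE t : truncated_Fourier a x t = X1 t +i* X2 t by exact: truncated_Fourier_integrable.
have bc h : mu.-integrable D (EFin \o h) -> bmf (fun t => \int[mu]_(r in D) (cos (t * r) * h r)).
  by apply: bmf_wave_integral; [exact: continuous_cos|exact: cos1|exact: cos_lipschitz].
have bs h : mu.-integrable D (EFin \o h) -> bmf (fun t => \int[mu]_(r in D) (sin (t * r) * h r)).
  by apply: bmf_wave_integral; [exact: continuous_sin|exact: sin1|exact: sin_lipschitz].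
have bX1 : bmf X1 by apply/bmfZ/bmfB; [exact: bc|exact: bs].
have bX2 : bmf X2 by apply/bmfZ/bmfD; [exact: bs|exact: bc].
pose p := complex.Re lam^-1; pose q := complex.Im lam^-1.
have pq : lam^-1 = p +i* q by exact: eta.
pose Y t := p * X1 t - q * X2 t; pose Z t := p * X2 t + q * X1 t.
have bY : bmf Y by apply: bmfB; exact: bmfZ.
have bZ : bmf Z by apply: bmfD; exact: bmfZ.
have YZ t : X1 t +i* X2 t = lam * (Y t +i* Z t).
  have -> : Y t +i* Z t = lam^-1 * (X1 t +i* X2 t).
    by rewrite pq; apply/eqP; rewrite eq_complex /= !eqxx.
  by rewrite mulrA divff// mul1r.
have xYZ : {ae lebesgue_measure, forall r : R, `[- a, a]%classic r -> x r = Y r +i* Z r}.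
  apply: ae_imp Fx => r H /H; rewrite FE YZ => /(mulfI lam0) ->.
  by [].
have xY : {ae lebesgue_measure, forall r : R, `[- a, a]%classic r -> fr r = Y r}.
  by apply: ae_imp xYZ => r H /H; rewrite /fr => ->.
have xZ : {ae lebesgue_measure, forall r : R, `[- a, a]%classic r -> fi r = Z r}.
  by apply: ae_imp xYZ => r H /H; rewrite /fi => ->.
have cc h t g : mu.-integrable D (EFin \o h) -> bmf g ->
    {ae lebesgue_measure, forall r : R, `[- a, a]%classic r -> h r = g r} ->
    \int[mu]_(r in D) (cos (t * r) * h r) = cosT (- a) a g t.
  by move=> ih bg hg; apply: wave_integral_ae => //; exact: continuous_cos.
have ss h t g : mu.-integrable D (EFin \o h) -> bmf g ->
    {ae lebesgue_measure, forall r : R, `[- a, a]%classic r -> h r = g r} ->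
    \int[mu]_(r in D) (sin (t * r) * h r) = sinT (- a) a g t.
  by move=> ih bg hg; apply: wave_integral_ae => //; exact: continuous_sin.
have X1E t : X1 t = k * (cosT (- a) a Y t - sinT (- a) a Z t).
  by rewrite /X1 (cc _ _ _ ir bY xY) (ss _ _ _ ii bZ xZ).
have X2E t : X2 t = k * (sinT (- a) a Y t + cosT (- a) a Z t).
  by rewrite /X2 (ss _ _ _ ir bY xY) (cc _ _ _ ii bZ xZ).
have [m [n lamE]] : exists m n, lam = m +i* n.
  by exists (complex.Re lam), (complex.Im lam); exact: eta.
have E t : X1 t = m * Y t - n * Z t /\ X2 t = n * Y t + m * Z t.
  have := YZ t; rewrite lamE => /eqP; rewrite eq_complex /= => /andP[/eqP -> /eqP ->].
  by split => //; rewrite addrC.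
rewrite lamE; apply: (@bounded_eigenvalue_cross R a a0 Y Z) => //.
(* If [Y] and [Z] had norm 0, their transforms would vanish everywhere by Cauchy-Schwarz, hence so
   would [Y] and [Z], and [x] would be 0 almost everywhere. *)
- rewrite real_ltNge ?num_real//; apply/negP => H; apply: x_n0.
  have Y0 := ip_ge0 (- a) a Y; have Z0 := ip_ge0 (- a) a Z.
  have zero (g b : R -> R) (t : R) : bmf g -> ip (- a) a g g = 0 -> bmf (fun r => b (t * r)) ->
      \int[mu]_(r in D) (b (t * r) * g r) = 0.
    move=> bg g0 bb; apply/eqP; rewrite -sqrf_eq0 eq_le sqr_ge0 andbT.
    by rewrite (le_trans (int_CS _ _ bb bg))// -/(ip _ _ g g) g0 mulr0.
  have YY : ip (- a) a Y Y = 0 by lra.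
  have ZZ : ip (- a) a Z Z = 0 by lra.
  have bct (t : R) : bmf (fun r => cos (t * r)) by apply: bmf_cos; exact: measurable_funM.
  have bst (t : R) : bmf (fun r => sin (t * r)).
    split; last by exists 1 => r; exact: sin1.
    apply: measurableT_comp; last exact: measurable_funM.
    by apply: continuous_measurable_fun; exact: continuous_sin.
  apply: ae_imp xYZ => r Hr /Hr ->.
  have X10 : X1 r = 0 by rewrite X1E /cosT /sinT !zero// subrr mulr0.
  have X20 : X2 r = 0 by rewrite X2E /cosT /sinT !zero// addr0 mulr0.
  by rewrite /Y /Z X10 X20 !mulr0 subrr addr0.
- by move=> t; rewrite -X1E; have [] := E t.
- by move=> t; rewrite -X2E; have [] := E t.
Qed.

End CrossInclusion.

(** The grid omits 0 and 1, because [corner_eigenvalue] reaches only values strictly between them;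
    points near the ends use [ord0] and [ord_max]. *)
Lemma unit_grid {R : realType} (N : nat) (s : R) : 0 <= s <= 1 ->
  exists j : 'I_N.+1, `|s - j.+1%:R / N.+2%:R| <= N.+2%:R^-1.
Proof.
move=> /andP[s0 s1]; have N0 : 0 < N.+2%:R :> R by rewrite ltr0n.
have reduce (j : nat) : `|s * N.+2%:R - j.+1%:R| <= 1 -> `|s - j.+1%:R / N.+2%:R| <= N.+2%:R^-1.
  move=> H; rewrite -(ler_pM2r N0) mulVf ?gt_eqF// -[X in _ * X](gtr0_norm N0) -normrM.
  by rewrite mulrBl divfK ?gt_eqF.
have /andP[i1 i2] := truncn_itv (mulr_ge0 s0 (ltW N0)).
move: i1 i2; set i := Num.trunc _ => i1 i2.
have sN : s * N.+2%:R <= N.+2%:R by rewrite ler_piMl// ltW.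
have iN : (i <= N.+2)%N by rewrite -(ler_nat R) (le_trans i1).
case: i i1 i2 iN => [|i] i1 i2 iN.
  by exists ord0; apply: reduce => /=; rewrite ler_norml; apply/andP; split; lra.
have [iN1|Ni] := ltnP i N.+1.
  exists (Ordinal iN1); apply: reduce => /=; rewrite ler_norml.
  by move: i2; rewrite -[i.+2%:R]natr1 => i2; apply/andP; split; lra.
exists ord_max; apply: reduce => /=; move: i1; rewrite (_ : i = N.+1); last first.
  by apply/eqP; rewrite eqn_leq Ni andbT.
move: sN; rewrite -[N.+2%:R]natr1 => sN i1.
by rewrite ler_norml; apply/andP; split; lra.
Qed.

Lemma normc_re {R : realType} (x : R) : Normc.normc (x +i* 0)%C = `|x|.
Proof. by rewrite /= expr0n addr0 sqrtr_sqr. Qed.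

Lemma normc_im {R : realType} (x : R) : Normc.normc (0 +i* x)%C = `|x|.
Proof. by rewrite /= expr0n add0r sqrtr_sqr. Qed.

Theorem theorem5p2 (R : realType) (kappa : R) (kappa_gt0 : 0 < kappa) :
  exists A : R, forall a : R, 0 < a -> A <= a ->
    is_net kappa (eigenvalues `[- a, a] (truncated_Fourier a)) (@cross R).
Proof.
(* The grid costs [h] and the eigenvalue [h / 2], within [2 * h <= kappa]. *)
pose N := Num.trunc (2 / kappa); pose h : R := N.+2%:R^-1.
have h0 : 0 < h by rewrite invr_gt0 ltr0n.
have hk : 2 * h <= kappa.
  have /andP[_ kN] := truncn_itv (divr_ge0 (ler0n R 2) (ltW kappa_gt0)).
  rewrite /h ler_pdivrMr ?ltr0n// mulrC -ler_pdivrMr// (le_trans (ltW kN))//.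
  by rewrite ler_nat.
pose s (j : 'I_N.+1) : R := j.+1%:R * h.
have s01 j : 0 < s j < 1.
  rewrite mulr_gt0 ?ltr0n//= /s /h ltr_pdivrMr ?ltr0n// mul1r ltr_nat.
  by rewrite ltnS ltn_ord.
have hs j : 0 < h / 2 < s j.
  rewrite divr_gt0//= (@lt_le_trans _ _ h) ?gtr_pMr ?invf_lt1 ?ltr1n//.
  by rewrite /s ler_peMl ?(ltW h0)// ler1n.
have corner j := cid2 (corner_eigenvalue (s01 j) (hs j)).
pose A j := sval (corner j).
have A0 j : 0 < A j by rewrite /A; case: (corner j).
(* All thresholds are positive, so their sum exceeds each of them. *)
exists (\sum_j A j) => a a0 aA.
have AP j : forall L, A j <= L -> forall w sg, `|sg| = 1 ->
    exists m f, [/\ `|m - sg * s j| <= h / 2, bmf f, 0 < ip 0 L f f &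
      forall t, 0 <= t <= L -> kop 0 L (cker L w) f t = m * f t].
  by rewrite /A; case: (corner j).
split; first by move=> z; exact: eigenvalue_cross.
have main t : -1 <= t <= 1 -> exists sg (j : 'I_N.+1), `|sg| = 1 /\ `|sg * s j - t| <= h.
  move=> t1; have [|j Hj] := @unit_grid R N `|t|.
    by rewrite normr_ge0 ler_norml.
  have [t0|t0] := leP 0 t.
    exists 1, j; split; first exact: normr1.
    by rewrite mul1r distrC -[X in X - _](ger0_norm t0).
  exists (-1), j; split; first by rewrite normrN normr1.
  by rewrite (_ : -1 * s j - t = `|t| - s j)//; rewrite (ltr0_norm t0); ring.
have near_eig w t : -1 <= t <= 1 -> exists m f, [/\ `|t - m| <= kappa, m != 0, bmf f,
    0 < ip 0 a f f & forall u, 0 <= u <= a -> kop 0 a (cker a w) f u = m * f u].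
  move=> /main[sg [j [sg1 Hj]]].
  have ja : A j <= a.
    apply: le_trans aA; rewrite (bigD1 j)//= lerDl; apply: sumr_ge0 => i _; exact: ltW.
  have [m [f [ms bf f0 fE]]] := AP j a ja w sg sg1.
  have /andP[_ hsj] := hs j.
  exists m, f; split => //.
    rewrite (_ : t - m = - (m - sg * s j) - (sg * s j - t)); last by ring.
    by rewrite (le_trans (ler_normB _ _))// normrN (le_trans (lerD ms Hj))//; lra.
  (* The tolerance [h / 2] is smaller than every grid point, which keeps [m] away from 0, as the
     extension to [[- a, a]] requires. *)
  apply/eqP => m0; move: ms; rewrite m0 sub0r normrN normrM sg1 mul1r.
  by have /andP[sj0 _] := s01 j; rewrite gtr0_norm// leNgt hsj.
move=> z [t t1 [->|->]].
- have [m [f [tm m0 bf f0 fE]]] := near_eig 0 t t1.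
  exists (m +i* 0)%C; first exact: (even_eigenvalue a0 bf m0 f0 fE).
  by rewrite (_ : _ - _ = ((t - m) +i* 0)%C) ?normc_re//; apply/eqP; rewrite eq_complex /= subr0 !eqxx.
- have [m [f [tm m0 bf f0 fE]]] := near_eig (pi / 2) t t1.
  exists (0 +i* m)%C; first exact: (odd_eigenvalue a0 bf m0 f0 fE).
  by rewrite (_ : _ - _ = (0 +i* (t - m))%C) ?normc_im//; apply/eqP; rewrite eq_complex /= subr0 !eqxx.
Qed.
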